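(* Let $\Gamma$ be a discrete subgroup of $\mathrm{GL}_2(F_\infty)$ with $\det(\Gamma)\subset\mathcal{O}_\infty^\times$, and let $$P(z)=\sum_{[\gamma]\in H\backslash\Gamma}(\det\gamma)^l\prod_{i=1}^r\gamma^*s(z;a_i,b_i)^{k_i}$$ be a Poincaré series for $\Gamma$ with $r\geqslant 2$ satisfying condition (P). Assume that $\bigcap_{i=1}^r[a_i\to b_i]$ consists of an open edge $e$ and its two endpoints $v,w$ (vertices of $\mathcal{T}$), and that the stabilizer of one of the endpoints, say $v$, in $\Gamma$ is contained in $H$. Let $z\in\Omega$ and $p=\lambda(z)$. Then $\mathrm{ord}_z(P)=0$ if $z$ lies in the $\Gamma$-orbit of $\Omega_v\cup\Omega_e$, and $\mathrm{ord}_z(P)\geqslant t_p>0$ if $z$ does not lie in the $\Gamma$-orbit of $\Omega_v\cup\Omega_e\cup\Omega_w$, where $t_p=1$ if $p$ is a vertex of $\mathcal{T}$ and $t_p$ is the distance from $p$ to the set of vertices of $\mathcal{T}$ otherwise. In particular, $P$ is not identically zero. If moreover $\Gamma_w\subseteq H$, then also $\mathrm{ord}_z(P)=0$ for all $z$ in the $\Gamma$-orbit of $\Omega_w$.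
   Context: $q=p^e$ is an odd prime power (here $p$ is the characteristic), $F=\mathbb{F}_q(T)$, $\pi=1/T$, $F_\infty=\mathbb{F}_q((\pi))$, $\mathcal{O}_\infty=\mathbb{F}_q[[\pi]]$; $\mathbb{C}_\infty$ is the completion of an algebraic closure of $F_\infty$; $\mathrm{ord}$ is the valuation with $\mathrm{ord}(\pi)=1$, extended to $\mathbb{C}_\infty$, and $|x|=q^{-\mathrm{ord}(x)}$. $\Omega=\mathbb{C}_\infty\setminus F_\infty$ is the Drinfeld half-plane, with $\mathrm{GL}_2(F_\infty)$ acting by linear fractional transformations; $|z|_i=\inf\{|z-x|:x\in F_\infty\}$. Tree. $\mathcal{T}$ is the Bruhat–Tits tree of $\mathrm{PGL}_2(F_\infty)$: vertices are homothety classes $[L]$ of rank-two $\mathcal{O}_\infty$-lattices in the row space $F_\infty^2$, adjacent if they have representatives with $\pi L\subset L'\subset L$ (strict); $\gamma[L]=[L\gamma^{-1}]$. $v_n=[\pi^n\mathcal{O}_\infty f_1+\mathcal{O}_\infty f_2]$. Ends of $\mathcal{T}$ are identified $\mathrm{GL}_2(F_\infty)$-equivariantly with $\mathbb{P}^1(F_\infty)$, $(v_n)_{n\geqslant 0}$ representing $\infty$ and $(v_{-n})_{n\geqslant0}$ representing $0$. $[a\to b]$ is the geodesic from $a$ to $b$, viewed in the geometric realization $\mathcal{T}(\mathbb{R})$ (edges of length 1, path metric $d$). An open edge is $\{(1-t)v+tw:0<t<1\}$ with $v,w$ adjacent vertices. The building map $\lambda\colon\Omega\to\mathcal{T}(\mathbb{R})$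 is the unique $\mathrm{GL}_2(F_\infty)$-equivariant map with $\lambda^{-1}((1-t)v_0+tv_{-1})=\{z\in\mathbb{C}_\infty:|z|=|z|_i=q^{-t}\}$ for $t\in[0,1]\cap\mathbb{Q}$; its image is the set of points with rational barycentric coordinates. $\Omega_v=\lambda^{-1}(v)$, $\Omega_e=\lambda^{-1}(e)$, and $\Gamma_v=\{\gamma\in\Gamma:\gamma v=v\}$. Forms. For a $k$-form $\omega=g(z)(\mathrm{d}z)^k$ on $\Omega$, $\mathrm{ord}_z(\omega)=\mathrm{ord}\,g(z)-k\log_q|z|_i$. $s(z;a,b)=\left(\frac1{z-b}-\frac1{z-a}\right)\mathrm{d}z$ (with $\frac{1}{z-\infty}=0$), and $\gamma^*s(z;a,b)=\left(\frac1{\gamma z-b}-\frac1{\gamma z-a}\right)\mathrm{d}(\gamma z)$, which equals $s(z;\gamma^{-1}a,\gamma^{-1}b)$. Poincaré series data. $k_1,\dots,k_r\geqslant1$, $k=\sum k_i$, $l\in\mathbb{Z}$, $H\leqslant\Gamma$ with $\det(h)^l=1$ for all $h\in H$, and $a_i,b_i\in\mathbb{P}^1(F_\infty)$ with $a_i\ne b_i$, $\{a_i,b_i\}\ne\{a_j,b_j\}$ for $i\neq j$, and every $h\in H$ fixing all $a_i,b_i$. Condition (P): for all vertices $v$ of $\mathcal{T}$ and all $N\geqslant0$ the set $\{[\gamma]\in H\backslash\Gamma: d(\gamma v,[a_i\to b_i])\leqslant N\ \forall i\}$ is finite. Under (P) the series converges locally uniformly on $\Omega$ to a holomorphic $k$-form.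 *)

(* Defs.v *)
From HB Require Import structures.
From mathcomp Require Import all_boot all_order all_algebra.
From mathcomp Require Import all_classical all_reals all_analysis.

Set Implicit Arguments.
Unset Strict Implicit.
Unset Printing Implicit Defensive.

Import Order.TTheory GRing.Theory Num.Theory.

Local Open Scope classical_set_scope.
Local Open Scope ring_scope.

Record pseries (K : fieldType) := PSeries { pcoef : nat -> K }.

HB.instance Definition _ (K : fieldType) := gen_eqMixin (pseries K).
HB.instance Definition _ (K : fieldType) := gen_choiceMixin (pseries K).

Section PSeriesRing.
Variable K : fieldType.
Implicit Types f g h : pseries K.

Lemma pseriesP f g : (forall n, pcoef f n = pcoef g n) -> f = g.
Proof.
by case: f g => [f] [g] /= fg; congr PSeries; apply: funext => n; apply: fg.
Qed.

Definition ps0 : pseries K := PSeries (fun=> 0).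
Definition ps1 : pseries K := PSeries (fun n => (n == 0)%:R).
Definition psN f := PSeries (fun n => - pcoef f n).
Definition psD f g := PSeries (fun n => pcoef f n + pcoef g n).
Definition psM f g :=
  PSeries (fun n => \sum_(i < n.+1) pcoef f i * pcoef g (n - i)).

Fact psDA : associative psD.
Proof. by move=> f g h; apply: pseriesP => n /=; rewrite addrA. Qed.
Fact psDC : commutative psD.
Proof. by move=> f g; apply: pseriesP => n /=; rewrite addrC. Qed.
Fact ps0D : left_id ps0 psD.
Proof. by move=> f; apply: pseriesP => n /=; rewrite add0r. Qed.
Fact psND : left_inverse ps0 psN psD.
Proof. by move=> f; apply: pseriesP => n /=; rewrite addNr. Qed.

HB.instance Definition _ :=
  GRing.isZmodule.Build (pseries K) psDA psDC ps0D psND.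

Definition ps_trunc m f : {poly K} := \poly_(i < m) pcoef f i.

Lemma psM_trunc m n f g : (n < m)%N ->
  pcoef (psM f g) n = (ps_trunc m f * ps_trunc m g)`_n.
Proof.
move=> nm; rewrite coefM /=; apply: eq_bigr => -[i /= ltin] _.
by rewrite !coef_poly (leq_ltn_trans (leq_subr _ _) nm) (leq_trans ltin nm).
Qed.

Fact psMC : commutative psM.
Proof.
by move=> f g; apply: pseriesP => n; rewrite !(@psM_trunc n.+1)// mulrC.
Qed.

Lemma psM_truncr m n f (p : {poly K}) g : (n < m)%N ->
  (forall i, (i <= n)%N -> pcoef g i = p`_i) ->
  pcoef (psM f g) n = (ps_trunc m f * p)`_n.
Proof.
move=> nm gp; rewrite coefM /=; apply: eq_bigr => -[i /= ltin] _.
by rewrite !coef_poly (leq_trans ltin nm) gp// leq_subr.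
Qed.

Fact psMA : associative psM.
Proof.
move=> f g h; apply: pseriesP => n.
rewrite (psMC (psM f g) h).
rewrite (@psM_truncr n.+1 _ _ (ps_trunc n.+1 g * ps_trunc n.+1 h))//; last first.
  by move=> i le_in; rewrite (@psM_trunc n.+1).
rewrite (@psM_truncr n.+1 _ _ (ps_trunc n.+1 f * ps_trunc n.+1 g))//; last first.
  by move=> i le_in; rewrite (@psM_trunc n.+1).
by rewrite [in RHS]mulrC mulrA.
Qed.

Fact ps1M : left_id ps1 psM.
Proof.
move=> f; apply: pseriesP => n /=.
by rewrite big_ord_recl /= mul1r subn0 big1 ?addr0// => i _; rewrite mul0r.
Qed.

Fact psMDl : left_distributive psM psD.
Proof.
move=> f g h; apply: pseriesP => n /=.
by rewrite -big_split /=; apply: eq_bigr => i _; rewrite mulrDl.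
Qed.

Fact ps1_neq0 : ps1 != 0.
Proof.
apply/eqP => /(congr1 (fun f => pcoef f 0%N)) /= /eqP.
by rewrite oner_eq0.
Qed.

HB.instance Definition _ :=
  GRing.Zmodule_isComNzRing.Build (pseries K) psMA psMC ps1M psMDl ps1_neq0.

Definition ps_unit : {pred pseries K} :=
  fun f => `[< exists g, g * f = 1 >].
Definition ps_inv f :=
  if f \in ps_unit then xget f [set g | g * f = 1] else f.

Fact psVM : {in ps_unit, left_inverse 1 ps_inv *%R}.
Proof.
move=> f fU; rewrite /ps_inv fU; case: xgetP => // nog.
by move/asboolP: fU => [g gf]; case: (nog g).
Qed.
Fact ps_unitPl f g : g * f = 1 -> ps_unit f.
Proof. by move=> gf; apply/asboolP; exists g. Qed.
Fact ps_inv_out : {in [predC ps_unit], ps_inv =1 id}.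
Proof. by move=> f; rewrite inE /= /ps_inv => /negbTE ->. Qed.

HB.instance Definition _ := GRing.ComNzRing_hasMulInverse.Build (pseries K)
  psVM ps_unitPl ps_inv_out.

Lemma ps_neq0P f : f != 0 ->
  exists n, pcoef f n != 0 /\ forall m, (m < n)%N -> pcoef f m = 0.
Proof.
move=> f0; have exf : exists n, pcoef f n != 0.
  apply: contrapT => nof; move/eqP: f0; apply; apply: pseriesP => n /=.
  by apply/eqP; apply: contrapT => fn; apply: nof; exists n; apply/negP.
case: (ex_minnP exf) => n fn minn; exists n; split=> // m lt_mn.
by apply/eqP; apply: contraLR lt_mn => fm; rewrite -leqNgt minn.
Qed.

Fact ps_integral : GRing.integral_domain_axiom (pseries K).
Proof.
move=> f g fg0; apply/norP => -[/ps_neq0P[m [fm mf]] /ps_neq0P[n [gn ng]]].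
have := congr1 (fun h => pcoef h (m + n)%N) fg0.
have ltm : (m < (m + n).+1)%N by rewrite ltnS leq_addr.
rewrite /= (bigD1 (Ordinal ltm))//= addKn big1 ?addr0; last first.
  move=> [i /= lti]; rewrite -val_eqE /= neq_ltn => /orP[im|mi].
    by rewrite mf// mul0r.
  rewrite ng ?mulr0// -(ltn_add2l i) subnKC 1?ltn_add2r//.
by move/eqP; rewrite mulf_eq0 (negbTE fm) (negbTE gn).
Qed.

HB.instance Definition _ :=
  GRing.ComUnitRing_isIntegral.Build (pseries K) ps_integral.

End PSeriesRing.

(* K((pi)), as the fraction field of K[[pi]]. *)
Notation laurent K := {fraction (pseries K)}.

Section LaurentIntegers.
Variable K : fieldType.

Definition of_ps (f : pseries K) : laurent K := tofrac f.

Definition uniformizer : laurent K := of_ps (PSeries (fun n => (n == 1)%:R)).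

Definition Oinf : set (laurent K) := range of_ps.

Definition Oinf_units : set (laurent K) :=
  [set of_ps f | f in [set f | f \is a GRing.unit]].

End LaurentIntegers.

(* A completion C of an algebraic closure A of K((pi)), with the extension to C
   of the valuation of K((pi)), normalized by ord pi = 1. *)
Record Cinfty (R : realType) (K : finFieldType) := MkCinfty {
  Cinf_closure : closedFieldType;
  Cinf_sort :> fieldType;
  Cinf_alg : {rmorphism laurent K -> Cinf_closure};
  Cinf_incl : {rmorphism Cinf_closure -> Cinf_sort};
  ord : Cinf_sort -> \bar R;
  Cinf_algebraic : forall x : Cinf_closure, algebraicOver Cinf_alg x;
  ord_eqy : forall x, ord x = +oo%E <-> x = 0;
  ord_neqNy : forall x, ord x <> -oo%E;
  ordM : forall x y, ord (x * y) = (ord x + ord y)%E;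
  ordD : forall x y, (Order.min (ord x) (ord y) <= ord (x + y)%R)%E;
  ord_series : forall (f : pseries K) (n : nat),
    (forall m, (m < n)%N -> pcoef f m = 0) -> pcoef f n != 0 ->
    ord (Cinf_incl (Cinf_alg (of_ps f))) = n%:R%:E;
  Cinf_dense : forall (x : Cinf_sort) (M : R),
    exists y : Cinf_closure, (M%:E <= ord (x - Cinf_incl y)%R)%E;
  Cinf_complete : forall u : nat -> Cinf_sort,
    (forall M : R, exists N, forall m n, (N <= m)%N -> (N <= n)%N ->
       (M%:E <= ord (u m - u n)%R)%E) ->
    exists l, forall M : R, exists N, forall n, (N <= n)%N ->
       (M%:E <= ord (u n - l)%R)%E
}.

(* [None] is the point at infinity. *)
Definition P1 (K : fieldType) : Type := option (laurent K).

Section GL2.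
Variable K : fieldType.
Local Notation F := (laurent K).
Local Notation i0 := (ord0 : 'I_2).
Local Notation i1 := (ord_max : 'I_2).

Definition mobP1 (g : 'M[F]_2) (x : P1 K) : P1 K :=
  match x with
  | None => if g i1 i0 == 0 then None else Some (g i0 i0 / g i1 i0)
  | Some y => if g i1 i0 * y + g i1 i1 == 0 then None
              else Some ((g i0 i0 * y + g i0 i1) / (g i1 i0 * y + g i1 i1))
  end.

Definition GL2_subgroup (G : set 'M[F]_2) :=
  [/\ forall g, G g -> g \in unitmx, G 1%:M,
      forall g h, G g -> G h -> G (g *m h) & forall g, G g -> G (invmx g)].

Definition rcoset_of (H : set 'M[F]_2) (g : 'M[F]_2) : set 'M[F]_2 :=
  [set h *m g | h in H].

Definition rcosets_of (H G : set 'M[F]_2) : set (set 'M[F]_2) :=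
  [set rcoset_of H g | g in G].

End GL2.

Section Tree.
Variables (R : realType) (K : fieldType).
Local Notation F := (laurent K).

Definition Ospan (f1 f2 : 'rV[F]_2) : set 'rV[F]_2 :=
  [set x | exists c1 c2, [/\ Oinf c1, Oinf c2 & x = c1 *: f1 + c2 *: f2]].

Definition lattice (L : set 'rV[F]_2) :=
  exists f1 f2, row_free (col_mx f1 f2) /\ L = Ospan f1 f2.

Definition scale_lat (c : F) (L : set 'rV[F]_2) : set 'rV[F]_2 :=
  [set c *: x | x in L].

(* Vertices are homothety classes of lattices; elements of [vert] that do not
   satisfy [is_vertex] are never used. *)
Definition vert : Type := set (set 'rV[F]_2).

Definition hclass (L : set 'rV[F]_2) : vert :=
  [set L' | exists c, c != 0 /\ L' = scale_lat c L].

Definition is_vertex (v : vert) := exists L, lattice L /\ v = hclass L.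

Definition adj (v w : vert) :=
  exists L L', [/\ lattice L, lattice L', v = hclass L, w = hclass L' &
    scale_lat (uniformizer K) L `<` L' /\ L' `<` L].

(* g [L] = [L g^-1] *)
Definition act_vert (g : 'M[F]_2) (v : vert) : vert :=
  [set [set x *m invmx g | x in L] | L in v].

Definition std_vertex (n : int) : vert :=
  hclass (Ospan (uniformizer K ^ n *: delta_mx 0 ord0) (delta_mx 0 ord_max)).

(* A point of the geometric realization is given by its barycentric
   coordinates, as a function on the vertices. *)
Definition tpoint : Type := vert -> R.

Definition bary (v w : vert) (t : R) : tpoint :=
  fun u => (1 - t) * `[< u = v >]%:R + t * `[< u = w >]%:R.

Definition vpoint (v : vert) : tpoint := fun u => `[< u = v >]%:R.

Definition realization : set tpoint :=
  [set x | exists v w t, [/\ adj v w, 0 <= t <= 1 & x = bary v w t]].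

Definition vertex_points : set tpoint := [set vpoint v | v in is_vertex].

Definition open_edge (v w : vert) : set tpoint :=
  [set bary v w t | t in [set t | 0 < t < 1]].

Definition act_pt (g : 'M[F]_2) (x : tpoint) : tpoint :=
  fun u => x (act_vert (invmx g) u).

(* Length of a path made of finitely many segments, each inside a closed edge;
   [tdist] is the resulting path metric. *)
Inductive path_length : tpoint -> tpoint -> R -> Prop :=
| path_nil x : path_length x x 0
| path_cons v w s t z L : adj v w -> 0 <= s <= 1 -> 0 <= t <= 1 ->
    path_length (bary v w t) z L ->
    path_length (bary v w s) z (`|s - t| + L).

Definition tdist (x y : tpoint) : R := inf [set L | path_length x y L].

Definition tdist_set (x : tpoint) (A : set tpoint) : R :=
  inf [set tdist x y | y in A].

Definition tp (p : tpoint) : R :=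
  if `[< vertex_points p >] then 1 else tdist_set p vertex_points.

Definition ray (rho : nat -> vert) :=
  (forall n, adj (rho n) (rho n.+1)) /\ injective rho.

Definition same_end (rho rho' : nat -> vert) :=
  exists m n, forall i, rho (m + i)%N = rho' (n + i)%N.

(* The GL_2-equivariant identification of ends with points of P^1 for which
   (v_n)_{n >= 0} represents infinity. *)
Definition represents (rho : nat -> vert) (x : P1 K) :=
  ray rho /\ exists g : 'M[F]_2, [/\ g \in unitmx, mobP1 g None = x &
    same_end rho (fun n => act_vert g (std_vertex n%:Z))].

Definition line_between (a b : P1 K) (l : int -> vert) :=
  [/\ forall n, adj (l n) (l (n + 1)), injective l,
      represents (fun n => l (- n%:Z)) a & represents (fun n => l n%:Z) b].

Definition geodesic (a b : P1 K) : set tpoint :=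
  [set x | exists l n t, [/\ line_between a b l, 0 <= t <= 1 &
                             x = bary (l n) (l (n + 1)) t]].

End Tree.

Section HalfPlane.
Variables (R : realType) (K : finFieldType) (C : Cinfty R K).
Local Notation F := (laurent K).
Local Notation i0 := (ord0 : 'I_2).
Local Notation i1 := (ord_max : 'I_2).
Local Notation q := (#|K|%:R : R).

Definition emb (x : F) : C := Cinf_incl C (Cinf_alg C x).

Definition absC (x : C) : R :=
  if x == 0 then 0 else q `^ (- fine (ord x)).

(* |z|_i *)
Definition imabs (z : C) : R := inf (range (fun x : F => absC (z - emb x))).

Definition Omega : set C := ~` range emb.

Definition mob (g : 'M[F]_2) (z : C) : C :=
  (emb (g i0 i0) * z + emb (g i0 i1)) / (emb (g i1 i0) * z + emb (g i1 i1)).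

Definition orbit_of (G : set 'M[F]_2) (S : set C) : set C :=
  [set z | exists g y, [/\ G g, S y & z = mob g y]].

Definition discrete_in_GL2 (G : set 'M[F]_2) :=
  forall g, G g -> exists2 eps : R, 0 < eps &
    forall h, G h -> (forall i j, absC (emb (h i j - g i j)) < eps) -> h = g.

(* Every point of Omega is GL_2-equivalent to some z with |z| = |z|_i = q^(-t),
   t rational in [0, 1], so these properties determine [lam] on Omega; its values
   outside Omega are irrelevant. *)
Definition building_map (lam : C -> tpoint R K) :=
  [/\ forall z, Omega z -> realization (lam z),
      forall (g : 'M[F]_2) z, g \in unitmx -> Omega z ->
        lam (mob g z) = act_pt g (lam z)
    & forall t : rat, 0 <= t <= 1 ->
        Omega `&` lam @^-1` [set bary (std_vertex 0) (std_vertex (-1)) (ratr t)]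
        = [set z | absC z = imabs z /\ imabs z = q `^ (- ratr t)]].

(* A k-form g(z) (dz)^k is represented by its coefficient g. *)
Definition ord_form (k : nat) (g : C -> C) (z : C) : \bar R :=
  (ord (g z) - (k%:R * (ln (imabs z) / ln q))%:E)%E.

(* 1 / (z - b), with 1 / (z - infinity) = 0. *)
Definition pole (b : P1 K) (z : C) : C :=
  match b with None => 0 | Some y => (z - emb y)^-1 end.

(* The coefficient of the 1-form s(z; a, b). *)
Definition sform (a b : P1 K) (z : C) : C := pole b z - pole a z.

(* g^*(f(z) dz) = f(g z) d(g z), where d(g z) = det g / (c z + d)^2 dz for g
   with bottom row (c, d). *)
Definition pullback (g : 'M[F]_2) (f : C -> C) (z : C) : C :=
  f (mob g z) * (emb (\det g) / (emb (g i1 i0) * z + emb (g i1 i1)) ^+ 2).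

(* Unconditional summability of the family (f i)_{i in D}; [usum] is 0 for
   families that are not summable. *)
Definition has_sum (I : choiceType) (D : set I) (f : I -> C) (s : C) :=
  forall M : R, exists A : set I, [/\ finite_set A, A `<=` D &
    forall B : set I, finite_set B -> A `<=` B -> B `<=` D ->
      (M%:E <= ord (s - \sum_(i \in B) f i)%R)%E].

Definition usum (I : choiceType) (D : set I) (f : I -> C) : C :=
  xget 0 [set s | has_sum D f s].

Section Poincare.
Variables (G H : set 'M[F]_2) (r : nat) (l : int).
Variables (k : 'I_r -> nat) (a b : 'I_r -> P1 K).

Definition conditionP :=
  forall v, is_vertex v -> forall N : nat,
    finite_set [set X | exists g, [/\ G g, X = rcoset_of H g &
      forall i, tdist_set (vpoint R (act_vert g v)) (geodesic (a i) (b i))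
                <= N%:R]].

Definition poincare_term (g : 'M[F]_2) (z : C) : C :=
  emb (\det g ^ l) * \prod_(i < r) pullback g (sform (a i) (b i)) z ^+ k i.

(* The coefficient of the k-form P; a coset contributes the term of an
   arbitrary representative. *)
Definition poincare (z : C) : C :=
  usum (rcosets_of H G) (fun X => poincare_term (xget 1%:M X) z).

End Poincare.

End HalfPlane.

Arguments Omega {R K C}.

(* Main.v *)
(* The order at z of the form s(z; a, b) is the distance from lam z to the
   geodesic joining a and b: both are GL_2-equivariant, and when
   |z| = |z|_i = q^-t both are given by the same explicit expression [defect] in
   a matrix with columns representing b and a.  So, normalized by the power of
   |z|_i, every term of the series has absolute value at most 1 at z, with
   equality exactly when the translate of lam z lies on all the geodesics, that
   is, on the closed edge; condition (P) makes the terms tend to 0.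
   If lam z is a translate of v or of a point of e, then, since the group
   preserves the types of vertices and the stabilizer of v is in H, this happens
   for exactly one coset, whose term dominates the sum by the ultrametric
   inequality.  If lam z is not in the orbit of the closed edge, every term has a
   factor of positive order, and this order is at least t_p because a geodesic is
   a subcomplex of the tree. *)
Require Import Defs.
From HB Require Import structures.
From mathcomp Require Import all_boot all_order all_algebra.
From mathcomp Require Import all_classical all_reals all_analysis.
From mathcomp Require Import zify ring lra.

Set Implicit Arguments.
Unset Strict Implicit.
Unset Printing Implicit Defensive.

Import Order.TTheory GRing.Theory Num.Theory.

Local Open Scope classical_set_scope.
Local Open Scope ring_scope.

(** * The valuation of Laurent series *)

(** The expression [defect] depends only on [invmx g *m h], where [g] places the point of the tree
    and the columns of [h] represent the ends, so statements about the tree become valuation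
    estimates for one two by two matrix. The obstacle is that [geodesic] quantifies over arbitrary
    lines with prescribed ends and that [tdist] is an infimum over paths. Three facts link them to
    the matrix: the defect is 1 exactly on the geodesic; its logarithm bounds from above the
    distance of a vertex to the geodesic, which is what condition (P) takes as input; and it never
    lies strictly between 1 and [q] to the power [t_p]. The last one comes from the value group of
    [F] being the integral powers of [q]: on an edge the logarithm of the defect is [n], [n + t] or
    [n - t] with [n] an integer. The building map is specified only at rational parameters of one
    edge. Bringing an arbitrary [z] there uses that [F] is closed in [C] (so [|z|_i > 0]), that its
    value group is discrete (so the infimum is attained), and that algebraic elements are dense (so
    [log_q |z|] is rational). *)

Section PowerSeriesUnits.
Variable K : fieldType.
Implicit Types f : Defs.pseries K.

(** The first [n] coefficients of [1 / f]. Each coefficient depends on all earlier ones; carrying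
    them in a list makes the recursion structural. *)
Fixpoint inv_coefs f n : seq K :=
  if n is m.+1 then
    rcons (inv_coefs f m)
      (((m == 0)%:R - \sum_(i < m) (inv_coefs f m)`_i * pcoef f (m - i))
         / pcoef f 0)
  else [::].

Lemma size_inv_coefs f n : size (inv_coefs f n) = n.
Proof. by elim: n => //= n IHn; rewrite size_rcons IHn. Qed.

Lemma nth_inv_coefs f n i : (i < n)%N ->
  (inv_coefs f n)`_i = (inv_coefs f i.+1)`_i.
Proof.
elim: n => // n IHn; rewrite ltnS leq_eqVlt => /orP[/eqP-> //|lt_in].
by rewrite /= !nth_rcons !size_inv_coefs lt_in ltnn eqxx IHn //= nth_rcons
  size_inv_coefs ltnn eqxx.
Qed.

Lemma ps_unit_coef0 f : pcoef f 0 != 0 -> f \is a GRing.unit.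
Proof.
move=> f0; apply/asboolP.
exists (PSeries (fun n => (inv_coefs f n.+1)`_n)); apply: pseriesP => n /=.
rewrite big_ord_recr /= subnn nth_rcons size_inv_coefs ltnn eqxx divfK//.
under eq_bigr => i _.
  rewrite nth_rcons size_inv_coefs ltnn eqxx; over.
rewrite [X in _ + (_ - X)](eq_bigr (fun i : 'I_n =>
  (inv_coefs f i.+1)`_i * pcoef f (n - i))); last first.
  by move=> i _; rewrite nth_inv_coefs.
rewrite [X in X + _](eq_bigr (fun i : 'I_n =>
  (inv_coefs f i.+1)`_i * pcoef f (n - i))); last first.
  by move=> i _ /=; rewrite nth_rcons size_inv_coefs ltnn eqxx.
by rewrite addrCA subrr addr0.
Qed.

Lemma coef0_unit f : f \is a GRing.unit -> pcoef f 0 != 0.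
Proof.
move=> /unitrP[g [gf _]]; apply/eqP => f0.
have /= := congr1 (fun h : Defs.pseries K => pcoef h 0%N) gf.
rewrite big_ord_recl big_ord0 addr0 /= f0 mulr0 => /esym/eqP.
by rewrite oner_eq0.
Qed.

Lemma pcoef_Xmul f n :
  pcoef (PSeries (fun n => (n == 1)%:R) * f) n = if n is m.+1 then pcoef f m else 0.
Proof.
rewrite /=; case: n => [|n]; first by rewrite big_ord_recl big_ord0 mul0r addr0.
rewrite big_ord_recl /= mul0r add0r big_ord_recl /= mul1r subn1 /= big1 ?addr0//.
by move=> i _; rewrite mul0r.
Qed.

Lemma pcoef_Xn_mul f m n : pcoef (PSeries (fun n => (n == 1)%:R) ^+ m * f) n
  = if (n < m)%N then 0 else pcoef f (n - m).
Proof.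
elim: m n => [|m IHm] n; first by rewrite mul1r subn0.
by rewrite exprS -mulrA pcoef_Xmul; case: n => // n; rewrite IHm.
Qed.

Lemma ps_factor f n : (forall m, (m < n)%N -> pcoef f m = 0) ->
  f = PSeries (fun n => (n == 1)%:R) ^+ n * PSeries (fun m => pcoef f (n + m)).
Proof.
move=> f0; apply: pseriesP => m; rewrite pcoef_Xn_mul /=.
by case: ltnP => [/f0 //|le_nm]; rewrite subnKC.
Qed.

Lemma uniformizer_neq0 : uniformizer K != 0.
Proof.
rewrite /uniformizer /of_ps tofrac_eq0; apply/eqP => /(congr1 (fun f => pcoef f 1%N)).
by move=> /= /eqP; rewrite oner_eq0.
Qed.

(** Opens the quotient construction of [{fraction _}]: a class has a numerator and a denominator,
    and its product with the denominator is computed on representatives. *)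
Lemma frac_quotient (x : laurent K) : exists f g : Defs.pseries K,
  g != 0 /\ x = of_ps f / of_ps g.
Proof.
rewrite /of_ps; elim/quotW: x => x; exists (frac x).1, (frac x).2.
have dx : (frac x).2 != 0 by apply: denom_ratioP.
have tx : FracField.tofrac (frac x).2 != 0 by rewrite tofrac_eq0.
split=> //; apply: (mulIf tx); rewrite divfK//.
rewrite /FracField.tofrac; unlock.
rewrite -[LHS]FracField.pi_mul; apply/eqmodP.
by rewrite /= FracField.equivfE /FracField.mulf !numden_Ratio ?mulf_neq0 ?oner_eq0//
  !mulr1 mulrC.
Qed.

(** Numerator and denominator are each a power of the uniformizer times a series with nonzero
    constant term, and such a series is invertible. *)
Lemma laurent_factor (x : laurent K) : x != 0 -> exists (n : int) u,
  u \is a GRing.unit /\ x = uniformizer K ^ n * of_ps u.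
Proof.
have unif := uniformizer_neq0.
have fact f : f != 0 -> exists (n : nat) u,
    u \is a GRing.unit /\ of_ps f = uniformizer K ^+ n * of_ps u.
  move=> /ps_neq0P[n [fn fm]]; exists n, (PSeries (fun m => pcoef f (n + m))).
  split; first by apply: ps_unit_coef0; rewrite /= addn0.
  by rewrite {1}(ps_factor fm) /of_ps rmorphM rmorphXn.
have [f [g [g0 ->]]] := frac_quotient x.
move=> fg0; have f0 : f != 0.
  by apply: contraNneq fg0 => ->; rewrite /of_ps rmorph0 mul0r.
have [[m [u [uU ->]]] [n [v [vU ->]]]] := (fact _ f0, fact _ g0).
exists (m%:Z - n%:Z), (u / v); split; first by rewrite unitrM unitrV uU.
rewrite expfzDr// -invr_expz -!exprnP /of_ps rmorphM/= rmorphV// invfM.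
by rewrite mulrACA.
Qed.

End PowerSeriesUnits.

(** * The ultrametric absolute value on the completed field *)

Section AbsoluteValue.
Variables (R : realType) (K : finFieldType) (C : Cinfty R K).
Local Notation q := (#|K|%:R : R).
Implicit Types x y : C.

Lemma q_gt1 : 1 < q.
Proof. by rewrite ltr1n finalg.card_finNzRing_gt1. Qed.

Lemma q_gt0 : 0 < q. Proof. exact: lt_trans q_gt1. Qed.
Lemma q_neq0 : q != 0. Proof. exact: lt0r_neq0 q_gt0. Qed.

Lemma fine_ord x : x != 0 -> ord x = (fine (ord x))%:E.
Proof.
move=> x0; rewrite fineK// fin_numE; apply/andP; split; apply/eqP.
  exact: ord_neqNy.
by move/ord_eqy => /eqP; rewrite (negbTE x0).
Qed.

Lemma absC_eq0 x : (absC x == 0) = (x == 0).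
Proof.
rewrite /absC; case: ifPn => [_|x0]; first by rewrite eqxx.
by rewrite gt_eqF// powR_gt0// q_gt0.
Qed.

Lemma absC0 : absC (0 : C) = 0. Proof. by apply/eqP; rewrite absC_eq0. Qed.

Lemma absC_ge0 x : 0 <= absC x.
Proof. by rewrite /absC; case: ifP => // _; exact: powR_ge0. Qed.

Lemma absC_gt0 x : (0 < absC x) = (x != 0).
Proof. by rewrite lt_neqAle absC_ge0 andbT eq_sym absC_eq0. Qed.

Lemma absCM x y : absC (x * y) = absC x * absC y.
Proof.
have [->|x0] := eqVneq x 0; first by rewrite mul0r absC0 mul0r.
have [->|y0] := eqVneq y 0; first by rewrite mulr0 absC0 mulr0.
rewrite /absC mulf_eq0 (negbTE x0) (negbTE y0) /= -powRD; last first.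
  by rewrite q_neq0 implybT.
by rewrite ordM (fine_ord x0) (fine_ord y0) /= opprD.
Qed.

Lemma absC_powR x (M : R) : (absC x <= q `^ (- M)) = (M%:E <= ord x)%E.
Proof.
have [->|x0] := eqVneq x 0.
  by rewrite absC0 powR_ge0 (_ : ord 0 = +oo)%E ?leey//; apply/ord_eqy.
rewrite /absC (negbTE x0) (fine_ord x0) /= lee_fin.
rewrite -(ler_ln (powR_gt0 _ q_gt0) (powR_gt0 _ q_gt0)) !ln_powR.
by rewrite ler_pM2r ?lerN2// ln_gt0// q_gt1.
Qed.

Lemma absC1 : absC (1 : C) = 1.
Proof.
have := absCM 1 1; rewrite mulr1 -{1}[absC 1]mulr1 => /mulfI -> //.
by rewrite absC_eq0 oner_eq0.
Qed.

Lemma absCX x n : absC (x ^+ n) = absC x ^+ n.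
Proof. by elim: n => [|n IHn]; rewrite ?expr0 ?absC1// !exprS absCM IHn. Qed.

Lemma absCV x : absC x^-1 = (absC x)^-1.
Proof.
have [->|x0] := eqVneq x 0; first by rewrite invr0 absC0 invr0.
have ax : absC x != 0 by rewrite absC_eq0.
by apply: (mulIf ax); rewrite -absCM !mulVf// absC1.
Qed.

Lemma absCN x : absC (- x) = absC x.
Proof.
have N1 : absC (-1 : C) = 1.
  have : absC (-1 : C) ^+ 2 == 1 by rewrite -absCX sqrrN expr1n absC1.
  by rewrite sqrf_eq1 => /orP[/eqP //|/eqP N1]; move: (absC_ge0 (-1)); rewrite N1 ler0N1.
by rewrite -mulN1r absCM N1 mul1r.
Qed.

Lemma absCB x y : absC (x - y) = absC (y - x).
Proof. by rewrite -absCN opprB. Qed.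

(** A common bound [c] replaces the maximum of the ultrametric inequality, so that the estimate
    passes to finite sums unchanged. *)
Lemma absCD_le x y (c : R) : absC x <= c -> absC y <= c -> absC (x + y) <= c.
Proof.
have [->|x0] := eqVneq x 0; first by rewrite add0r.
have [->|y0] := eqVneq y 0; first by rewrite addr0.
move=> xc yc; have [->|xy0] := eqVneq (x + y) 0.
  by rewrite absC0 (le_trans (absC_ge0 x)).
wlog le_xy : x y x0 y0 xc yc xy0 / (ord x <= ord y)%E => [hw|].
  by have [?|/ltW ?] := leP (ord x) (ord y); [|rewrite addrC]; apply: hw; rewrite // addrC.
apply: le_trans xc; rewrite {2}/absC (negbTE x0) absC_powR -fine_ord//.
by apply: le_trans (ordD x y); rewrite le_min lexx.
Qed.

Lemma absCD_lt x y (c : R) : absC x < c -> absC y < c -> absC (x + y) < c.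
Proof.
move=> xc yc; apply: (@le_lt_trans _ _ (Num.max (absC x) (absC y))).
  by apply: absCD_le; rewrite le_max lexx ?orbT.
by rewrite gt_max xc.
Qed.

Lemma absC_sum_le (I : Type) (r : seq I) (P : pred I) (f : I -> C) (c : R) :
  0 <= c -> (forall i, P i -> absC (f i) <= c) -> absC (\sum_(i <- r | P i) f i) <= c.
Proof.
move=> c0 fc; elim/big_ind: _ => //; first by rewrite absC0.
by move=> x y; exact: absCD_le.
Qed.

(** Otherwise [x = (x + y) - y] would be a sum of two elements smaller than [x]. *)
Lemma absCD_dominant x y : absC y < absC x -> absC (x + y) = absC x.
Proof.
move=> yx; apply/eqP; rewrite eq_le absCD_le ?(ltW yx)//=.
rewrite leNgt; apply/negP => h.
have : absC ((x + y) - y) < absC x by apply: absCD_lt; rewrite ?absCN.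
by rewrite addrK ltxx.
Qed.

HB.instance Definition _ := GRing.RMorphism.copy (emb C) (Cinf_incl C \o Cinf_alg C).

Definition absF (x : laurent K) : R := absC (emb C x).

End AbsoluteValue.

Section LaurentAbsoluteValue.
Variables (R : realType) (K : finFieldType) (C : Cinfty R K).
Local Notation q := (#|K|%:R : R).
Local Notation absF := (absF C).
Implicit Types x y : laurent K.

Lemma absF_eq0 x : (absF x == 0) = (x == 0).
Proof. by rewrite /absF absC_eq0 fmorph_eq0. Qed.
Lemma absF0 : absF 0 = 0. Proof. by rewrite /absF rmorph0 absC0. Qed.
Lemma absF_ge0 x : 0 <= absF x. Proof. exact: absC_ge0. Qed.
Lemma absFM x y : absF (x * y) = absF x * absF y.
Proof. by rewrite /absF rmorphM absCM. Qed.
Lemma absFV x : absF x^-1 = (absF x)^-1.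
Proof. by rewrite /absF fmorphV absCV. Qed.
Lemma absFX x n : absF (x ^+ n) = absF x ^+ n.
Proof. by rewrite /absF rmorphXn absCX. Qed.
Lemma absFXz x (n : int) : absF (x ^ n) = absF x ^ n.
Proof. by case: n => n; rewrite ?NegzE ?exprnN ?absFV absFX. Qed.
Lemma absFD_le x y c : absF x <= c -> absF y <= c -> absF (x + y) <= c.
Proof. by rewrite /absF rmorphD; exact: absCD_le. Qed.

Lemma absF_series (f : Defs.pseries K) n :
  (forall m, (m < n)%N -> pcoef f m = 0) -> pcoef f n != 0 ->
  absF (of_ps f) = q ^- n.
Proof.
move=> f0 fn; have := ord_series C f0 fn; rewrite -/(emb C _) => ordf.
have f_neq0 : emb C (of_ps f) != 0.
  by apply/eqP => /ord_eqy; rewrite ordf.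
by rewrite /absF /absC (negbTE f_neq0) ordf /= powRN powR_mulrn// ltW// q_gt0.
Qed.

Lemma absF_unit (u : Defs.pseries K) : u \is a GRing.unit -> absF (of_ps u) = 1.
Proof. by move=> /coef0_unit u0; rewrite (@absF_series _ 0)// expr0 invr1. Qed.

Lemma absF_unif : absF (uniformizer K) = q^-1.
Proof.
rewrite (@absF_series _ 1)//; last by rewrite /= oner_eq0.
by case=> //= n; rewrite ltnS.
Qed.

Lemma absF_disc x : x != 0 -> exists n : int, absF x = q ^ n.
Proof.
move=> /laurent_factor[n [u [uU ->]]]; exists (- n).
by rewrite absFM absFXz absF_unif absF_unit// mulr1 exprz_inv.
Qed.

Lemma q_exprz_le (m n : int) : (q ^ m <= q ^ n) = (m <= n).
Proof. by rewrite ler_eXz2l// q_gt1. Qed.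

Lemma Oinf_absF (x : laurent K) : Oinf x <-> absF x <= 1.
Proof.
split=> [[f _ <-]|].
  have [->|/ps_neq0P[n [fn f0]]] := eqVneq f 0.
    by rewrite /of_ps rmorph0 absF0.
  by rewrite (absF_series f0 fn) invf_le1 ?exprn_gt0 ?q_gt0 ?exprn_ege1// ltW// q_gt1.
have [->|/laurent_factor[n [u [uU ->]]]] := eqVneq x 0.
  by exists 0 => //; rewrite /of_ps rmorph0.
rewrite absFM absFXz absF_unif absF_unit// mulr1 exprz_inv -(expr0z q).
rewrite q_exprz_le oppr_le0; case: n => // n _.
exists (PSeries (fun n => (n == 1)%:R) ^+ n * u) => //.
by rewrite /of_ps rmorphM rmorphXn.
Qed.

Lemma Oinf_units_absF (x : laurent K) : Oinf_units x -> absF x = 1.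
Proof. by move=> [u /absF_unit uU <-]. Qed.

End LaurentAbsoluteValue.

(** * Two by two matrices over a valued field *)

Section TwoByTwo.
Variable F : fieldType.
Local Notation i0 := (ord0 : 'I_2).
Local Notation i1 := (ord_max : 'I_2).
Implicit Types g h k M : 'M[F]_2.

Definition mx2 (a b c d : F) : 'M[F]_2 :=
  \matrix_(i, j) if i == i0 then if j == i0 then a else b
                 else if j == i0 then c else d.

Lemma mx2E a b c d : (mx2 a b c d i0 i0 = a) * (mx2 a b c d i0 i1 = b) *
  (mx2 a b c d i1 i0 = c) * (mx2 a b c d i1 i1 = d).
Proof. by rewrite !mxE. Qed.

Lemma I2P (P : 'I_2 -> Prop) : P i0 -> P i1 -> forall i, P i.
Proof.
move=> P0 P1 [[|[|//]] lti].
  by rewrite (_ : Ordinal lti = i0)//; apply: val_inj.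
by rewrite (_ : Ordinal lti = i1)//; apply: val_inj.
Qed.

Lemma mx2P g h : g i0 i0 = h i0 i0 -> g i0 i1 = h i0 i1 ->
  g i1 i0 = h i1 i0 -> g i1 i1 = h i1 i1 -> g = h.
Proof. by move=> ? ? ? ?; apply/matrixP; apply: I2P; apply: I2P. Qed.

Lemma sum2 (f : 'I_2 -> F) : \sum_i f i = f i0 + f i1.
Proof.
by rewrite big_ord_recl big_ord1; congr (f _ + f _); apply: val_inj.
Qed.

Lemma mulmx2 m n (A : 'M[F]_(m, 2)) (B : 'M[F]_(2, n)) i j :
  (A *m B) i j = A i i0 * B i0 j + A i i1 * B i1 j.
Proof. by rewrite mxE sum2. Qed.

Lemma det2 g : \det g = g i0 i0 * g i1 i1 - g i0 i1 * g i1 i0.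
Proof.
rewrite (expand_det_row _ i0) sum2 /cofactor !det_mx11 !mxE /= !expr0 !expr1.
rewrite mul1r mulN1r mulrN; congr (_ * g _ _ - _ * g _ _); exact: val_inj.
Qed.

Lemma unit2 g : (g \in unitmx) = (\det g != 0).
Proof. by rewrite unitmxE unitfE. Qed.

Lemma mul_invmx2 g h : g *m h = 1%:M -> h = invmx g.
Proof.
by move=> gh; have [gU hU] := mulmx1_unit gh; rewrite -[h]mul1mx -(mulVmx gU) -mulmxA gh mulmx1.
Qed.

Lemma invmx2 g : g \in unitmx ->
  invmx g = (\det g)^-1 *: mx2 (g i1 i1) (- g i0 i1) (- g i1 i0) (g i0 i0).
Proof.
rewrite unit2 => g0; apply/esym/mul_invmx2; rewrite -scalemxAr.
have d0 := g0; rewrite det2 in d0.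
by apply: mx2P; rewrite mxE mulmx2 !mx2E !mxE ?eqxx //= det2; field.
Qed.

Lemma invmxM2 g h : g \in unitmx -> h \in unitmx ->
  invmx (g *m h) = invmx h *m invmx g.
Proof.
move=> gU hU; apply/esym/mul_invmx2.
by rewrite mulmxA -(mulmxA g) mulmxV// mulmx1 mulmxV.
Qed.

Lemma unitmxM g h : g \in unitmx -> h \in unitmx -> g *m h \in unitmx.
Proof. by move=> gU hU; rewrite unitmx_mul gU. Qed.

Lemma unitmxV g : g \in unitmx -> invmx g \in unitmx.
Proof. by rewrite unitmx_inv. Qed.

Lemma unitmx_scale (c : F) g : c != 0 -> g \in unitmx -> c *: g \in unitmx.
Proof. by move=> c0 gU; rewrite unitmxZ// unitfE. Qed.

Lemma det_scale2 (c : F) g : \det (c *: g) = c ^+ 2 * \det g.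
Proof. by rewrite detZ. Qed.

(** The point with homogeneous coordinates [(a : c)]. *)
Definition proj_pt (a c : F) : option F := if c == 0 then None else Some (a / c).

(** The formula of [mobP1] over an arbitrary field; facts about [mobP1] then follow by
    conversion. *)
Definition mobP g (x : option F) : option F :=
  match x with
  | None => proj_pt (g i0 i0) (g i1 i0)
  | Some y => proj_pt (g i0 i0 * y + g i0 i1) (g i1 i0 * y + g i1 i1)
  end.

Lemma mobP_None g : mobP g None = proj_pt (g i0 i0) (g i1 i0).
Proof. by []. Qed.

Lemma mobP_Some0 g : mobP g (Some 0) = proj_pt (g i0 i1) (g i1 i1).
Proof. by rewrite /= !mulr0 !add0r. Qed.

Lemma mobP_proj g (a c : F) : g \in unitmx -> (a != 0) || (c != 0) ->
  mobP g (proj_pt a c) =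
  proj_pt (g i0 i0 * a + g i0 i1 * c) (g i1 i0 * a + g i1 i1 * c).
Proof.
rewrite unit2 det2 => gU; rewrite /proj_pt; have [->|c0] := eqVneq c 0; last first.
  move=> _ /=; rewrite /proj_pt; have -> : g i1 i0 * (a / c) + g i1 i1 = (g i1 i0 * a + g i1 i1 * c) / c.
    by field.
  rewrite mulf_eq0 invr_eq0 (negbTE c0) orbF; case: eqP => // /eqP n0.
  by congr Some; field; rewrite n0 c0.
rewrite orbF => a0; rewrite /= /proj_pt !mulr0 !addr0 mulf_eq0 (negbTE a0) orbF.
by case: eqP => // /eqP n0; congr Some; field; rewrite n0 a0.
Qed.

Lemma mobPM g h x : g \in unitmx -> h \in unitmx ->
  mobP (g *m h) x = mobP g (mobP h x).
Proof.
move=> gU hU; case: x => [y|].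
  rewrite [mobP h _]/(proj_pt (h i0 i0 * y + h i0 i1) (h i1 i0 * y + h i1 i1)).
  rewrite mobP_proj//; last first.
    rewrite unit2 det2 in hU; apply: contraNT hU; rewrite negb_or !negbK.
    move=> /andP[/eqP e1 /eqP e2]; apply/eqP.
    have -> : h i0 i1 = - (h i0 i0 * y) by apply/eqP; rewrite -addr_eq0 addrC e1.
    have -> : h i1 i1 = - (h i1 i0 * y) by apply/eqP; rewrite -addr_eq0 addrC e2.
    by ring.
  by rewrite /= !mulmx2; congr proj_pt; ring.
rewrite mobP_None mobP_proj//; last first.
  rewrite unit2 det2 in hU; apply: contraNT hU; rewrite negb_or !negbK.
  by move=> /andP[/eqP-> /eqP->]; rewrite mul0r mulr0 subrr.
by rewrite -!mulmx2.
Qed.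

(** The columns of [h] are homogeneous coordinates of [b] and of [a]; they are independent because
    the points differ. *)
Lemma mobP_two (a b : option F) : a <> b -> exists h,
  [/\ h \in unitmx, mobP h (Some 0) = a & mobP h None = b].
Proof.
case: a b => [x|] [y|] // ab.
- exists (mx2 y x 1 1); rewrite unit2 det2 mobP_Some0 mobP_None /proj_pt !mx2E.
  rewrite !oner_eq0 !divr1 mulr1 mulr1; split=> //.
  by rewrite subr_eq0; apply/eqP => e; apply: ab; rewrite e.
- exists (mx2 1 x 0 1); rewrite unit2 det2 mobP_Some0 mobP_None /proj_pt !mx2E.
  by rewrite !oner_eq0 eqxx !divr1 mulr1 mulr0 subr0 oner_eq0.
- exists (mx2 y 1 1 0); rewrite unit2 det2 mobP_Some0 mobP_None /proj_pt !mx2E.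
  by rewrite !oner_eq0 eqxx !divr1 mulr1 mulr0 sub0r oppr_eq0 oner_eq0.
Qed.

Definition actv g (v : set (set 'rV[F]_2)) : set (set 'rV[F]_2) :=
  [set [set x *m invmx g | x in L] | L in v].

Lemma actvM g h v : g \in unitmx -> h \in unitmx ->
  actv (g *m h) v = actv g (actv h v).
Proof.
move=> gU hU; rewrite /actv image_comp; congr (_ @` v).
apply: funext => L; rewrite [RHS]/= image_comp; congr (_ @` L).
by apply: funext => x; rewrite [RHS]/= invmxM2// mulmxA.
Qed.

Lemma actv1 v : actv 1%:M v = v.
Proof.
rewrite /actv invmx1 -[RHS]image_id; congr (_ @` v); apply: funext => L.
by rewrite -[RHS]image_id; congr (_ @` L); apply: funext => x; rewrite mulmx1.
Qed.

End TwoByTwo.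

Section Moebius.
Variable K : fieldType.
Local Notation F := (laurent K).
Local Notation i0 := (ord0 : 'I_2).
Local Notation i1 := (ord_max : 'I_2).
Implicit Types g h : 'M[F]_2.

Lemma mobP1_None g : mobP1 g None = proj_pt (g i0 i0) (g i1 i0).
Proof. by []. Qed.

Lemma mobP1_Some0 g : mobP1 g (Some 0) = proj_pt (g i0 i1) (g i1 i1).
Proof. exact: mobP_Some0. Qed.

Lemma mobP1M g h x : g \in unitmx -> h \in unitmx ->
  mobP1 (g *m h) x = mobP1 g (mobP1 h x).
Proof. exact: mobPM. Qed.

Lemma mobP1_two (a b : P1 K) : a <> b -> exists h : 'M[F]_2,
  [/\ h \in unitmx, mobP1 h (Some 0) = a & mobP1 h None = b].
Proof. exact: mobP_two. Qed.

End Moebius.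

Section VertexAction.
Variable K : fieldType.
Local Notation F := (laurent K).

Lemma act_vertM (g h : 'M[F]_2) (v : vert K) : g \in unitmx -> h \in unitmx ->
  act_vert (g *m h) v = act_vert g (act_vert h v).
Proof. exact: actvM. Qed.

Lemma act_vert1 (v : vert K) : act_vert 1%:M v = v.
Proof. exact: actv1. Qed.

Lemma act_vertK (g : 'M[F]_2) : g \in unitmx -> cancel (act_vert g) (act_vert (invmx g)).
Proof. by move=> gU v; rewrite -act_vertM ?unitmx_inv// mulVmx// act_vert1. Qed.

Lemma act_vertVK (g : 'M[F]_2) : g \in unitmx -> cancel (act_vert (invmx g)) (act_vert g).
Proof. by move=> gU v; rewrite -act_vertM ?unitmx_inv// mulmxV// act_vert1. Qed.

End VertexAction.

(* Two by two matrices are studied over an abstract discretely valued field, so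
   that conversion never unfolds the operations of the fraction field
   [laurent K]. *)
Record absval (R : realType) (F : fieldType) := AbsVal {
  av :> F -> R;
  avq : R;
  avpi : F;
  avq_gt1 : 1 < avq;
  av_pi : av avpi = avq^-1;
  av_ge0 : forall x, 0 <= av x;
  av_eq0 : forall x, (av x == 0) = (x == 0);
  avM : forall x y, av (x * y) = av x * av y;
  avD_le : forall x y c, av x <= c -> av y <= c -> av (x + y) <= c;
  av_disc : forall x, x != 0 -> exists n : int, av x = avq ^ n
}.

Section AbsValTheory.
Variables (R : realType) (F : fieldType) (v : absval R F).
Local Notation q := (avq v).
Local Notation pi := (avpi v).
Implicit Types x y : F.

Lemma avq_gt0 : 0 < q. Proof. exact: lt_trans (avq_gt1 v). Qed.
Lemma avq_neq0 : q != 0. Proof. exact: lt0r_neq0 avq_gt0. Qed.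
Lemma avqV_lt1 : q^-1 < 1. Proof. by rewrite invf_lt1 ?avq_gt1 ?avq_gt0. Qed.
Lemma avqV_gt0 : 0 < q^-1. Proof. by rewrite invr_gt0 avq_gt0. Qed.

Lemma av0 : v 0 = 0. Proof. by apply/eqP; rewrite av_eq0. Qed.
Lemma av_gt0 x : (0 < v x) = (x != 0).
Proof. by rewrite lt_neqAle av_ge0 andbT eq_sym av_eq0. Qed.
Lemma av1 : v 1 = 1.
Proof.
have := avM v 1 1; rewrite mulr1 -{1}[v 1]mulr1 => /mulfI -> //.
by rewrite av_eq0 oner_eq0.
Qed.
Lemma avX x n : v (x ^+ n) = v x ^+ n.
Proof. by elim: n => [|n IHn]; rewrite ?expr0 ?av1// !exprS avM IHn. Qed.
Lemma avV x : v x^-1 = (v x)^-1.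
Proof.
have [->|x0] := eqVneq x 0; first by rewrite invr0 av0 invr0.
have ax : v x != 0 by rewrite av_eq0.
by apply: (mulIf ax); rewrite -avM !mulVf// av1.
Qed.
Lemma avXz x (n : int) : v (x ^ n) = v x ^ n.
Proof. by case: n => n; rewrite ?NegzE ?exprnN ?avV avX. Qed.
Lemma avN x : v (- x) = v x.
Proof.
have N1 : v (-1) = 1.
  have : v (-1) ^+ 2 == 1 by rewrite -avX sqrrN expr1n av1.
  by rewrite sqrf_eq1 => /orP[/eqP //|/eqP N1]; move: (av_ge0 v (-1)); rewrite N1 ler0N1.
by rewrite -mulN1r avM N1 mul1r.
Qed.
Lemma avD_lt x y c : v x < c -> v y < c -> v (x + y) < c.
Proof.
move=> xc yc; apply: (@le_lt_trans _ _ (Num.max (v x) (v y))).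
  by apply: avD_le; rewrite le_max lexx ?orbT.
by rewrite gt_max xc.
Qed.

Lemma avq_exprz_le (m n : int) : (q ^ m <= q ^ n) = (m <= n).
Proof. by rewrite ler_eXz2l// avq_gt1. Qed.
Lemma avq_exprz_lt (m n : int) : (q ^ m < q ^ n) = (m < n).
Proof. by rewrite ltr_eXz2l// avq_gt1. Qed.

(** Discreteness of the value group: a strict bound by a power of [q] gains a full factor [q]. *)
Lemma av_lt x (n : int) : v x < q ^ n -> v x <= q ^ (n - 1).
Proof.
have [->|/(av_disc v)[m ->]] := eqVneq x 0.
  by rewrite av0 exprz_ge0// ltW// avq_gt0.
by rewrite avq_exprz_lt avq_exprz_le; lia.
Qed.

Lemma av_lt1 x : v x < 1 -> v x <= q^-1.
Proof. by rewrite -(expr0z q) => /av_lt; rewrite sub0r exprN1. Qed.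

Lemma av_ltq x : v x < q -> v x <= 1.
Proof. by rewrite -{1}(expr1z q) => /av_lt; rewrite subrr expr0z. Qed.

Lemma pi_neq0 : pi != 0. Proof. by rewrite -av_gt0 av_pi avqV_gt0. Qed.

Lemma av_piXz (n : int) : v (pi ^ n) = q ^ (- n).
Proof. by rewrite avXz av_pi exprz_inv. Qed.

End AbsValTheory.

(** * Integral matrices and elementary divisors *)

Section IntegralMatrices.
Variables (R : realType) (F : fieldType) (v : absval R F).
Local Notation q := (avq v).
Local Notation pi := (avpi v).
Local Notation i0 := (ord0 : 'I_2).
Local Notation i1 := (ord_max : 'I_2).
Implicit Types k M : 'M[F]_2.

Definition intmx m n (M : 'M[F]_(m, n)) := forall i j, v (M i j) <= 1.

(** [GL_2] of the valuation ring, which stabilizes the standard lattice. *)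
Definition GLO k := intmx k /\ v (\det k) = 1.

(** The Iwahori subgroup: the elements of [GLO] that fix the whole base edge from [v_0] to
    [v_{-1}]. *)
Definition iwahori k := GLO k /\ v (k i0 i1) < 1.

(** Since matrices act on lattices through their inverses, [dpi n] carries [v_0] to [v_{-n}]. *)
Definition dpi (n : int) : 'M[F]_2 := mx2 (pi ^ n) 0 0 1.

Definition swap2 : 'M[F]_2 := mx2 0 1 1 0.

Lemma intmxM m n (M : 'M[F]_(m, 2)) (N : 'M[F]_(2, n)) :
  intmx M -> intmx N -> intmx (M *m N).
Proof.
move=> Mi Ni i j; rewrite mulmx2; apply: avD_le; rewrite avM;
  by rewrite mulr_ile1// av_ge0.
Qed.

Lemma intmx_det M : intmx M -> v (\det M) <= 1.
Proof.
by move=> Mi; rewrite det2; apply: avD_le; rewrite ?avN avM mulr_ile1// av_ge0.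
Qed.

Lemma GLO_unit k : GLO k -> k \in unitmx.
Proof. by move=> [_ dk]; rewrite unit2 -(av_gt0 v) dk. Qed.

Lemma GLO1 : GLO 1%:M.
Proof.
split; last by rewrite det1 av1.
by move=> i j; rewrite mxE; case: eqP; rewrite ?av1 ?av0.
Qed.

Lemma GLOV k : GLO k -> GLO (invmx k).
Proof.
move=> kO; have kU := GLO_unit kO; case: kO => ki kd.
split; last by rewrite det_inv avV kd invr1.
rewrite invmx2//.
by apply: I2P; apply: I2P; rewrite mxE avM avV kd invr1 mul1r mx2E ?avN.
Qed.

Lemma GLO_swap : GLO swap2.
Proof.
split; last by rewrite det2 !mx2E mul0r mul1r sub0r avN av1.
by apply: I2P; apply: I2P; rewrite mx2E ?av0 ?av1.
Qed.

Lemma intmx_inv_GLO k : k \in unitmx -> intmx k -> intmx (invmx k) -> GLO k.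
Proof.
move=> kU ki ki'; split=> //; apply/eqP; rewrite eq_le intmx_det//=.
have := intmx_det ki'; rewrite det_inv avV invf_le1// av_gt0.
by rewrite -unit2.
Qed.

Lemma det_dpi n : \det (dpi n) = pi ^ n.
Proof. by rewrite det2 !mx2E mulr1 mul0r subr0. Qed.

Lemma dpi_unit n : dpi n \in unitmx.
Proof. by rewrite unit2 det_dpi expfz_neq0// pi_neq0. Qed.

Lemma dpiD m n : dpi (m + n) = dpi m *m dpi n.
Proof.
apply: mx2P; rewrite mulmx2 !mx2E ?mulr0 ?mul0r ?addr0 ?add0r ?mulr1//.
by rewrite expfzDr// pi_neq0.
Qed.

Lemma dpi0 : dpi 0 = 1%:M.
Proof. by apply: mx2P; rewrite mx2E mxE. Qed.

Lemma dpiV n : invmx (dpi n) = dpi (- n).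
Proof. by apply/esym/mul_invmx2; rewrite -dpiD subrr dpi0. Qed.

(** The conjugation divides the upper right entry by [pi], which discreteness allows, and multiplies
    the lower left one by [pi]. *)
Lemma iwahori_conj k : iwahori k -> GLO (dpi (-1) *m k *m dpi 1).
Proof.
move=> [[ki kd] k01]; have p0 := pi_neq0 v.
split; last first.
  rewrite !det_mulmx !det_dpi !avM kd mulr1 -avM -expfzDr//.
  by rewrite addNr expr0z av1.
apply: I2P; apply: I2P;
  rewrite !mulmx2 !mx2E ?mul0r ?mulr0 ?addr0 ?add0r ?mul1r ?mulr1 //.
- by rewrite mulrAC -expfzDr// addNr expr0z mul1r.
- rewrite avM av_piXz opprK expr1z -(@ler_pM2l _ q^-1) ?avqV_gt0//.
  by rewrite mulKf ?avq_neq0// mulr1 av_lt1.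
- rewrite avM av_piXz mulrC -(expr0z q) exprN1.
  by rewrite mulr_ile1 ?av_ge0// ltW// ?avqV_gt0 ?avqV_lt1.
Qed.

(* One elementary divisor at a time: row operations over the valuation ring make
   the first row of a singular-mod-pi matrix divisible by pi. *)
Lemma integral_split M : intmx M -> M \in unitmx -> v (\det M) < 1 ->
  exists k M', [/\ GLO k, intmx M', M' \in unitmx,
    M = k *m dpi 1 *m M' & v (\det M') = q * v (\det M)].
Proof.
move=> Mi MU Md; have p0 := pi_neq0 v.
have [k [kO k00 k01]] : exists k, [/\ GLO k, v ((k *m M) i0 i0) < 1
    & v ((k *m M) i0 i1) < 1].
  have elem x : v x <= 1 -> GLO (mx2 1 (- x) 0 1).
    move=> x1; split; last by rewrite det2 !mx2E mulr1 mulr0 subr0 av1.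
    by apply: I2P; apply: I2P; rewrite mx2E ?avN ?av1 ?av0.
  have [M10|M10] := ltP (v (M i1 i0)) 1.
    have [M11|M11] := ltP (v (M i1 i1)) 1.
      exists swap2; split; first exact: GLO_swap.
        by rewrite mulmx2 !mx2E mul0r mul1r add0r.
      by rewrite mulmx2 !mx2E mul0r mul1r add0r.
    have M11e : v (M i1 i1) = 1 by apply/eqP; rewrite eq_le Mi.
    have M110 : M i1 i1 != 0 by rewrite -(av_gt0 v) M11e.
    exists (mx2 1 (- (M i0 i1 / M i1 i1)) 0 1); split.
    + by apply: elem; rewrite avM avV M11e invr1 mulr1.
    + rewrite mulmx2 !mx2E mul1r.
      have -> : M i0 i0 + - (M i0 i1 / M i1 i1) * M i1 i0 = \det M / M i1 i1.
        by rewrite det2; field.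
      by rewrite avM avV M11e invr1 mulr1.
    + by rewrite mulmx2 !mx2E mul1r mulNr divfK// subrr av0.
  have M10e : v (M i1 i0) = 1 by apply/eqP; rewrite eq_le Mi.
  have M100 : M i1 i0 != 0 by rewrite -(av_gt0 v) M10e.
  exists (mx2 1 (- (M i0 i0 / M i1 i0)) 0 1); split.
  + by apply: elem; rewrite avM avV M10e invr1 mulr1.
  + by rewrite mulmx2 !mx2E mul1r mulNr divfK// subrr av0.
  + rewrite mulmx2 !mx2E mul1r.
    have -> : M i0 i1 + - (M i0 i0 / M i1 i0) * M i1 i1 = - (\det M / M i1 i0).
      by rewrite det2; field.
    by rewrite avN avM avV M10e invr1 mulr1.
have kU := GLO_unit kO.
exists (invmx k), (dpi (-1) *m (k *m M)); split.
- exact: GLOV.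
- have kMi : intmx (k *m M) by apply: intmxM => //; case: kO.
  have qle x : v x < 1 -> v (pi ^ (-1) * x) <= 1.
    move=> x1; rewrite avM av_piXz opprK expr1z -(@ler_pM2l _ q^-1) ?avqV_gt0//.
    by rewrite mulKf ?avq_neq0// mulr1 av_lt1.
  by apply: I2P; apply: I2P; rewrite mulmx2 !mx2E ?mul0r ?addr0 ?mul1r ?add0r// qle.
- by rewrite !unitmx_mul dpi_unit kU MU.
- rewrite -mulmxA (mulmxA (dpi 1)) -dpiD subrr dpi0 mul1mx mulmxA.
  by rewrite mulVmx// mul1mx.
- rewrite !det_mulmx det_dpi !avM av_piXz opprK expr1z.
  by case: kO => _ ->; rewrite mul1r.
Qed.

Lemma scale_integral M : exists2 c, c != 0 & intmx (c *: M).
Proof.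
have ex x : exists n : nat, forall m, (n <= m)%N -> v (pi ^+ m * x) <= 1.
  have [->|/(av_disc v)[[n|n] xn]] := eqVneq x 0.
  - by exists 0%N => m _; rewrite mulr0 av0.
  - exists n => m nm; rewrite avM exprnP av_piXz xn -expfzDr ?avq_neq0//.
    by rewrite -(expr0z q) avq_exprz_le; lia.
  - exists 0%N => m _; rewrite avM exprnP av_piXz xn -expfzDr ?avq_neq0//.
    by rewrite -(expr0z q) avq_exprz_le; lia.
have [n00 h00] := ex (M i0 i0); have [n01 h01] := ex (M i0 i1).
have [n10 h10] := ex (M i1 i0); have [n11 h11] := ex (M i1 i1).
exists (pi ^+ (n00 + n01 + n10 + n11)); first by rewrite expf_neq0// pi_neq0.
by apply: I2P; apply: I2P; rewrite mxE; [apply: h00|apply: h01|apply: h10|apply: h11]; lia.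
Qed.

End IntegralMatrices.

(** * The distance to a geodesic as a function of a matrix *)

Section GeodesicDefect.
Variables (R : realType) (F : fieldType) (v : absval R F).
Local Notation q := (avq v).
Local Notation pi := (avpi v).
Local Notation i0 := (ord0 : 'I_2).
Local Notation i1 := (ord_max : 'I_2).
Local Notation swap := (@swap2 F).
Local Notation dpi := (dpi v).
Local Notation GLO := (GLO v).
Implicit Types (k M : 'M[F]_2) (s t : R) (a c : F).

(** When [|z| = |z|_i = s], this is the absolute value of the linear form [c z - a]; see
    [col_form_normal]. *)
Definition cnorm s a c : R := Num.max (v a) (s * v c).

(* [defect (q `^ (- t)) M] is q to the distance from the point
   (1 - t) v_0 + t v_{-1} to the geodesic joining the two columns of M. *)
Definition defect s M : R :=
  cnorm s (M i0 i0) (M i1 i0) * cnorm s (M i0 i1) (M i1 i1) / (v (\det M) * s).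

(** Right multiplication by [dg] rescales the columns: the ends stay the same while the vertex
    slides along the geodesic. *)
Definition dg (x y : F) : 'M[F]_2 := mx2 x 0 0 y.

Lemma dg_unit x y : x != 0 -> y != 0 -> dg x y \in unitmx.
Proof. by move=> x0 y0; rewrite unit2 det2 !mx2E mulr0 subr0 mulf_neq0. Qed.

Lemma swap_unit : swap \in unitmx.
Proof. exact: GLO_unit (GLO_swap v). Qed.

Lemma cnorm_ge0 s a c : 0 <= cnorm s a c.
Proof. by rewrite le_max av_ge0. Qed.

Lemma cnormZ s x a c : cnorm s (x * a) (x * c) = v x * cnorm s a c.
Proof. by rewrite /cnorm !avM mulrCA maxr_pMr// av_ge0. Qed.

Lemma unit_col0 M : M \in unitmx -> (M i0 i0 != 0) || (M i1 i0 != 0).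
Proof.
rewrite unit2 det2; apply: contraNT; rewrite negb_or !negbK => /andP[/eqP-> /eqP->].
by rewrite mul0r mulr0 subrr.
Qed.

Lemma unit_col1 M : M \in unitmx -> (M i0 i1 != 0) || (M i1 i1 != 0).
Proof.
rewrite unit2 det2; apply: contraNT; rewrite negb_or !negbK => /andP[/eqP-> /eqP->].
by rewrite mul0r mulr0 subrr.
Qed.

Lemma unit_det_gt0 M : M \in unitmx -> 0 < v (\det M).
Proof. by rewrite unit2 av_gt0. Qed.

(** An ultrametric Hadamard inequality: both products in the determinant are at most the product of
    the column norms divided by [s]. *)
Lemma defect_ge1 s M : 0 < s -> M \in unitmx -> 1 <= defect s M.
Proof.
move=> s0 MU; rewrite ler_pdivlMr ?mulr_gt0 ?unit_det_gt0// mul1r.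
rewrite mulrC -ler_pdivlMl//.
have le0 a c : v a <= cnorm s a c by rewrite le_max lexx.
have le1 a c : v c <= s^-1 * cnorm s a c.
  by rewrite ler_pdivlMl// le_max lexx orbT.
rewrite det2; apply: avD_le; rewrite ?avN avM.
  by rewrite mulrCA ler_pM ?av_ge0.
by rewrite mulrA mulrC ler_pM ?av_ge0.
Qed.

Lemma defect_swap s M : defect s (M *m swap) = defect s M.
Proof.
rewrite /defect det_mulmx avM (proj2 (GLO_swap v)) mulr1 !mulmx2 !mx2E.
by rewrite !mulr0 !mulr1 !addr0 !add0r [X in X / _]mulrC.
Qed.

Lemma defect_dg s x y M : x != 0 -> y != 0 ->
  defect s (M *m dg x y) = defect s M.
Proof.
move=> x0 y0; have vx : v x != 0 by rewrite av_eq0.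
have vy : v y != 0 by rewrite av_eq0.
rewrite /defect det_mulmx !mulmx2 !mx2E !mulr0 ?addr0 ?add0r.
rewrite ![_ * x]mulrC ![_ * y]mulrC !cnormZ [\det (dg x y)]det2 !mx2E mulr0 subr0 !avM.
have [->|d0] := eqVneq (v (\det M)) 0; first by rewrite !mul0r invr0 !mulr0.
have [->|s0] := eqVneq s 0; first by rewrite !mulr0 invr0 !mulr0.
by field; rewrite s0 d0 vx vy.
Qed.

Lemma defect_scale s c M : c != 0 -> defect s (c *: M) = defect s M.
Proof.
move=> c0; rewrite -(defect_dg s M c0 c0); congr defect.
by apply: mx2P; rewrite mulmx2 !mx2E !mxE ?mulr0 ?addr0 ?add0r mulrC.
Qed.

(** An integral matrix does not increase the norm, and neither does its inverse. *)
Lemma cnorm_GLO k a c : GLO k ->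
  cnorm 1 (k i0 i0 * a + k i0 i1 * c) (k i1 i0 * a + k i1 i1 * c) = cnorm 1 a c.
Proof.
have le k' a' c' : GLO k' ->
    cnorm 1 (k' i0 i0 * a' + k' i0 i1 * c') (k' i1 i0 * a' + k' i1 i1 * c')
    <= cnorm 1 a' c'.
  move=> [ki _]; rewrite {1}/cnorm mul1r ge_max.
  have aux x y : v x <= 1 -> v y <= 1 -> v (x * a' + y * c') <= cnorm 1 a' c'.
    move=> x1 y1; rewrite /cnorm mul1r.
    apply: avD_le; rewrite avM le_max; apply/orP; [left|right];
      by rewrite ler_piMl// av_ge0.
  by rewrite !aux.
move=> kO; apply/eqP; rewrite eq_le le//=.
have kU := GLO_unit kO; have := le _ (k i0 i0 * a + k i0 i1 * c) (k i1 i0 * a + k i1 i1 * c) (GLOV kO).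
set a' := (X in cnorm 1 X _ <= _); set c' := (X in cnorm 1 _ X <= _).
have e i : invmx k i i0 * k i0 i0 + invmx k i i1 * k i1 i0 = (i == i0)%:R.
  by rewrite -mulmx2 mulVmx// mxE.
have e' i : invmx k i i0 * k i0 i1 + invmx k i i1 * k i1 i1 = (i == i1)%:R.
  by rewrite -mulmx2 mulVmx// mxE.
have comb i : invmx k i i0 * (k i0 i0 * a + k i0 i1 * c) +
    invmx k i i1 * (k i1 i0 * a + k i1 i1 * c) = (i == i0)%:R * a + (i == i1)%:R * c.
  by rewrite -e -e'; ring.
by rewrite /a' /c' !comb /= mul1r mul0r addr0 mul0r mul1r add0r.
Qed.

Lemma defect_GLO k M : GLO k -> defect 1 (k *m M) = defect 1 M.
Proof.
move=> kO; rewrite /defect det_mulmx avM (proj2 kO) mul1r !mulmx2.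
by rewrite !cnorm_GLO.
Qed.

(** The parameter [q^-1] is the far end of the base edge; [dpi (-1)] brings that vertex back to
    [v_0]. *)
Lemma defect_shift M : defect q^-1 M = defect 1 (dpi (-1) *m M).
Proof.
have q0 := avq_neq0 v.
rewrite /defect det_mulmx det_dpi !mulmx2 !mx2E !mul0r !mul1r !addr0 !add0r.
have cn a c : cnorm 1 (pi ^ (-1) * a) c = q * cnorm q^-1 a c.
  rewrite /cnorm avM av_piXz opprK expr1z maxr_pMr ?ltW ?avq_gt0//.
  by rewrite mulVKf// mul1r.
rewrite !cn avM av_piXz opprK expr1z mulr1.
have [->|d0] := eqVneq (v (\det M)) 0; first by rewrite mulr0 !mul0r invr0 !mulr0.
by field; rewrite q0 d0.
Qed.

Lemma normalize_col a c : (a != 0) || (c != 0) ->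
  exists2 x, x != 0 & v x * cnorm 1 a c = 1.
Proof.
rewrite /cnorm mul1r => ac; have [ca|ac'] := leP (v c) (v a).
  have a0 : a != 0.
    apply: contraTneq ac => a0; rewrite a0 av0 in ca.
    by rewrite a0 eqxx /= negbK -(av_eq0 v) eq_le ca av_ge0.
  by exists a^-1; rewrite ?invr_eq0// avV mulVf// av_eq0.
have c0 : c != 0 by rewrite -(av_gt0 v) (le_lt_trans (av_ge0 v a)).
by exists c^-1; rewrite ?invr_eq0// avV mulVf// av_eq0.
Qed.

Definition unimodular_cols M := [/\ intmx v M, cnorm 1 (M i0 i0) (M i1 i0) = 1
  & cnorm 1 (M i0 i1) (M i1 i1) = 1].

Lemma normalize_cols M : M \in unitmx ->
  exists x y, [/\ x != 0, y != 0 & unimodular_cols (M *m dg x y)].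
Proof.
move=> MU.
have [x x0 xn] := normalize_col (unit_col0 MU).
have [y y0 yn] := normalize_col (unit_col1 MU).
exists x, y; split=> //.
rewrite /unimodular_cols !mulmx2 !mx2E !mulr0 !addr0 !add0r ![_ * x]mulrC ![_ * y]mulrC.
rewrite !cnormZ; split=> //.
apply: I2P; apply: I2P; rewrite mulmx2 !mx2E mulr0 ?addr0 ?add0r avM mulrC.
- by rewrite -xn ler_wpM2l ?av_ge0// le_max lexx.
- by rewrite -yn ler_wpM2l ?av_ge0// le_max lexx.
- by rewrite -xn ler_wpM2l ?av_ge0// le_max mul1r lexx orbT.
- by rewrite -yn ler_wpM2l ?av_ge0// le_max mul1r lexx orbT.
Qed.

Lemma defect_unimodular M : unimodular_cols M -> defect 1 M = (v (\det M))^-1.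
Proof. by move=> [_ c0 c1]; rewrite /defect c0 c1 !mulr1 div1r. Qed.

Lemma defect1_GLO M : M \in unitmx -> defect 1 M = 1 ->
  exists x y, [/\ x != 0, y != 0 & GLO (M *m dg x y)].
Proof.
move=> MU; have [x [y [x0 y0 Mu]]] := normalize_cols MU.
rewrite -(defect_dg 1 M x0 y0) defect_unimodular// => d1.
by exists x, y; split=> //; split; [case: Mu|rewrite -[LHS]invrK d1 invr1].
Qed.

Lemma unimodular_GLO k M : GLO k -> unimodular_cols M -> unimodular_cols (k *m M).
Proof.
move=> kO [Mi c0 c1]; split; first by apply: intmxM => //; case: kO.
  by rewrite !mulmx2 cnorm_GLO.
by rewrite !mulmx2 cnorm_GLO.
Qed.

(** Modulo [pi] the two columns span one line, which points to the neighbour nearer the geodesic;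
    the claim is that this line is the second axis. If an entry of the first row were a unit, the
    bound on the product of norms would make the other column's upper entry small and its lower
    entry a unit, so the determinant would be a unit. *)
Lemma unimodular_corner M : M \in unitmx -> unimodular_cols M -> v (\det M) < 1 ->
  defect q^-1 M <= defect 1 M -> v (M i0 i0) < 1 /\ v (M i0 i1) < 1.
Proof.
move=> MU Mu d1; have dM := unit_det_gt0 MU; have qV := avqV_gt0 v.
have [Mi c0 c1] := Mu; move=> cc0.
have {cc0} cc : cnorm q^-1 (M i0 i0) (M i1 i0) * cnorm q^-1 (M i0 i1) (M i1 i1) <= q^-1.
  move: cc0; rewrite (defect_unimodular Mu) /defect ler_pdivrMr ?mulr_gt0//.
  by rewrite mulKf// gt_eqF.
have small a c b d : cnorm q^-1 a c * cnorm q^-1 b d <= q^-1 -> cnorm 1 b d = 1 ->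
    v a = 1 -> v b < 1 /\ v d = 1.
  move=> ab bd a1; have le_b : cnorm q^-1 b d <= q^-1.
    apply: le_trans ab; rewrite ler_peMl ?cnorm_ge0//.
    by rewrite -a1 le_max lexx.
  have b1 : v b < 1.
    by apply: le_lt_trans (avqV_lt1 v); apply: le_trans le_b; rewrite le_max lexx.
  split=> //; move: bd; rewrite /cnorm mul1r.
  by case: (leP (v b) (v d)) => // _ b1'; rewrite b1' ltxx in b1.
have dom x y : v x = 1 -> v y < 1 -> v (x + y) < 1 -> False.
  move=> x1 y1 xy; have : v ((x + y) - y) < 1 by apply: avD_lt; rewrite ?avN.
  by rewrite addrK x1 ltxx.
rewrite det2 in d1; split; rewrite lt_neqAle Mi andbT; apply/eqP => e.
  have [b1 dd] := small _ _ _ _ cc c1 e.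
  apply: dom d1; first by rewrite avM e dd mulr1.
  by rewrite avN avM (le_lt_trans _ b1)// ler_piMr ?av_ge0.
rewrite mulrC in cc; have [b1 dd] := small _ _ _ _ cc c0 e.
rewrite addrC in d1; apply: dom d1; first by rewrite avN avM e dd mulr1.
by rewrite avM (le_lt_trans _ b1)// ler_piMr ?av_ge0.
Qed.

(* At a vertex off the geodesic, at most one neighbour is not farther away. *)
Lemma defect_neighbours k M : M \in unitmx -> GLO k -> 1 < defect 1 M ->
  defect q^-1 M <= defect 1 M -> defect q^-1 (k *m M) <= defect 1 (k *m M) ->
  iwahori v k.
Proof.
move=> MU kO; have [x [y [x0 y0 Mu]]] := normalize_cols MU.
rewrite -!(defect_dg _ M x0 y0) -!(defect_dg _ (k *m M) x0 y0) -mulmxA.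
set N := M *m dg x y in Mu *.
have NU : N \in unitmx by rewrite unitmx_mul MU dg_unit.
have kN := unimodular_GLO kO Mu.
have kNd : v (\det (k *m N)) = v (\det N) by rewrite det_mulmx avM (proj2 kO) mul1r.
rewrite defect_unimodular// invf_gt1 ?unit_det_gt0// => d1 le1 le2.
split=> //.
have [N00 N01] : v (N i0 i0) < 1 /\ v (N i0 i1) < 1.
  by apply: unimodular_corner => //; rewrite defect_unimodular.
have [kN00 _] : v ((k *m N) i0 i0) < 1 /\ v ((k *m N) i0 i1) < 1.
  have kNU : k *m N \in unitmx by rewrite unitmx_mul (GLO_unit kO).
  by apply: unimodular_corner => //; rewrite kNd.
(* The first columns of [N] and of [k *m N] both reduce to the second axis, so [k] preserves that
   axis modulo [pi]. *)
have N10 : v (N i1 i0) = 1.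
  case: Mu => _ + _; rewrite /cnorm mul1r.
  by case: (leP (v (N i0 i0))) => // _ e; rewrite e ltxx in N00.
rewrite mulmx2 in kN00; case: kO => ki _.
have -> : v (k i0 i1) = v (- (k i0 i0 * N i0 i0)
    + (k i0 i0 * N i0 i0 + k i0 i1 * N i1 i0)) by rewrite addKr avM N10 mulr1.
apply: avD_lt => //; rewrite avN avM.
by rewrite (le_lt_trans _ N00)// ler_piMl ?av_ge0.
Qed.

(** Two geodesics with a common end share a ray. Once the first row has been scaled enough, the
    upper right entry is dominated by the lower right one, and the product of the column norms is
    that of the diagonal entries. *)
Lemma defect_ray M : M \in unitmx -> M i1 i0 = 0 ->
  exists n0 : nat, forall n, (n0 <= n)%N -> defect 1 (dpi n%:Z *m M) = 1.
Proof.
move=> MU M10; rewrite unit2 det2 M10 mulr0 subr0 in MU.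
have [n0 n0P] : exists n0 : nat, forall n, (n0 <= n)%N ->
    v (pi ^ n%:Z * M i0 i1) <= v (M i1 i1).
  move: MU; rewrite mulf_eq0 negb_or => /andP[_ /(av_disc v)[m ->]].
  have [->|/(av_disc v)[p e]] := eqVneq (M i0 i1) 0.
    by exists 0%N => n _; rewrite mulr0 av0 exprz_ge0// ltW// avq_gt0.
  exists (`|p - m|)%N => n nm; rewrite avM av_piXz e -expfzDr ?avq_neq0//.
  by rewrite avq_exprz_le; lia.
exists n0 => n /n0P le1.
rewrite /defect det_mulmx det_dpi !mulmx2 !mx2E M10 ?mul0r ?mul1r ?mulr0 ?addr0 ?add0r.
rewrite /cnorm !mul1r (max_idPr le1) av0 (max_idPl (av_ge0 _ _)) det2 M10 mulr0 subr0.
rewrite mulr1 !avM mulrA divff// !mulf_neq0 ?av_eq0// ?expfz_neq0 ?pi_neq0//.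
  by apply: contraNneq MU => ->; rewrite mul0r.
by apply: contraNneq MU => ->; rewrite mulr0.
Qed.

(** Each column norm at [s = q ^ (-t)] is at least [s] times the norm at 1, which costs a factor
    [s^-1], at most [q]. *)
Lemma defect_shift_le t M : 0 <= t <= 1 -> M \in unitmx ->
  defect 1 M <= q * defect (q `^ (- t)) M.
Proof.
move=> /andP[t0 t1] MU; have q0 := avq_gt0 v.
have s0 : 0 < q `^ (- t) by rewrite powR_gt0.
have s1 : q `^ (- t) <= 1 by rewrite -(powRr0 q) ler_powR ?oppr_le0// ltW// avq_gt1.
have sq : q^-1 <= q `^ (- t).
  by rewrite -(powR_inv1 (ltW q0)) ler_powR ?lerN2// ltW// avq_gt1.
set s := q `^ (- t) in s0 s1 sq *.
have cn a c : s * cnorm 1 a c <= cnorm s a c.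
  rewrite {1}/cnorm mul1r; case: (leP (v a)) => _; rewrite /cnorm le_max ?lexx ?orbT//.
  by rewrite ler_piMl ?av_ge0.
have dM := unit_det_gt0 MU.
rewrite {1}/defect mulr1 ler_pdivrMr//.
have -> : q * defect s M * v (\det M)
    = q / s * (cnorm s (M i0 i0) (M i1 i0) * cnorm s (M i0 i1) (M i1 i1)).
  by rewrite /defect; field; rewrite !gt_eqF.
apply: (@le_trans _ _ (q / s * (s * cnorm 1 (M i0 i0) (M i1 i0) *
    (s * cnorm 1 (M i0 i1) (M i1 i1))))); last first.
  apply: ler_wpM2l; first by rewrite divr_ge0 ?ltW.
  by rewrite ler_pM ?mulr_ge0 ?cnorm_ge0// ltW.
have -> : q / s * (s * cnorm 1 (M i0 i0) (M i1 i0) * (s * cnorm 1 (M i0 i1) (M i1 i1)))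
    = q * s * (cnorm 1 (M i0 i0) (M i1 i0) * cnorm 1 (M i0 i1) (M i1 i1)).
  by field; rewrite gt_eqF.
rewrite ler_peMl ?mulr_ge0 ?cnorm_ge0//.
by rewrite -ler_pdivrMl// mulr1.
Qed.

(** Both terms of the maximum are log-affine in [t], so the norm is log-convex. *)
Lemma cnorm_interp t a c : 0 <= t <= 1 ->
  cnorm (q `^ (- t)) a c <= cnorm 1 a c `^ (1 - t) * cnorm q^-1 a c `^ t.
Proof.
move=> /andP[t0 t1]; have t1' : 0 <= 1 - t by rewrite subr_ge0.
have q0 := avq_gt0 v.
(* As a zero exponent gives 1 even on base 0, for [x = 0] the vanishing factor is the first one when
   [t = 0] and the second one otherwise. *)
have key x : 0 <= x -> x = x `^ (1 - t) * x `^ t.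
  rewrite le_eqVlt => /orP[/eqP<-|x0].
    have [->|t0'] := eqVneq t 0; first by rewrite subr0 powRr1// mul0r.
    by rewrite (powR0 t0') mulr0.
  by rewrite -powRD ?subrK ?powRr1 ?ltW// gt_eqF ?implybT.
rewrite {1}/cnorm ge_max; apply/andP; split.
  rewrite [leLHS]key ?av_ge0// ler_pM ?powR_ge0//.
    by rewrite ge0_ler_powR ?nnegrE ?av_ge0 ?cnorm_ge0// le_max lexx.
  by rewrite ge0_ler_powR ?nnegrE ?av_ge0 ?cnorm_ge0// le_max lexx.
rewrite {1}(key (v c)) ?av_ge0// mulrCA ler_pM ?mulr_ge0 ?powR_ge0//.
  by rewrite ge0_ler_powR ?nnegrE ?av_ge0 ?cnorm_ge0// le_max mul1r lexx orbT.
have -> : q `^ (- t) * v c `^ t = (q^-1 * v c) `^ t.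
  by rewrite powRM ?invr_ge0 ?av_ge0 ?ltW// -(powR_inv1 (ltW q0)) -powRrM mulN1r.
apply: ge0_ler_powR => //; rewrite ?nnegrE ?cnorm_ge0//.
  by rewrite mulr_ge0 ?av_ge0// ltW// avqV_gt0.
by rewrite le_max lexx orbT.
Qed.

(** Log-convexity of the column norms bounds the defect inside the edge by its value 1 at the ends,
    and it is never below 1. *)
Lemma defect_interp t M : 0 <= t <= 1 -> M \in unitmx ->
  defect 1 M = 1 -> defect q^-1 M = 1 -> defect (q `^ (- t)) M = 1.
Proof.
move=> t01 MU d0 d1; have q0 := avq_gt0 v; have s0 : 0 < q `^ (- t) by rewrite powR_gt0.
have dM := unit_det_gt0 MU; have [t0 t1] := andP t01.
apply/eqP; rewrite eq_le defect_ge1// andbT ler_pdivrMr ?mulr_gt0// mul1r.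
have {d0} d0 : cnorm 1 (M i0 i0) (M i1 i0) * cnorm 1 (M i0 i1) (M i1 i1) = v (\det M).
  move: d0; rewrite /defect mulr1 => /(congr1 ( *%R^~ (v (\det M)))).
  by rewrite divfK ?mul1r// gt_eqF.
have {d1} d1 : cnorm q^-1 (M i0 i0) (M i1 i0) * cnorm q^-1 (M i0 i1) (M i1 i1)
    = v (\det M) / q.
  move: d1; rewrite /defect => /(congr1 ( *%R^~ (v (\det M) / q))).
  by rewrite divfK ?mul1r// gt_eqF// divr_gt0.
apply: le_trans (ler_pM (cnorm_ge0 _ _ _) (cnorm_ge0 _ _ _)
  (cnorm_interp _ _ t01) (cnorm_interp _ _ t01)) _.
rewrite mulrACA -!powRM ?cnorm_ge0// d0 d1 powRM ?invr_ge0 ?av_ge0 ?(ltW q0)// mulrA.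
rewrite -powRD ?(gt_eqF dM) ?implybT// subrK powRr1 ?av_ge0//.
by rewrite -(powR_inv1 (ltW q0)) -powRrM mulN1r.
Qed.

Lemma cnorm_powR t a c : (a != 0) || (c != 0) -> exists (n : int) (e : bool),
  cnorm (q `^ (- t)) a c = q `^ (n%:~R - e%:R * t).
Proof.
move=> ac; have q0 := avq_gt0 v; have s0 : 0 < q `^ (- t) by rewrite powR_gt0.
rewrite /cnorm; case: leP => h.
  have c0 : c != 0.
    apply: contraTneq ac => c0; move: h; rewrite c0 av0 mulr0 => a0.
    by rewrite eqxx orbF negbK -(av_eq0 v) eq_le a0 av_ge0.
  have [n ->] := av_disc v c0; exists n, true.
  by rewrite mul1r powRD ?(gt_eqF q0) ?implybT// powR_intmul ?(ltW q0)// mulrC.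
have a0 : a != 0 by rewrite -(av_gt0 v) (le_lt_trans _ h)// mulr_ge0 ?av_ge0 ?ltW.
have [n ->] := av_disc v a0; exists n, false.
by rewrite mul0r subr0 powR_intmul ?(ltW q0).
Qed.

(** The booleans record which entry of each column attains the norm; the resulting slope in [t] is
    1, 0 or -1. *)
Lemma defect_powR t M : M \in unitmx -> exists (n : int) (e e' : bool),
  defect (q `^ (- t)) M = q `^ (n%:~R + (1 - e%:R - e'%:R) * t).
Proof.
move=> MU; have q0 := avq_gt0 v.
have [m [e h0]] := cnorm_powR t (unit_col0 MU).
have [p [e' h1]] := cnorm_powR t (unit_col1 MU).
have [n dn] : exists n : int, v (\det M) = q ^ n by apply: av_disc; rewrite -unit2.
exists (m + p - n), e, e'; rewrite /defect h0 h1 dn -powR_intmul ?(ltW q0)//.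
rewrite -!powRD ?(gt_eqF q0) ?implybT// -powRN -powRD ?(gt_eqF q0) ?implybT//.
by congr powR; rewrite !rmorphD rmorphN /=; ring.
Qed.

Lemma powR_gt1 (x : R) : (1 < q `^ x) = (0 < x).
Proof.
have q0 := avq_gt0 v; have q1 := avq_gt1 v.
rewrite -ltr_ln ?posrE ?powR_gt0// ln1 ln_powR pmulr_lgt0// ln_gt0//.
Qed.

Lemma defect_gap0 M : M \in unitmx -> defect 1 M != 1 -> q <= defect 1 M.
Proof.
move=> MU d1; have q0 := avq_gt0 v.
have : 1 < defect 1 M by rewrite lt_neqAle eq_sym d1 defect_ge1.
have [n [e [e']]] := defect_powR 0 MU; rewrite oppr0 powRr0 mulr0 addr0 => ->.
rewrite powR_intmul ?(ltW q0)// -(expr0z q) avq_exprz_lt => n0.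
by rewrite -[leLHS](expr1z q) avq_exprz_le; lia.
Qed.

(** A positive number [n], [n + t] or [n - t] with [n] an integer is at least 1, [t] or [1 - t]
    respectively. *)
Lemma defect_gap t M : 0 < t < 1 -> M \in unitmx -> defect (q `^ (- t)) M != 1 ->
  q `^ Num.min t (1 - t) <= defect (q `^ (- t)) M.
Proof.
move=> /andP[t0 t1] MU d1; have q0 := avq_gt0 v; have q1 := avq_gt1 v.
have : 1 < defect (q `^ (- t)) M by rewrite lt_neqAle eq_sym d1 defect_ge1// powR_gt0.
have [n [e [e' ->]]] := defect_powR t MU.
rewrite powR_gt1 => x0; apply: ler_powR; first exact: ltW.
have [n1|n0] := leP (1 : int) n.
  have n1' : 1 <= n%:~R :> R by rewrite -[1]/(1%:~R) ler_int.
  by rewrite ge_min; apply/orP; right; case: e e' {x0} => [] [] /=; lra.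
have n0' : n%:~R <= 0 :> R by rewrite -[0]/(0%:~R) ler_int; lia.
case: e e' x0 => [] [] /= x0; try lra.
have [n00|nn0] := leP (0 : int) n.
  have nn0 : 0 <= n%:~R :> R by rewrite -[0]/(0%:~R) ler_int.
  by rewrite ge_min; apply/orP; left; lra.
have : n%:~R <= -1 :> R by rewrite -[-1]/((-1)%:~R) ler_int; lia.
lra.
Qed.

Lemma av_neq_scale t x y : 0 < t < 1 -> y != 0 -> v x <> v y * q `^ (- t).
Proof.
move=> /andP[t0 t1] y0; have q0 := avq_gt0 v.
have [->|/(av_disc v)[m ->]] := eqVneq x 0.
  by move=> /esym/eqP; rewrite av0 mulf_eq0 av_eq0 (negbTE y0) gt_eqF ?powR_gt0.
have [n ->] := av_disc v y0; rewrite -!powR_intmul ?(ltW q0)// -powRD ?(gt_eqF q0) ?implybT//.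
move=> /(congr1 (@ln R)); rewrite !ln_powR => /mulIf.
rewrite gt_eqF ?ln_gt0 ?avq_gt1// => /(_ isT) e.
have [mn|mn] := leP n m.
  have : n%:~R <= m%:~R :> R by rewrite ler_int.
  lra.
have : m%:~R <= n%:~R - 1 :> R by rewrite -[1]/(1%:~R) -rmorphB ler_int; lia.
lra.
Qed.

(** Here the diagonal entries give the column norms; dividing the columns by them leaves an upper
    right entry below [q ^ (-t)] and a lower left entry of at most [q ^ t < q], hence integral by
    discreteness. *)
Lemma defect1_iwahori_aux t M : 0 < t < 1 -> M \in unitmx ->
  defect (q `^ (- t)) M = 1 -> q `^ (- t) * v (M i1 i0) <= v (M i0 i0) ->
  v (M i0 i1) < q `^ (- t) * v (M i1 i1) ->
  exists x y, [/\ x != 0, y != 0 & iwahori v (M *m dg x y)].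
Proof.
move=> t01 MU d1 le0 lt1; have [t0 t1] := andP t01; have q0 := avq_gt0 v.
have s0 : 0 < q `^ (- t) by rewrite powR_gt0.
have d0 := unit_det_gt0 MU.
have a0 : M i0 i0 != 0.
  have := unit_col0 MU; apply: contraTneq => a0; rewrite a0 av0 in le0.
  by rewrite a0 eqxx negbK -(av_eq0 v) eq_le av_ge0 andbT -(pmulr_rle0 _ s0).
have dd0 : M i1 i1 != 0.
  by rewrite -(av_gt0 v) -(pmulr_rgt0 _ s0) (le_lt_trans _ lt1) ?av_ge0.
have ad : v (M i0 i0) * v (M i1 i1) = v (\det M).
  move: d1; rewrite /defect /cnorm (max_idPl le0) (max_idPr (ltW lt1)).
  move/(congr1 ( *%R^~ (v (\det M) * q `^ (- t)))).
  rewrite divfK ?mul1r ?gt_eqF ?mulr_gt0// mulrCA mulrC => /mulIf; apply.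
  by rewrite gt_eqF.
exists (M i0 i0)^-1, (M i1 i1)^-1; rewrite !invr_eq0; split=> //.
have va : v (M i0 i0) != 0 by rewrite av_eq0.
have vd : v (M i1 i1) != 0 by rewrite av_eq0.
have b1 : v (M i0 i1 / M i1 i1) < q `^ (- t).
  by rewrite avM avV ltr_pdivrMr ?av_gt0.
have s1 : q `^ (- t) < 1.
  by rewrite powRN invf_lt1 ?powR_gt0// powR_gt1.
have c1 : v (M i1 i0 / M i0 i0) <= 1.
  apply: av_ltq; rewrite avM avV ltr_pdivrMr ?av_gt0// -(ltr_pM2l s0).
  apply: (le_lt_trans le0); rewrite mulrA ltr_pMl ?av_gt0//.
  rewrite -[X in _ * X](powRr1 (ltW q0)) -powRD ?(gt_eqF q0) ?implybT// powR_gt1; lra.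
split; first split.
- apply: I2P; apply: I2P; rewrite mulmx2 !mx2E !mulr0 ?addr0 ?add0r ?divff ?av1//.
  exact: ltW (lt_trans b1 s1).
- by rewrite det_mulmx avM -ad det2 !mx2E mulr0 subr0 avM !avV; field; rewrite va vd.
- by rewrite mulmx2 !mx2E mulr0 add0r (lt_trans b1).
Qed.

(* Inside an edge only the apartments containing the edge have defect 1. *)
Lemma defect1_iwahori t M : 0 < t < 1 -> M \in unitmx -> defect (q `^ (- t)) M = 1 ->
  exists x y, [/\ x != 0, y != 0 &
    iwahori v (M *m dg x y) \/ iwahori v (M *m swap *m dg x y)].
Proof.
move=> t01 MU d1; have q0 := avq_gt0 v.
have s0 : 0 < q `^ (- t) by rewrite powR_gt0.
have [le0|lt0] := leP (q `^ (- t) * v (M i1 i0)) (v (M i0 i0));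
  have [le1|lt1] := leP (q `^ (- t) * v (M i1 i1)) (v (M i0 i1)).
(* If both norms are attained in the same row, defect 1 equates an integral power of [q] with a
   nonintegral one. *)
- have : v (M i0 i0 * M i0 i1) = v (\det M) * q `^ (- t).
    move: d1; rewrite /defect /cnorm (max_idPl le0) (max_idPl le1).
    move/(congr1 ( *%R^~ (v (\det M) * q `^ (- t)))).
    by rewrite divfK ?mul1r ?avM// gt_eqF// mulr_gt0// unit_det_gt0.
  by move/av_neq_scale => /(_ t01); rewrite -unit2 => /(_ MU).
- have [x [y [x0 y0 Iw]]] := defect1_iwahori_aux t01 MU d1 le0 lt1.
  by exists x, y; split=> //; left.
- have MsU : M *m swap \in unitmx by rewrite unitmx_mul MU swap_unit.
  have [|||x [y [x0 y0 Iw]]] := @defect1_iwahori_aux t (M *m swap) t01 MsU.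
  + by rewrite defect_swap.
  + by rewrite !mulmx2 !mx2E !mulr0 !mulr1 !add0r.
  + by rewrite !mulmx2 !mx2E !mulr0 !mulr1 !addr0.
  by exists x, y; split=> //; right.
- have cd0 : M i1 i0 * M i1 i1 != 0.
    rewrite -(av_gt0 v) avM mulr_gt0 // -(pmulr_rgt0 _ s0);
    [exact: le_lt_trans (av_ge0 _ _) lt0|exact: le_lt_trans (av_ge0 _ _) lt1].
  have : v (\det M) = v (M i1 i0 * M i1 i1) * q `^ (- t).
    move: d1; rewrite /defect /cnorm (max_idPr (ltW lt0)) (max_idPr (ltW lt1)).
    move/(congr1 ( *%R^~ (v (\det M) * q `^ (- t)))).
    rewrite divfK ?mul1r; last by rewrite gt_eqF// mulr_gt0// unit_det_gt0.
    rewrite avM mulrACA -mulrA => e; apply: (mulIf (lt0r_neq0 s0)); rewrite -e; ring.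
  by move/av_neq_scale => /(_ t01 cd0).
Qed.

End GeodesicDefect.

(** * Vertices, lines and geodesics of the tree *)

Section Lattices.
Variables (R : realType) (F : fieldType) (v : absval R F).
Local Notation pi := (avpi v).
Local Notation i0 := (ord0 : 'I_2).
Local Notation i1 := (ord_max : 'I_2).
Local Notation dpi := (dpi v).
Local Notation GLO := (GLO v).
Local Notation intmx := (intmx v).
Implicit Types (M N g h : 'M[F]_2) (x y : 'rV[F]_2) (L : set 'rV[F]_2).

(** This definition and the next four restate [Ospan], [lattice], [scale_lat], [hclass] and [adj]
    over an abstract valued field; rewriting with [OinfE] identifies them with the originals. *)
Definition span2 x y : set 'rV[F]_2 := [set z | exists c1 c2,
  [/\ [set c | v c <= 1] c1, [set c | v c <= 1] c2 & z = c1 *: x + c2 *: y]].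

Definition lattice2 L := exists x y, row_free (col_mx x y) /\ L = span2 x y.

Definition scale2 (c : F) L : set 'rV[F]_2 := [set c *: x | x in L].

Definition hclass2 L : set (set 'rV[F]_2) :=
  [set L' | exists c, c != 0 /\ L' = scale2 c L].

Definition adj2 (u w : set (set 'rV[F]_2)) :=
  exists L L', [/\ lattice2 L, lattice2 L', u = hclass2 L, w = hclass2 L' &
    scale2 pi L `<` L' /\ L' `<` L].

Definition lat M := span2 (row i0 M) (row i1 M).

(* [vtx g] is the translate by g of the vertex v_0. *)
Definition vtx g := hclass2 (lat (invmx g)).

Lemma mulmx_rows x M : x *m M = x ord0 i0 *: row i0 M + x ord0 i1 *: row i1 M.
Proof. by apply/rowP => j; rewrite mulmx2 !mxE. Qed.

Lemma latP M x : lat M x <-> exists2 y : 'rV[F]_2, intmx y & x = y *m M.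
Proof.
split=> [[c1 [c2 [c1i c2i ->]]]|[y yi ->]].
  exists (\row_j if j == i0 then c1 else c2).
    by move=> i; apply: I2P; rewrite mxE.
  by rewrite mulmx_rows !mxE.
by exists (y ord0 i0), (y ord0 i1); split; rewrite /= ?yi// mulmx_rows.
Qed.

Lemma row0_col_mx x y : row i0 (col_mx x y : 'M[F]_2) = x.
Proof.
apply/rowP => j; rewrite mxE -[RHS](col_mxEu x y 0 j).
by congr (fun_of_matrix _ _ _); apply: ord_inj.
Qed.

Lemma row1_col_mx x y : row i1 (col_mx x y : 'M[F]_2) = y.
Proof.
apply/rowP => j; rewrite mxE -[RHS](col_mxEd x y 0 j).
by congr (fun_of_matrix _ _ _); apply: ord_inj.
Qed.

Lemma lattice2P L : lattice2 L <-> exists2 M, M \in unitmx & L = lat M.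
Proof.
split=> [[x [y [xy ->]]]|[M MU ->]].
  by exists (col_mx x y : 'M[F]_2); [rewrite -row_free_unit|rewrite /lat row0_col_mx row1_col_mx].
exists (row i0 M), (row i1 M); split=> //.
have -> : col_mx (row i0 M) (row i1 M) = M :> 'M[F]_2.
  by apply/row_matrixP; apply: I2P; rewrite ?row0_col_mx ?row1_col_mx.
by rewrite row_free_unit.
Qed.

Lemma lat_mulr M N : [set x *m N | x in lat M] = lat (M *m N).
Proof.
apply/seteqP; split=> [_ [_ /latP[y yi ->] <-]|x /latP[y yi ->]].
  by apply/latP; exists y; rewrite ?mulmxA.
by exists (y *m M); [apply/latP; exists y|rewrite mulmxA].
Qed.

Lemma scale2_lat c M : scale2 c (lat M) = lat (c *: M).
Proof.
apply/seteqP; split=> [_ [_ /latP[y yi ->] <-]|x /latP[y yi ->]].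
  by apply/latP; exists y; rewrite ?scalemxAr.
by exists (y *m M); [apply/latP; exists y|rewrite scalemxAr].
Qed.

Lemma lat_sub M N : intmx N -> lat (N *m M) `<=` lat M.
Proof.
move=> Ni _ /latP[y yi ->]; apply/latP; exists (y *m N); last by rewrite mulmxA.
exact: intmxM.
Qed.

Lemma lat_subP M N : M \in unitmx -> lat N `<=` lat M -> intmx (N *m invmx M).
Proof.
move=> MU NM i j; have /NM /latP[y yi e] : lat N (row i N).
  apply/latP; exists (delta_mx 0 i); last by rewrite -rowE.
  by move=> i' j'; rewrite mxE; case: andb; rewrite ?av1 ?av0 ?ler01.
have -> : (N *m invmx M) i j = y 0 j.
  by rewrite -[y]mulmx1 -(mulmxV MU) mulmxA -e -row_mul [RHS]mxE.
exact: yi.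
Qed.

Lemma lat_eqP M N : M \in unitmx -> N \in unitmx ->
  lat M = lat N <-> GLO (N *m invmx M).
Proof.
move=> MU NU; split=> [e|kO].
  apply: intmx_inv_GLO.
  - by rewrite unitmx_mul NU unitmx_inv.
  - by apply: lat_subP => //; rewrite e.
  - by rewrite invmxM2 ?unitmx_inv// invmxK; apply: lat_subP => //; rewrite e.
have -> : N = N *m invmx M *m M by rewrite mulmxKV.
have kU := GLO_unit kO; apply/seteqP; split; last by apply: lat_sub; case: kO.
rewrite -{1}[M](mulKmx kU); apply: lat_sub.
by case: (GLOV kO).
Qed.

Lemma hclass2_scale c L : c != 0 -> hclass2 (scale2 c L) = hclass2 L.
Proof.
move=> c0; have scc (e d : F) : scale2 e (scale2 d L) = scale2 (e * d) L.
  rewrite /scale2 image_comp; congr (_ @` L); apply: funext => y.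
  by rewrite [LHS]/= scalerA.
apply/seteqP; split=> [_ [d [d0 ->]]|_ [d [d0 ->]]].
  by exists (d * c); rewrite scc mulf_neq0.
by exists (d / c); rewrite scc divfK// mulf_neq0 ?invr_eq0.
Qed.

Lemma hclass2_id L : hclass2 L L.
Proof.
exists 1; rewrite oner_neq0; split=> //; rewrite /scale2 -[LHS]image_id.
by congr (_ @` L); apply: funext => y; rewrite scale1r.
Qed.

Lemma act_vtx g h : g \in unitmx -> h \in unitmx -> actv g (vtx h) = vtx (g *m h).
Proof.
move=> gU hU; rewrite /vtx invmxM2//.
apply/seteqP; split=> [_ [_ [c [c0 ->]] <-]|_ [c [c0 ->]]].
  by exists c; split=> //; rewrite !scale2_lat lat_mulr scalemxAl.
exists (scale2 c (lat (invmx h))); first by exists c.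
by rewrite !scale2_lat lat_mulr scalemxAl.
Qed.

(** The stabilizer of [v_0] consists of the scalar multiples of elements of [GLO]. *)
Lemma vtx_eq g h : g \in unitmx -> h \in unitmx ->
  vtx g = vtx h <-> exists2 c, c != 0 & GLO (c *: (invmx g *m h)).
Proof.
move=> gU hU.
have key c : c != 0 -> lat (c *: invmx g) = lat (invmx h) <->
    GLO (c *: (invmx g *m h)).
  move=> c0; have cU : c *: invmx g \in unitmx.
    by rewrite unitmxZ ?unitmx_inv// unitfE.
  have -> : lat (c *: invmx g) = lat (invmx h) <-> lat (invmx h) = lat (c *: invmx g).
    by split.
  by rewrite lat_eqP ?unitmx_inv// invmxK scalemxAl.
split=> [e|[c c0 /(key _ c0) e]].
  have : hclass2 (lat (invmx g)) (lat (invmx h)) by rewrite -/(vtx g) e; exact: hclass2_id.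
  by move=> [c [c0 e']]; exists c => //; apply/key => //; rewrite e' scale2_lat.
by rewrite /vtx -e -scale2_lat hclass2_scale.
Qed.

Lemma vtx_scale c g : c != 0 -> g \in unitmx -> vtx (c *: g) = vtx g.
Proof.
move=> c0 gU; have cU : c *: g \in unitmx by rewrite unitmxZ// unitfE.
apply/(vtx_eq cU gU); exists c => //.
rewrite scalemxAr mulVmx//; exact: GLO1.
Qed.

Lemma vtx_GLO g k : g \in unitmx -> GLO k -> vtx (g *m k) = vtx g.
Proof.
move=> gU kO; have kU := GLO_unit kO; apply/esym/(vtx_eq gU).
  by rewrite unitmx_mul gU.
by exists 1; rewrite ?oner_neq0// scale1r mulKmx.
Qed.

Lemma vertex2P u : (exists L, lattice2 L /\ u = hclass2 L) <->
  exists2 g, g \in unitmx & u = vtx g.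
Proof.
split=> [[L [/lattice2P[M MU ->] ->]]|[g gU ->]].
  by exists (invmx M); rewrite ?unitmx_inv// /vtx invmxK.
exists (lat (invmx g)); split=> //; apply/lattice2P.
by exists (invmx g); rewrite ?unitmx_inv.
Qed.

(** Transitivity of [GL_2] on oriented edges: a lattice strictly between [pi L] and [L] is spanned
    by [x] and [pi y] for a suitable basis [x], [y] of [L]. *)
Lemma adj2P u w : adj2 u w <->
  exists g, [/\ g \in unitmx, u = vtx g & w = vtx (g *m dpi 1)].
Proof.
have p0 := pi_neq0 v; have pi1 : v pi <= 1 by rewrite av_pi ltW// avqV_lt1.
split=> [[L [L' [/lattice2P[M MU eL] /lattice2P[M' M'U eL'] -> ->]]]|].
  rewrite {}eL {}eL' scale2_lat => -[[piLL' nL'piL] [L'L nLL']].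
  (* A vector of [L'] outside [pi L] is primitive in [L], so it can be completed to a basis of
     [L]. *)
  have [x xL' nx] : exists2 x, lat M' x & ~ lat (pi *: M) x.
    by apply: contrapT => n; apply: nL'piL => x xL'; apply: contrapT => nx; apply: n; exists x.
  have /latP[y yi xy] := L'L _ xL'.
  have [k kO ky] : exists2 k, GLO k & row i0 k = y.
    have ny : ~ (v (y ord0 i0) < 1 /\ v (y ord0 i1) < 1).
      move=> [y0 y1]; apply: nx; apply/latP; exists (pi^-1 *: y); last first.
        by rewrite -scalemxAl -scalemxAr scalerA mulVf// scale1r.
      have aux c : v c < 1 -> v (pi^-1 * c) <= 1.
        move=> c1; rewrite avM avV av_pi invrK -ler_pdivlMl ?avq_gt0//.
        by rewrite mulr1 av_lt1.
      by move=> i; rewrite ord1; apply: I2P; rewrite mxE aux.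
    have [y0|y0] := ltP (v (y ord0 i0)) 1.
      have y1 : v (y ord0 i1) = 1.
        apply/eqP; rewrite eq_le yi leNgt; apply/negP => ?; exact: ny.
      exists (mx2 (y ord0 i0) (y ord0 i1) 1 0); last first.
        by apply/rowP; apply: I2P; rewrite mxE mx2E.
      split; last by rewrite det2 !mx2E mulr0 sub0r avN mulr1.
      by apply: I2P; apply: I2P; rewrite mx2E ?yi ?av0 ?av1.
    have {}y0 : v (y ord0 i0) = 1 by apply/eqP; rewrite eq_le yi.
    exists (mx2 (y ord0 i0) (y ord0 i1) 0 1); last first.
      by apply/rowP; apply: I2P; rewrite mxE mx2E.
    split; last by rewrite det2 !mx2E mulr0 subr0 mulr1.
    by apply: I2P; apply: I2P; rewrite mx2E ?yi ?av0 ?av1.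
  have kU := GLO_unit kO; set N := k *m M.
  have NU : N \in unitmx by rewrite unitmx_mul kU.
  have eMN : lat M = lat N by apply/lat_eqP => //; rewrite /N mulmxK.
  have N0 : row i0 N = x by rewrite row_mul ky xy.
  (* The scalar [pi], invisible in the homothety class, turns [dpi (-1)] into the diagonal matrix
     with entries 1 and [pi]. *)
  have eL' : lat M' = lat (dpi (-1) *m (pi *: N)).
    have e z : dpi (-1) *m (pi *: z) = mx2 1 0 0 pi *m z :> 'M[F]_2.
      rewrite -scalemxAr scalemxAl; congr (_ *m _).
      by apply: mx2P; rewrite !mxE /= ?mulr0 ?mulr1// exprN1 mulfV.
    rewrite e.
    have r0 : row i0 (mx2 1 0 0 pi *m N) = x.
      rewrite row_mul mulmx_rows !mxE /= scale1r scale0r addr0 N0//.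
    have r1 : row i1 (mx2 1 0 0 pi *m N) = pi *: row i1 N.
      by rewrite row_mul mulmx_rows !mxE /= scale0r add0r.
    apply/seteqP; split=> z.
      move=> zL'; have : lat N z by rewrite -eMN; exact: L'L.
      move=> [c1 [c2 [c1i c2i ez]]].
      have [c21|c21] := ltP (v c2) 1.
        exists c1, (c2 / pi); split=> //; last by rewrite r0 r1 scalerA divfK// -N0.
        rewrite /= avM avV av_pi invrK -ler_pdivlMr ?avq_gt0// div1r.
        exact: av_lt1.
      have {c21} c21 : v c2 = 1 by apply/eqP; rewrite eq_le c2i.
      have c20 : c2 != 0 by rewrite -(av_gt0 v) c21.
      (* With [c2] a unit, [L'] would also contain the second basis vector, hence all of [L]. *)
      exfalso; apply: nLL'; rewrite eMN.
      have /latP[z' z'i ez'] := zL'; have /latP[x' x'i ex'] := xL'.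
      move=> t [d1 [d2 [d1i d2i ->]]].
      apply/latP; exists (d1 *: x' + (d2 / c2) *: (z' - c1 *: x')).
        move=> i j; rewrite !mxE; apply: avD_le.
          by rewrite avM mulr_ile1 ?av_ge0.
        rewrite avM mulr_ile1 ?av_ge0//; first by rewrite avM avV c21 invr1 mulr1.
        by apply: avD_le => //; rewrite avN avM mulr_ile1 ?av_ge0.
      rewrite mulmxDl -!scalemxAl mulmxBl -scalemxAl -ez' -ex' N0 ez N0.
      by rewrite addrAC subrr add0r scalerA divfK.
    move=> [c1 [c2 [c1i c2i ->]]]; rewrite r0 r1.
    have : lat M' (pi *: row i1 N).
      apply: piLL'; rewrite -scale2_lat; exists (row i1 N) => //.
      rewrite eMN; exists 0, 1; rewrite /= av0 av1; split=> //.
      by rewrite scale0r scale1r add0r.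
    move=> /latP[z' z'i ->]; have /latP[x' x'i ->] := xL'.
    apply/latP; exists (c1 *: x' + c2 *: z'); last by rewrite mulmxDl -!scalemxAl.
    by move=> i j; rewrite !mxE; apply: avD_le; rewrite avM mulr_ile1 ?av_ge0.
  exists (invmx N); split; first by rewrite unitmx_inv.
    by rewrite /vtx invmxK eMN.
  rewrite /vtx invmxM2 ?unitmx_inv ?dpi_unit// invmxK dpiV eL'.
  by rewrite -scalemxAr -scale2_lat hclass2_scale.
move=> [g [gU -> ->]]; set M := invmx g.
have MU : M \in unitmx by rewrite unitmx_inv.
have e : pi *: (dpi (-1) *m M) = mx2 1 0 0 pi *m M.
  rewrite scalemxAl; congr (_ *m _).
  by apply: mx2P; rewrite !mxE /= ?mulr0 ?mulr1// exprN1 mulfV.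
have eU : mx2 1 0 0 pi *m M \in unitmx.
  by rewrite unitmx_mul MU unit2 det2 !mx2E mul1r mulr0 subr0 p0.
exists (lat M), (lat (mx2 1 0 0 pi *m M)); split.
- by apply/lattice2P; exists M.
- by apply/lattice2P; exists (mx2 1 0 0 pi *m M).
- by [].
- rewrite /vtx invmxM2 ?dpi_unit// dpiV -/M -e -scale2_lat.
  by rewrite hclass2_scale.
have dint : intmx (mx2 1 0 0 pi).
  by apply: I2P; apply: I2P; rewrite mx2E ?av0 ?av1 ?ler01.
split; split.
- rewrite scale2_lat.
  have -> : pi *: M = mx2 pi 0 0 1 *m (mx2 1 0 0 pi *m M).
    rewrite mulmxA -mul_scalar_mx; congr (_ *m _).
    by apply: mx2P; rewrite mulmx2 !mxE /= ?mulr0 ?mul0r ?mulr1 ?mul1r ?addr0 ?add0r.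
  by apply: lat_sub; apply: I2P; apply: I2P; rewrite mx2E ?av0 ?av1 ?ler01.
- rewrite scale2_lat => /lat_subP.
  rewrite unitmxZ ?unitfE// => /(_ MU i0 i0).
  have -> : invmx (pi *: M) = pi^-1 *: g.
    apply/esym/mul_invmx2; rewrite -scalemxAl -scalemxAr scalerA divff//.
    by rewrite scale1r mulVmx.
  rewrite -mulmxA -scalemxAr mulVmx// -scalemxAr mulmx1 [X in v X]mxE mx2E mulr1.
  by rewrite avV av_pi invrK leNgt avq_gt1.
- exact: lat_sub.
- move=> /lat_subP; rewrite eU => /(_ isT i1 i1).
  rewrite invmxM2// ?unit2 ?det2 ?mx2E ?mul1r ?mulr0 ?subr0//; last first.
  rewrite mulmxA mulmxV// mul1mx.
  have -> : invmx (mx2 1 0 0 pi) = mx2 1 0 0 pi^-1.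
    apply/esym/mul_invmx2.
    by apply: mx2P; rewrite mulmx2 !mxE /= ?mulr0 ?mul0r ?mulr1 ?mul1r ?addr0 ?add0r ?mulfV.
  by rewrite mx2E avV av_pi invrK leNgt avq_gt1.
Qed.

End Lattices.

(** * Lines without backtracking and paths of edges *)

Section VertexDefect.
Variables (R : realType) (F : fieldType) (v : absval R F).
Local Notation q := (avq v).
Local Notation pi := (avpi v).
Local Notation i0 := (ord0 : 'I_2).
Local Notation i1 := (ord_max : 'I_2).
Local Notation dpi := (dpi v).
Local Notation GLO := (GLO v).
Local Notation vtx := (vtx v).
Local Notation adj2 := (adj2 v).
Local Notation vertT := (set (set 'rV[F]_2)).
Implicit Types (M N g h k : 'M[F]_2) (u w : vertT).

Lemma row0_dpi n : row i0 (dpi n) = pi ^ n *: delta_mx 0 i0.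
Proof. by apply/rowP; apply: I2P; rewrite !mxE /= ?mulr1 ?mulr0. Qed.

Lemma row1_dpi n : row i1 (dpi n) = delta_mx 0 i1.
Proof. by apply/rowP; apply: I2P; rewrite !mxE. Qed.

Lemma vtx_dpi n : vtx (dpi (- n)) =
  hclass2 (span2 v (pi ^ n *: delta_mx 0 i0) (delta_mx 0 i1)).
Proof. by rewrite /vtx dpiV opprK /lat row0_dpi row1_dpi. Qed.

(* The valuation of the determinant, mod 2, is the type of a vertex. *)
Lemma vtx_type (c g : 'M[F]_2) : c \in unitmx -> v (\det c) = 1 -> g \in unitmx ->
  vtx (c *m g) <> vtx (g *m dpi 1).
Proof.
move=> cU c1 gU; have q0 := avq_gt0 v.
have g0 : v (\det g) != 0 by rewrite av_eq0 -unit2.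
move/vtx_eq; rewrite !unitmx_mul cU gU dpi_unit => -[]// x x0 [_].
rewrite det_scale2 !det_mulmx det_inv det_mulmx det_dpi expr1z.
rewrite avM avX avM avV !avM c1 mul1r av_pi.
have [m ->] := av_disc v x0; rewrite mulKf//.
rewrite exprnP exprz_exp -[q^-1]exprN1 -expfzDr ?avq_neq0// -(expr0z q) => /eqP.
by rewrite eq_le !avq_exprz_le; lia.
Qed.

Lemma vtx_dpi_neq g : g \in unitmx -> vtx g <> vtx (g *m dpi 1).
Proof. by rewrite -{2}[g]mul1mx; apply: vtx_type; rewrite ?unitmx1// det1 av1. Qed.

Lemma adj2_vtx g : g \in unitmx -> adj2 (vtx g) (vtx (g *m dpi 1)).
Proof. by move=> gU; apply/adj2P; exists g. Qed.

(** [dpi 1 *m swap2 F] reverses the base edge: followed by [dpi 1] it equals [pi] times [swap2 F],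
    which fixes [v_0]. *)
Lemma vtx_flip g : g \in unitmx ->
  vtx g = vtx (g *m dpi 1 *m swap2 F *m dpi 1).
Proof.
move=> gU; rewrite -(vtx_scale v (pi_neq0 v) gU).
have -> : g *m dpi 1 *m swap2 F *m dpi 1 = (pi *: g) *m swap2 F.
  rewrite -!mulmxA -scalemxAl scalemxAr; congr (_ *m _).
  by apply: mx2P; rewrite mulmx2 [in RHS]mxE !mulmx2 !mx2E ?expr1z ?mulr0 ?mul0r ?mulr1 ?mul1r ?addr0 ?add0r ?mulr0 ?mulr1.
by rewrite vtx_GLO ?unitmxZ ?unitfE ?pi_neq0//; exact: GLO_swap.
Qed.

Lemma adj2_sym u w : adj2 u w -> adj2 w u.
Proof.
move=> /adj2P[g [gU -> ->]]; apply/adj2P.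
exists (g *m dpi 1 *m swap2 F); rewrite !unitmx_mul gU dpi_unit.
rewrite (GLO_unit (GLO_swap v)); split=> //; last by rewrite -vtx_flip.
by apply/esym/vtx_GLO; rewrite ?unitmx_mul ?gU ?dpi_unit//; exact: GLO_swap.
Qed.

(** Uses a chosen [g] carrying [v_0] to [u]; [vdefect_vtx] shows that the choice is irrelevant. The
    default value 1%:M keeps [vdefect_ge1] true for every [u]. *)
Definition vdefect h u : R :=
  defect v 1 (invmx (xget 1%:M [set g | g \in unitmx /\ u = vtx g]) *m h).

Lemma vdefect_vtx h g : g \in unitmx -> vdefect h (vtx g) = defect v 1 (invmx g *m h).
Proof.
move=> gU; rewrite /vdefect; case: xgetP => [g' _ [g'U e]|/(_ g)]; last by case.
have [c c0 kO] := (vtx_eq v gU g'U).1 e.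
rewrite -(defect_scale v 1 (invmx g' *m h) (invr_neq0 c0)) -(defect_GLO _ kO).
congr defect; rewrite -scalemxAl -scalemxAr scalerA divff// scale1r.
by rewrite -mulmxA mulKVmx.
Qed.

Lemma vdefect_ge1 h u : h \in unitmx -> 1 <= vdefect h u.
Proof.
move=> hU; apply: defect_ge1 => //; rewrite unitmx_mul hU unitmx_inv andbT.
by case: xgetP => [g -> []//|_]; rewrite unitmx1.
Qed.

Lemma vdefect_swap h u : vdefect (h *m swap2 F) u = vdefect h u.
Proof. by rewrite /vdefect mulmxA defect_swap. Qed.

(** Two edges leaving the same vertex come from matrices that differ by a scalar and some [k] in
    [GLO]; [defect_neighbours] makes [k] Iwahori, so their far ends coincide. *)
Lemma vdefect_neighbours h u w1 w2 : h \in unitmx -> adj2 u w1 -> adj2 u w2 ->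
  1 < vdefect h u -> vdefect h w1 <= vdefect h u -> vdefect h w2 <= vdefect h u ->
  w1 = w2.
Proof.
move=> hU /adj2P[g [gU -> ->]] /adj2P[g' [g'U e ->]].
have gdU : g *m dpi 1 \in unitmx by rewrite unitmx_mul gU dpi_unit.
have g'dU : g' *m dpi 1 \in unitmx by rewrite unitmx_mul g'U dpi_unit.
rewrite (vdefect_vtx h gdU) (vdefect_vtx h g'dU).
rewrite !invmxM2 ?dpi_unit// !dpiV -!mulmxA -!defect_shift vdefect_vtx//.
have [c c0 kO] := (vtx_eq v g'U gU).1 (esym e).
set k := c *: _ in kO; have kU := GLO_unit kO.
have kh : invmx g' *m h = c^-1 *: (k *m (invmx g *m h)).
  rewrite /k -scalemxAl scalerA mulVf// scale1r -mulmxA mulKVmx//.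
have gk : g' *m k = c *: g by rewrite /k -scalemxAr mulKVmx.
move=> d1 le1 le2.
have MU : invmx g *m h \in unitmx by rewrite unitmx_mul unitmx_inv gU.
have kI : iwahori v k.
  apply: (defect_neighbours MU kO d1 le1); rewrite defect_GLO//.
  by rewrite -(defect_scale v _ _ (invr_neq0 c0)) -kh.
have k'O := iwahori_conj kI.
rewrite -(vtx_scale v c0 gdU) scalemxAl -gk.
have -> : g' *m k *m dpi 1 = g' *m dpi 1 *m (dpi (-1) *m k *m dpi 1).
  by rewrite !mulmxA -[g' *m dpi 1 *m dpi (-1)]mulmxA -dpiD subrr dpi0 mulmx1.
by rewrite vtx_GLO.
Qed.

(** The vertex just left is a nearer neighbour; if the next vertex were not farther, uniqueness of
    such a neighbour would force a backtrack. *)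
Lemma ray_growth h (f : nat -> vertT) : h \in unitmx ->
  (forall j, adj2 (f j) (f j.+1)) -> (forall j, f j <> f j.+2) ->
  1 < vdefect h (f 0) < vdefect h (f 1) ->
  forall j, 1 < vdefect h (f j) < vdefect h (f j.+1).
Proof.
move=> hU fadj fneq f0; elim=> // j /andP[j1 j2].
have j3 : 1 < vdefect h (f j.+1) by apply: lt_trans j2.
rewrite j3 /= ltNge; apply/negP => le_j; apply: (fneq j).
by apply: (vdefect_neighbours hU (adj2_sym (fadj j)) (fadj j.+1) j3 (ltW j2) le_j).
Qed.

(* Off the geodesic the defect grows in at least one direction of a line without
   backtracking, so a line with the same ends never leaves the geodesic. *)
Lemma line_vdefect1 h (l : int -> vertT) : h \in unitmx ->
  (forall n, adj2 (l n) (l (n + 1))) -> injective l ->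
  (exists n0 : nat, forall n, (n0 <= n)%N -> vdefect h (l n%:Z) = 1) ->
  (exists n0 : nat, forall n, (n0 <= n)%N -> vdefect h (l (- n%:Z)) = 1) ->
  forall n, vdefect h (l n) = 1.
Proof.
move=> hU ladj linj [np npP] [nm nmP] n; apply/eqP.
apply: contrapT => /negP dn.
have {}dn : 1 < vdefect h (l n) by rewrite lt_neqAle eq_sym dn vdefect_ge1.
have [up|down] := ltP (vdefect h (l n)) (vdefect h (l (n + 1))).
  have grow : forall j : nat, 1 < vdefect h (l (n + j%:Z)) < vdefect h (l (n + j.+1%:Z)).
    apply: (@ray_growth h (fun j => l (n + j%:Z)) hU) => [j|j|]; last by rewrite addr0 dn.
      by have := ladj (n + j%:Z); rewrite -addrA -[1]/(1%:Z) -PoszD addn1.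
    by move=> /linj; lia.
  have := grow (np + `|n|)%N.
  have -> : n + (np + `|n|)%N%:Z = (absz (n + (np + `|n|)%N%:Z))%:Z by lia.
  by rewrite npP ?ltxx//; lia.
have grow : forall j : nat, 1 < vdefect h (l (n - j%:Z)) < vdefect h (l (n - j.+1%:Z)).
  apply: (@ray_growth h (fun j => l (n - j%:Z)) hU) => [j|j|].
  - apply: adj2_sym; have := ladj (n - j.+1%:Z).
    by have -> : n - j.+1%:Z + 1 = n - j%:Z by lia.
  - by move=> /linj; lia.
  (* The neighbour [l (n + 1)] is already the one that is not farther, so [l (n - 1)] has to be
     farther. *)
  - rewrite subr0 dn /= ltNge; apply/negP => down'.
    have a1 := ladj (n - 1); rewrite subrK in a1.
    have := vdefect_neighbours hU (ladj n) (adj2_sym a1) dn down down'.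
    by move=> /linj; lia.
have := grow (nm + `|n|)%N.
have -> : n - (nm + `|n|)%N%:Z = - (absz (n - (nm + `|n|)%N%:Z))%:Z by lia.
by rewrite nmP ?ltxx//; lia.
Qed.

Lemma vdefect_ray g h : g \in unitmx -> h \in unitmx -> (invmx g *m h) i1 i0 = 0 ->
  exists n0 : nat, forall n, (n0 <= n)%N -> vdefect h (vtx (g *m dpi (- n%:Z))) = 1.
Proof.
move=> gU hU h10.
have MU : invmx g *m h \in unitmx by rewrite unitmx_mul unitmx_inv gU.
have [n0 n0P] := defect_ray v MU h10; exists n0 => n /n0P <-.
rewrite vdefect_vtx ?unitmx_mul ?gU ?dpi_unit// invmxM2 ?dpi_unit// dpiV opprK.
by rewrite mulmxA.
Qed.

Lemma adj2_act g u w : g \in unitmx -> adj2 u w -> adj2 (actv g u) (actv g w).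
Proof.
move=> gU /adj2P[h [hU -> ->]].
rewrite !act_vtx ?unitmx_mul ?hU ?dpi_unit// mulmxA.
by apply: adj2_vtx; rewrite unitmx_mul gU.
Qed.

Inductive edge_path : vertT -> vertT -> nat -> Prop :=
| edge_nil u : edge_path u u 0
| edge_cons u w x n : adj2 u w -> edge_path w x n -> edge_path u x n.+1.

Lemma edge_path_act g u w n : g \in unitmx ->
  edge_path u w n -> edge_path (actv g u) (actv g w) n.
Proof.
move=> gU; elim=> {u w n} [u|u w x n uw _ IH]; first exact: edge_nil.
by apply: edge_cons IH; exact: adj2_act.
Qed.

(** Each factor [k *m dpi 1] extracted by [integral_split] is one edge and lowers the valuation of
    the determinant by one. *)
Lemma edge_path_integral n M : M \in unitmx -> intmx v M -> v (\det M) = q ^- n ->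
  edge_path (vtx 1%:M) (vtx M) n.
Proof.
elim: n M => [|n IHn] M MU Mi Md.
  have MO : GLO M by split=> //; rewrite Md expr0 invr1.
  by rewrite -[M]mul1mx (vtx_GLO (unitmx1 _ _) MO); exact: edge_nil.
have q0 := avq_gt0 v.
have d1 : v (\det M) < 1 by rewrite Md invf_lt1 ?exprn_gt0// exprn_egt1// avq_gt1.
have [k [M' [kO M'i M'U eM dM']]] := integral_split Mi MU d1.
have kU := GLO_unit kO; have kdU : k *m dpi 1 \in unitmx by rewrite unitmx_mul kU dpi_unit.
apply: (@edge_cons _ (vtx (k *m dpi 1))).
  by rewrite -(vtx_GLO (unitmx1 _ _) kO) mul1mx; exact: adj2_vtx.
have dM'n : v (\det M') = q ^- n by rewrite dM' Md exprS invfM mulVKf// gt_eqF.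
have := edge_path_act kdU (IHn M' M'U M'i dM'n).
by rewrite !act_vtx ?unitmx1// mulmx1 -eM.
Qed.

(** Connectedness of the tree. As [inf] of the empty set is 0, a positive lower bound on [tdist]
    presupposes that some path exists. *)
Lemma edge_path_vtx g h : g \in unitmx -> h \in unitmx -> exists n, edge_path (vtx g) (vtx h) n.
Proof.
move=> gU hU; have MU := unitmxM (unitmxV gU) hU.
have [c c0 Mi] := scale_integral v (invmx g *m h).
have cMU := unitmx_scale c0 MU.
have [n dM] : exists n : nat, v (\det (c *: (invmx g *m h))) = q ^- n.
  have := intmx_det Mi; have [m ->] : exists m : int, v (\det (c *: (invmx g *m h))) = q ^ m.
    by apply: av_disc; rewrite -unit2.
  rewrite -(expr0z q) avq_exprz_le => m0; exists (absz m).
  by rewrite exprnN; congr (_ ^ _); lia.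
exists n; have := edge_path_act gU (edge_path_integral cMU Mi dM).
by rewrite vtx_scale// !act_vtx ?unitmx1// mulmx1 mulKVmx.
Qed.

Definition same_ends h' h := mobP h' None = mobP h None /\ mobP h' (Some 0) = mobP h (Some 0).

Lemma same_ends_dg h x y : h \in unitmx -> x != 0 -> y != 0 -> same_ends (h *m dg x y) h.
Proof.
move=> hU x0 y0; have dU := dg_unit x0 y0; split; rewrite mobPM//; congr mobP.
  by rewrite /= !mx2E /proj_pt eqxx.
by rewrite mobP_Some0 /proj_pt !mx2E (negbTE y0) mul0r.
Qed.

Lemma swap_ends h : h \in unitmx ->
  mobP (h *m swap2 F) None = mobP h (Some 0) /\ mobP (h *m swap2 F) (Some 0) = mobP h None.
Proof.
move=> hU; have sU := swap_unit v; split; rewrite mobPM//; congr mobP.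
  by rewrite /= !mx2E /proj_pt oner_eq0 mul0r.
by rewrite mobP_Some0 /proj_pt !mx2E eqxx.
Qed.

(** Normalized columns turn [invmx g *m h] into an integral matrix whose determinant has the inverse
    of the defect as absolute value; its path of edges leads to a vertex of the geodesic. *)
Lemma edge_path_to_geodesic n g h : g \in unitmx -> h \in unitmx ->
  defect v 1 (invmx g *m h) <= q ^+ n ->
  exists h' m, [/\ (m <= n)%N, h' \in unitmx, same_ends h' h
    & edge_path (vtx g) (vtx h') m].
Proof.
move=> gU hU; have MU := unitmxM (unitmxV gU) hU.
have [x [y [x0 y0 Mu]]] := normalize_cols v MU.
rewrite -(defect_dg v 1 _ x0 y0) defect_unimodular//; have [Ni _ _] := Mu.
have dU := dg_unit x0 y0; have NU := unitmxM MU dU; have h'U := unitmxM hU dU.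
set N := _ *m dg x y in Mu Ni NU *.
have [m dN] : exists m : nat, v (\det N) = q ^- m.
  have := intmx_det Ni; have [m ->] : exists m : int, v (\det N) = q ^ m.
    by apply: av_disc; rewrite -unit2.
  rewrite -(expr0z q) avq_exprz_le => m0; exists (absz m).
  by rewrite exprnN; congr (_ ^ _); lia.
rewrite dN invrK => le_qmn; exists (h *m dg x y), m; split=> //.
- by move: le_qmn; rewrite !exprnP avq_exprz_le.
- exact: same_ends_dg.
have := edge_path_act gU (edge_path_integral NU Ni dN).
by rewrite !act_vtx ?unitmx1// mulmx1 /N -mulmxA mulKVmx.
Qed.

(** The guards on [t] restrict the hypotheses to the endpoints that carry nonzero weight, so that a
    vertex is covered too. *)
Lemma defect_vertices (t : R) g h : g \in unitmx -> h \in unitmx -> 0 <= t <= 1 ->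
  (t < 1 -> vdefect h (vtx g) = 1) -> (0 < t -> vdefect h (vtx (g *m dpi 1)) = 1) ->
  defect v (q `^ (- t)) (invmx g *m h) = 1.
Proof.
move=> gU hU t01; have MU := unitmxM (unitmxV gU) hU; have [t0 t1] := andP t01.
rewrite vdefect_vtx// vdefect_vtx ?unitmx_mul ?gU ?dpi_unit//.
rewrite invmxM2 ?dpi_unit// dpiV -mulmxA -defect_shift => d0 d1.
have [tt|tn0] := eqVneq t 0; first by rewrite tt oppr0 powRr0 d0// tt ltr01.
have {tn0} tp : 0 < t by rewrite lt_neqAle eq_sym tn0.
have [tt|tn1] := eqVneq t 1.
  by rewrite tt (powR_inv1 (ltW (avq_gt0 v))) d1.
by apply: defect_interp => //; [rewrite d0// lt_neqAle tn1|rewrite d1].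
Qed.

(** After rescaling its columns, [h] differs from [g] by an element of [GLO] at a vertex, of the
    Iwahori subgroup inside the edge. At a vertex only that vertex is matched, since [GLO] moves the
    rest of the edge; inside, the orientation may be opposite, hence [swap2 F]. *)
Lemma on_geodesic_matrix (t : R) g h : g \in unitmx -> h \in unitmx -> 0 <= t <= 1 ->
  defect v (q `^ (- t)) (invmx g *m h) = 1 ->
  exists h', [/\ h' \in unitmx, same_ends h' h \/ same_ends h' (h *m swap2 F),
    t < 1 -> vtx g = vtx h' & (0 < t < 1 -> vtx (g *m dpi 1) = vtx (h' *m dpi 1)) /\
      (t = 1 -> vtx (g *m dpi 1) = vtx h')].
Proof.
move=> gU hU /andP[t0 t1] dM; have MU := unitmxM (unitmxV gU) hU.
have gh N : g *m (invmx g *m h *m N) = h *m N by rewrite -mulmxA mulKVmx.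
have [tt|tn0] := eqVneq t 0.
  move: dM; rewrite tt oppr0 powRr0 => /(defect1_GLO MU)[x [y [x0 y0 kO]]].
  exists (h *m dg x y); split.
  - exact: unitmxM (dg_unit x0 y0).
  - by left; exact: same_ends_dg.
  - by rewrite -gh vtx_GLO.
  - by rewrite ltxx; split=> // /eqP; rewrite eq_sym oner_eq0.
have [tt|tn1] := eqVneq t 1.
  have M'U := unitmxM (dpi_unit v (-1)) MU.
  move: dM; rewrite tt (powR_inv1 (ltW (avq_gt0 v))) defect_shift.
  move=> /(defect1_GLO M'U)[x [y [x0 y0 kO]]].
  exists (h *m dg x y); split.
  - exact: unitmxM (dg_unit x0 y0).
  - by left; exact: same_ends_dg.
  - by rewrite ltxx.
  - rewrite ltxx andbF; split=> // _; rewrite -gh.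
    have -> : g *m (invmx g *m h *m dg x y) =
        g *m dpi 1 *m (dpi (-1) *m (invmx g *m h) *m dg x y).
      by rewrite !mulmxA -[g *m dpi 1 *m dpi (-1)]mulmxA -dpiD subrr dpi0 mulmx1.
    by rewrite (vtx_GLO _ kO)// unitmxM ?dpi_unit.
have t01 : 0 < t < 1 by rewrite !lt_neqAle eq_sym tn0 tn1 t0.
have [x [y [x0 y0 kI]]] := defect1_iwahori t01 MU dM.
have key h' : same_ends h' h \/ same_ends h' (h *m swap2 F) -> iwahori v (invmx g *m h') ->
    exists h', [/\ h' \in unitmx, same_ends h' h \/ same_ends h' (h *m swap2 F),
      t < 1 -> vtx g = vtx h' & (0 < t < 1 -> vtx (g *m dpi 1) = vtx (h' *m dpi 1)) /\
      (t = 1 -> vtx (g *m dpi 1) = vtx h')].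
  move=> ends kI'; have kO := proj1 kI'; have kU := GLO_unit kO.
  have eh' : h' = g *m (invmx g *m h') by rewrite mulKVmx.
  exists h'; split=> //.
  - by rewrite eh' unitmxM.
  - by rewrite eh' vtx_GLO.
  - split=> [_|/eqP]; last by rewrite (negbTE tn1).
    have -> : h' *m dpi 1 = g *m dpi 1 *m (dpi (-1) *m (invmx g *m h') *m dpi 1).
      rewrite {1}eh' !mulmxA -[g *m dpi 1 *m dpi (-1)]mulmxA -dpiD subrr dpi0 mulmx1.
      by [].
    by rewrite (vtx_GLO _ (iwahori_conj kI'))// unitmxM ?dpi_unit.
case: kI => kI.
  apply: (key (h *m dg x y)); last by rewrite mulmxA.
  by left; exact: same_ends_dg.
apply: (key (h *m swap2 F *m dg x y)); last by rewrite !mulmxA.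
by right; apply: same_ends_dg => //; apply: unitmxM => //; exact: swap_unit v.
Qed.

(** The image under [h] of the line of the [v_n], running from [h 0] to [h infinity]. *)
Definition std_line h (n : int) := vtx (h *m dpi (- n)).

Lemma std_line_adj h n : h \in unitmx -> adj2 (std_line h n) (std_line h (n + 1)).
Proof.
move=> hU; apply: adj2_sym; rewrite /std_line.
have -> : h *m dpi (- n) = h *m dpi (- (n + 1)) *m dpi 1.
  by rewrite -mulmxA -dpiD; congr (_ *m dpi _); lia.
by apply: adj2_vtx; rewrite unitmxM ?dpi_unit.
Qed.

Lemma std_line_inj h : h \in unitmx -> injective (std_line h).
Proof.
move=> hU m n; rewrite /std_line => /vtx_eq; rewrite !unitmxM ?dpi_unit//.
move=> -[]// c c0; rewrite invmxM2 ?dpi_unit// dpiV -mulmxA mulKmx// -dpiD => -[kO].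
rewrite det_scale2 det_dpi avM avX av_piXz => kd.
have := kO i1 i1; rewrite mxE mx2E mulr1.
have [p cp] := av_disc v c0; rewrite cp -(expr0z q) avq_exprz_le => p0.
have := kO i0 i0; rewrite mxE mx2E avM av_piXz cp -expfzDr ?avq_neq0//.
rewrite -{1}(expr0z q) avq_exprz_le => p1.
move/eqP: kd; rewrite cp exprnP exprz_exp -expfzDr ?avq_neq0// -(expr0z q).
by rewrite eq_le !avq_exprz_le; lia.
Qed.

Lemma std_line_opp h n : h \in unitmx -> std_line h (- n) = std_line (h *m swap2 F) n.
Proof.
move=> hU; rewrite /std_line opprK.
have -> : h *m swap2 F *m dpi (- n) = pi ^ (- n) *: (h *m dpi n *m swap2 F).
  rewrite -!mulmxA scalemxAr; congr (_ *m _).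
  apply: mx2P; rewrite [in RHS]mxE !mulmx2 !mx2E;
    rewrite ?(mulr0, mul0r, mulr1, mul1r, addr0, add0r)//.
  by rewrite -expfzDr ?pi_neq0// addNr.
have hdU : h *m dpi n \in unitmx by rewrite unitmxM ?dpi_unit.
have hdsU := unitmxM hdU (swap_unit v).
have p0 : pi ^ (- n) != 0 by rewrite expfz_neq0// pi_neq0.
rewrite (vtx_scale v p0 hdsU).
by apply/esym/vtx_GLO => //; exact: GLO_swap.
Qed.

End VertexDefect.

Lemma mobP_same_infinity (F : fieldType) (g h : 'M[F]_2) : g \in unitmx ->
  mobP g None = mobP h None -> (invmx g *m h) ord_max ord0 = 0.
Proof.
move=> gU e; rewrite invmx2// -scalemxAl mxE mulmx2 !mx2E.
suff -> : - g ord_max ord0 * h ord0 ord0 + g ord0 ord0 * h ord_max ord0 = 0.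
  by rewrite mulr0.
move: e; rewrite /= /proj_pt.
have [->|g0] := eqVneq (g ord_max ord0) 0; have [->|h0] := eqVneq (h ord_max ord0) 0 => //.
  by rewrite oppr0 mul0r mulr0 addr0.
move=> [e]; have -> : g ord0 ord0 = h ord0 ord0 / h ord_max ord0 * g ord_max ord0.
  by rewrite -e divfK.
by field.
Qed.

(** * Barycentric coordinates and the path metric *)

Section RealizationPaths.
Variables (R : realType) (K : fieldType).
Local Notation F := (laurent K).
Implicit Types (u w : vert K) (p x y z : tpoint R K) (g : 'M[F]_2).

Lemma vpoint_bary u w : vpoint R u = bary u w 0.
Proof. by apply: funext => x; rewrite /bary subr0 mul1r mul0r addr0. Qed.

Lemma baryC u w (t : R) : bary u w t = bary w u (1 - t).
Proof. by apply: funext => x; rewrite /bary opprB addrC subrKC. Qed.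

Lemma bary1 u w : bary u w 1 = vpoint R w.
Proof. by rewrite baryC subrr -vpoint_bary. Qed.

Lemma act_bary g u w (t : R) : g \in unitmx ->
  act_pt g (bary u w t) = bary (act_vert g u) (act_vert g w) t.
Proof.
move=> gU; apply: funext => x; rewrite /act_pt /bary.
have e u' : `[< act_vert (invmx g) x = u' >] = `[< x = act_vert g u' >].
  apply: asbool_equiv_eq; split=> [<-|->]; last exact: (act_vertK gU).
  exact/esym/(act_vertVK gU).
by rewrite !e.
Qed.

Lemma act_vpoint g u : g \in unitmx -> act_pt g (vpoint R u) = vpoint R (act_vert g u).
Proof. by move=> gU; rewrite (vpoint_bary u u) (act_bary _ _ _ gU) -vpoint_bary. Qed.

Lemma bary_supp u w (t : R) (x : vert K) : bary u w t x != 0 -> x = u \/ x = w.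
Proof.
rewrite /bary; case: asboolP => [-> _|_]; first by left.
case: asboolP => [-> _|_]; first by right.
by rewrite !mulr0 addr0 eqxx.
Qed.

Lemma bary_left u w (t : R) : u <> w -> bary u w t u = 1 - t.
Proof.
by move=> uw; rewrite /bary asboolT// asboolF// mulr1 mulr0 addr0.
Qed.

Lemma bary_right u w (t : R) : u <> w -> bary u w t w = t.
Proof.
by move=> uw; rewrite /bary asboolF ?asboolT// ?mulr1 ?mulr0 ?add0r// => e; apply: uw.
Qed.

Lemma path_length_ge0 p x (L : R) : path_length p x L -> 0 <= L.
Proof. by elim=> // *; rewrite addr_ge0. Qed.

Lemma path_trans p x y (L L' : R) :
  path_length p x L -> path_length x y L' -> path_length p y (L + L').
Proof.
move=> pL; elim: pL y L' => {p x L} [x|u w s t z L uw s01 t01 _ IH] y L' yL.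
  by rewrite add0r.
by rewrite -addrA; apply: path_cons => //; exact: IH.
Qed.

Lemma path_edge u w (s t : R) : adj u w -> 0 <= s <= 1 -> 0 <= t <= 1 ->
  path_length (bary u w s) (bary u w t) `|s - t|.
Proof.
move=> uw s01 t01; rewrite -[`|_|]addr0.
by apply: path_cons => //; exact: path_nil.
Qed.

Lemma path_adj u w : adj u w -> path_length (vpoint R u) (vpoint R w) 1.
Proof.
move=> uw; rewrite (vpoint_bary u w) -(bary1 u w).
have := @path_edge _ _ 0 1 uw; rewrite sub0r normrN normr1; apply.
  by rewrite lexx ler01.
by rewrite lexx ler01.
Qed.

(** Along a segment a coordinate changes by at most the length; this yields lower bounds for
    [tdist]. *)
Lemma path_length_coord p x (L : R) w : path_length p x L -> `|p w - x w| <= L.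
Proof.
elim=> {p x L} [x|u u' s t z L _ s01 t01 _ IH]; first by rewrite subrr normr0.
rewrite (_ : _ - _ = (bary u u' s w - bary u u' t w) + (bary u u' t w - z w)); last by ring.
apply: le_trans (ler_normD _ _) _; apply: lerD => //.
rewrite (_ : _ - _ = (s - t) * (`[< w = u' >]%:R - `[< w = u >]%:R)).
  rewrite normrM ler_piMr//.
  by case: asboolP => _; case: asboolP => _; rewrite ?subrr ?sub0r ?subr0 ?normrN ?normr1 ?normr0.
by rewrite /bary; ring.
Qed.

Lemma tdist_ge0 p x : 0 <= tdist p x.
Proof.
have [e|ne] := eqVneq [set L | path_length p x L] set0; first by rewrite /tdist e inf0.
by apply: lb_le_inf; [exact/set0P|move=> L /path_length_ge0].
Qed.

Lemma tdist_le p x (L : R) : path_length p x L -> tdist p x <= L.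
Proof.
by move=> pL; apply: ge_inf => //; exists 0 => M /path_length_ge0.
Qed.

Lemma tdist_set_le p (A : set (tpoint R K)) x (L : R) :
  A x -> path_length p x L -> tdist_set p A <= L.
Proof.
move=> Ax pL; apply: le_trans (tdist_le pL); apply: ge_inf; last by exists x.
by exists 0 => _ [y _ <-]; exact: tdist_ge0.
Qed.

End RealizationPaths.

Definition laurent_abs (R : realType) (K : finFieldType) (C : Cinfty R K) :
    absval R (laurent K) :=
  AbsVal (q_gt1 R K) (absF_unif C) (absF_ge0 C) (absF_eq0 C) (absFM C) (@absFD_le _ _ C)
    (@absF_disc _ _ C).

(** * The tree over Laurent series and its geodesics *)

Section BruhatTitsTree.
Variables (R : realType) (K : finFieldType) (C : Cinfty R K).
Local Notation F := (laurent K).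
Local Notation v := (laurent_abs C).
Local Notation q := (avq v).
Local Notation vtx := (vtx v).
Local Notation dpi := (dpi v).
Implicit Types (u w : vert K) (g h : 'M[F]_2) (a b : P1 K).

Lemma OinfE : @Oinf K = [set c | v c <= 1].
Proof. by apply/seteqP; split=> c h; apply/(Oinf_absF C). Qed.

Lemma adjE u w : adj u w <-> adj2 v u w.
Proof. by rewrite /adj /lattice /Ospan OinfE. Qed.

Lemma is_vertexP u : is_vertex u <-> exists2 g, g \in unitmx & u = vtx g.
Proof. by rewrite /is_vertex /lattice /Ospan OinfE; exact: vertex2P. Qed.

Lemma std_vertexE (n : int) : @std_vertex K n = vtx (dpi (- n)).
Proof.
by rewrite vtx_dpi /std_vertex /Ospan OinfE.
Qed.

Lemma act_vert_vtx g h : g \in unitmx -> h \in unitmx -> act_vert g (vtx h) = vtx (g *m h).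
Proof. exact: act_vtx. Qed.

Lemma act_std g (n : int) : g \in unitmx -> act_vert g (@std_vertex K n) = vtx (g *m dpi (- n)).
Proof. by move=> gU; rewrite std_vertexE; exact: (act_vert_vtx gU (dpi_unit v (- n))). Qed.

Lemma adj_vtx g : g \in unitmx -> adj (vtx g) (vtx (g *m dpi 1)).
Proof. by move=> gU; apply/adjE/adj2_vtx. Qed.

Lemma adj_sym u w : adj u w -> adj w u.
Proof. by move=> /adjE/adj2_sym/adjE. Qed.

Lemma adjP u w : adj u w -> exists g, [/\ g \in unitmx, u = vtx g & w = vtx (g *m dpi 1)].
Proof. by move=> /adjE/adj2P. Qed.

Lemma adj_neq u w : adj u w -> u <> w.
Proof. by move=> /adjP[g [gU -> ->]]; exact: vtx_dpi_neq. Qed.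

Lemma edge_path_length u w n : edge_path v u w n -> path_length (vpoint R u) (vpoint R w) n%:R.
Proof.
elim=> {u w n} [u|u w x n uw _ IH]; first exact: path_nil.
rewrite -natr1 addrC; apply: path_trans IH; apply: path_adj; exact/adjE.
Qed.

Lemma path_vertices u w : is_vertex u -> is_vertex w ->
  exists L : R, path_length (vpoint R u) (vpoint R w) L.
Proof.
move=> /is_vertexP[g gU ->] /is_vertexP[h hU ->].
have [n p] := edge_path_vtx v gU hU; exists n%:R; exact: edge_path_length.
Qed.

Lemma tp_vertex u : is_vertex u -> tp (vpoint R u) = 1.
Proof. by move=> uV; rewrite /tp asboolT//; exists u. Qed.

Lemma adj_vertex u w : adj u w -> is_vertex u /\ is_vertex w.
Proof. by move=> [L [L' [Lu L'w -> -> _]]]; split; [exists L|exists L']. Qed.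

(** The coordinate at [u] is [1 - t], and 0 or 1 at a vertex, which bounds every path to a vertex
    from below; the two pieces of the edge give the upper bounds. *)
Lemma tp_open_edge u w (t : R) : adj u w -> 0 < t < 1 ->
  0 < tp (bary u w t) <= Num.min t (1 - t).
Proof.
move=> uw /andP[t0 t1]; have uw' := adj_neq uw; have [uV wV] := adj_vertex uw.
have far x : is_vertex x -> Num.min t (1 - t) <= `|bary u w t u - vpoint R x u|.
  move=> _; rewrite (bary_left _ uw') /vpoint; case: asboolP => _.
    by rewrite ge_min -normrN opprB subKr (ger0_norm (ltW t0)) lexx.
  by rewrite subr0 ger0_norm ?subr_ge0 ?(ltW t1)// ge_min lexx orbT.
have m0 : 0 < Num.min t (1 - t) by rewrite lt_min t0 subr_gt0.
have nv : ~ vertex_points (bary u w t).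
  by move=> [x xV e]; have := far x xV; rewrite e subrr normr0 leNgt m0.
rewrite /tp asboolF//; apply/andP; split.
  apply: (lt_le_trans m0); apply: lb_le_inf.
    by exists (tdist (bary u w t) (vpoint R u)), (vpoint R u) => //; exists u.
  move=> _ [_ [x xV <-] <-]; apply: lb_le_inf.
    have [L pL] := path_vertices uV xV.
    exists (`|t - 0| + L); apply: path_cons => //; first by rewrite !ltW.
      by rewrite lexx ler01.
    by rewrite -vpoint_bary.
  by move=> L /(path_length_coord u); apply: le_trans; exact: far.
have t01 : 0 <= t <= 1 by rewrite !ltW.
rewrite le_min; apply/andP; split.
  apply: (@tdist_set_le _ _ _ _ (bary u w 0)); first by exists u => //; exact: vpoint_bary.
  have := @path_edge _ _ _ _ t 0 uw t01; rewrite subr0 ger0_norm ?(ltW t0)//; apply.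
  by rewrite lexx ler01.
apply: (@tdist_set_le _ _ _ _ (bary u w 1)); first by exists w => //; rewrite bary1.
have := @path_edge _ _ _ _ t 1 uw t01; rewrite distrC ger0_norm ?subr_ge0 ?(ltW t1)//; apply.
by rewrite ler01 lexx.
Qed.

Lemma mobP1_swap h : h \in unitmx -> mobP1 (h *m swap2 F) None = mobP1 h (Some 0)
  /\ mobP1 (h *m swap2 F) (Some 0) = mobP1 h None.
Proof. exact (@swap_ends _ _ v h). Qed.

Lemma mobP1_ends h' h : same_ends h' h ->
  mobP1 h' None = mobP1 h None /\ mobP1 h' (Some 0) = mobP1 h (Some 0).
Proof. exact id. Qed.

Lemma std_line_represents h : h \in unitmx ->
  represents (fun n => std_line v h n%:Z) (mobP1 h None).
Proof.
move=> hU; split.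
  split=> [n|m n /(std_line_inj hU)[//]].
  by apply/adjE; have := std_line_adj v n%:Z hU; rewrite -[1]/(1%:Z) -PoszD addn1.
by exists h; split=> //; exists 0%N, 0%N => i; rewrite (act_std _ hU).
Qed.

Lemma std_line_between h : h \in unitmx ->
  line_between (mobP1 h (Some 0)) (mobP1 h None) (std_line v h).
Proof.
move=> hU; have hsU := unitmxM hU (swap_unit v); split.
- by move=> n; apply/adjE; exact (std_line_adj v n hU).
- exact (std_line_inj hU).
- have -> : (fun n : nat => std_line v h (- n%:Z)) = (fun n => std_line v (h *m swap2 F) n%:Z).
    by apply: funext => n; exact (std_line_opp v n%:Z hU).
  by have := std_line_represents hsU; rewrite (proj1 (mobP1_swap hU)).
- exact (std_line_represents hU).
Qed.

Lemma geodesic_sym a b (x : tpoint R K) : geodesic a b x -> geodesic b a x.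
Proof.
move=> [l [n [t [[ladj linj la lb] /andP[t0 t1] ->]]]].
exists (fun m => l (- m)), (- (n + 1)), (1 - t); split.
- split=> //.
  + move=> m; apply: adj_sym; have := ladj (- (m + 1)).
    by have -> : - (m + 1) + 1 = - m by lia.
  + by move=> m m' /linj; lia.
  + by have -> : (fun m : nat => l (- - m%:Z)) = (fun m => l m%:Z)
      by apply: funext => m; rewrite opprK.
- by rewrite subr_ge0 t1 lerBlDr lerDl t0.
- rewrite opprK; have -> : - (- (n + 1) + 1) = n by lia.
  exact: baryC.
Qed.

Lemma geodesic_edge h (t : R) : h \in unitmx -> 0 <= t <= 1 ->
  geodesic (mobP1 h (Some 0)) (mobP1 h None) (bary (vtx h) (vtx (h *m dpi 1)) t).
Proof.
(* [vtx (h *m dpi 1)] is the vertex of index -1, so the edge is traversed backwards. *)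
move=> hU /andP[t0 t1]; exists (std_line v h), (-1), (1 - t); split.
- exact (std_line_between hU).
- by rewrite subr_ge0 t1 lerBlDr lerDl t0.
- rewrite /std_line opprK addNr oppr0 dpi0 mulmx1; exact: baryC.
Qed.

Lemma geodesic_vertex h : h \in unitmx ->
  geodesic (mobP1 h (Some 0)) (mobP1 h None) (vpoint R (vtx h)).
Proof.
move=> hU; have t01 : 0 <= (0 : R) <= 1 by rewrite lexx ler01.
by rewrite (vpoint_bary R (vtx h) (vtx (h *m dpi 1))); exact (geodesic_edge hU t01).
Qed.

(** Each half of an arbitrary line from [a] to [b] eventually follows a translate of the standard
    ray to the same end, where [vdefect_ray] applies; [line_vdefect1] then fills the middle. *)
Lemma geodesic_vdefect a b h (l : int -> vert K) : h \in unitmx ->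
  mobP1 h (Some 0) = a -> mobP1 h None = b -> line_between a b l ->
  forall n, vdefect v h (l n) = 1.
Proof.
move=> hU ha hb [ladj linj la lb].
have tail (rho : nat -> vert K) h' : h' \in unitmx -> represents rho (mobP1 h' None) ->
    exists n0 : nat, forall n, (n0 <= n)%N -> vdefect v h' (rho n) = 1.
  move=> h'U [_ [g [gU ge [m [n mn]]]]].
  have [n0 n0P] := vdefect_ray v gU h'U (mobP_same_infinity gU ge).
  exists (m + n0)%N => i mi; have -> : i = (m + (i - m))%N by lia.
  rewrite mn (act_std _ gU); apply: n0P; lia.
have hsU := unitmxM hU (swap_unit v).
apply: (line_vdefect1 hU) => [|//||].
- by move=> n; apply/adjE.
- by rewrite -hb in lb; exact: (tail _ _ hU lb).
(* [swap2 F] exchanges the ends, so the half going to [a] is also treated as a ray to the image of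
   infinity. *)
- rewrite -ha -(proj1 (mobP1_swap hU)) in la.
  have [n0 n0P] := tail _ _ hsU la; exists n0 => n /n0P.
  by rewrite vdefect_swap.
Qed.

(** One direction reads the defect off the vertices of a line through the point; the other builds
    such a line from [on_geodesic_matrix]. *)
Lemma geodesicP g h (t : R) : g \in unitmx -> h \in unitmx -> 0 <= t <= 1 ->
  geodesic (mobP1 h (Some 0)) (mobP1 h None) (bary (vtx g) (vtx (g *m dpi 1)) t)
  <-> defect v (q `^ (- t)) (invmx g *m h) = 1.
Proof.
move=> gU hU t01; split.
  move=> [l [n [s [lab s01 e]]]]; have d1 := geodesic_vdefect hU erefl erefl lab.
  have gd := adj_neq (adj_vtx gU).
  (* The line may describe the point by a different edge, so the two descriptions are compared only
     through the vertices of nonzero weight. *)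
  have supp (x : vert K) : bary (vtx g) (vtx (g *m dpi 1)) t x != 0 -> vdefect v h x = 1.
    by rewrite e => /bary_supp[] ->; exact: d1.
  apply: (defect_vertices gU hU t01) => [t1|t0]; apply: supp.
    by rewrite (bary_left t gd) subr_eq0 gt_eqF.
  by rewrite (bary_right t gd) gt_eqF.
move=> dM; have [h' [h'U ends vg [vgd vgd1]]] := on_geodesic_matrix gU hU t01 dM.
have {ends} ends x : geodesic (mobP1 h' (Some 0)) (mobP1 h' None) x ->
    @geodesic R K (mobP1 h (Some 0)) (mobP1 h None) x.
  have [s1 s2] := mobP1_swap hU.
  case: ends => /mobP1_ends[-> ->]; first exact id.
  by rewrite s1 s2; exact: geodesic_sym.
have [t0 t1] := andP t01; apply: ends.
have [tt|tn1] := eqVneq t 1; first by rewrite tt bary1 (vgd1 tt); exact (geodesic_vertex h'U).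
have t1' : t < 1 by rewrite lt_neqAle tn1.
have [tt|tn0] := eqVneq t 0.
  by rewrite tt -vpoint_bary (vg t1'); exact (geodesic_vertex h'U).
have t01' : 0 < t < 1 by rewrite t1' lt_neqAle eq_sym tn0 t0.
by rewrite (vg t1') (vgd t01'); exact (geodesic_edge h'U t01).
Qed.

Lemma tdist_geodesic g h n : g \in unitmx -> h \in unitmx ->
  defect v 1 (invmx g *m h) <= q ^+ n ->
  tdist_set (vpoint R (vtx g)) (geodesic (mobP1 h (Some 0)) (mobP1 h None)) <= n%:R.
Proof.
move=> gU hU /(edge_path_to_geodesic gU hU)[h' [m [mn h'U /mobP1_ends[e1 e2] p]]].
have ab := geodesic_vertex h'U; rewrite e1 e2 in ab.
apply: le_trans (tdist_set_le ab (edge_path_length p)) _.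
by rewrite ler_nat.
Qed.

End BruhatTitsTree.

(** * The half-plane and the building map *)

Section MoebiusField.
Variable L : fieldType.
Local Notation i0 := (ord0 : 'I_2).
Local Notation i1 := (ord_max : 'I_2).
Implicit Types (M N : 'M[L]_2) (z : L).

Definition jac M z := M i1 i0 * z + M i1 i1.
Definition mobL M z := (M i0 i0 * z + M i0 i1) / jac M z.

Lemma jac_mul M N z : jac N z != 0 -> jac (M *m N) z = jac M (mobL N z) * jac N z.
Proof. by move=> j0; rewrite /mobL /jac !mulmx2; rewrite /jac in j0 *; field. Qed.

Lemma mobL_mul M N z : jac N z != 0 -> mobL (M *m N) z = mobL M (mobL N z).
Proof.
move=> j0; rewrite {1}/mobL jac_mul//.
have -> : (M *m N) i0 i0 * z + (M *m N) i0 i1 =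
    (M i0 i0 * mobL N z + M i0 i1) * jac N z.
  by rewrite /mobL !mulmx2; rewrite /jac in j0 *; field.
by rewrite invfM mulrACA divff// mulr1.
Qed.

(** The linear form vanishing at [(a : c)] is equivariant up to the factor [det M / jac M z]; the
    invariance of [zdefect] rests on it. *)
Lemma mobL_form M z a c : jac M z != 0 ->
  (M i1 i0 * a + M i1 i1 * c) * mobL M z - (M i0 i0 * a + M i0 i1 * c)
  = \det M * (c * z - a) / jac M z.
Proof.
move=> j0; apply: (mulIf j0); rewrite divfK// mulrBl -mulrA divfK// det2 /jac; ring.
Qed.

End MoebiusField.

Section UpperHalfPlane.
Variables (R : realType) (K : finFieldType) (C : Cinfty R K).
Local Notation F := (laurent K).
Local Notation v := (laurent_abs C).
Local Notation i0 := (ord0 : 'I_2).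
Local Notation i1 := (ord_max : 'I_2).
Local Notation emb := (emb C).
Local Notation absC := (@absC R K C).
Local Notation imabs := (@imabs R K C).
Implicit Types (z : C) (x y a c : F) (g h : 'M[F]_2).

Definition emx g : 'M[C]_2 := map_mx emb g.

Lemma emxE g i j : emx g i j = emb (g i j).
Proof. by rewrite mxE. Qed.

Lemma embM x y : emb (x * y) = emb x * emb y. Proof. exact (rmorphM _ x y). Qed.
Lemma embD x y : emb (x + y) = emb x + emb y. Proof. exact (rmorphD _ x y). Qed.
Lemma embN x : emb (- x) = - emb x. Proof. exact (rmorphN _ x). Qed.
Lemma embV x : emb x^-1 = (emb x)^-1. Proof. exact (fmorphV _ x). Qed.
Lemma emb0 : emb 0 = 0. Proof. exact (rmorph0 _). Qed.
Lemma emb1 : emb 1 = 1. Proof. exact (rmorph1 _). Qed.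
Lemma emb_eq0 x : (emb x == 0) = (x == 0). Proof. exact (fmorph_eq0 _ x). Qed.

Lemma emxM g h : emx (g *m h) = emx g *m emx h.
Proof. exact (map_mxM _ g h). Qed.

Lemma det_emx g : \det (emx g) = emb (\det g).
Proof. exact (det_map_mx _ g). Qed.

Lemma emx1 : emx 1%:M = 1%:M.
Proof. exact (map_mx1 _ 2). Qed.

Lemma absC_emb x : absC (emb x) = v x. Proof. by []. Qed.

Lemma mobE g z : mob g z = mobL (emx g) z.
Proof. by rewrite /mobL /jac !emxE. Qed.

Lemma Omega_form z a c : Omega z -> (a != 0) || (c != 0) -> emb c * z - emb a != 0.
Proof.
move=> Oz; have [c0 a0|c0 _] := boolP (c == 0).
  rewrite orbF in a0; rewrite (eqP c0) emb0 mul0r sub0r oppr_eq0 emb_eq0.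
  exact a0.
apply/eqP => e; apply: Oz; exists (a / c) => //.
rewrite embM embV; apply: (mulIf (x := emb c)); first by rewrite emb_eq0.
by rewrite divfK ?emb_eq0// mulrC; apply/eqP; rewrite eq_sym -subr_eq0 e.
Qed.

Lemma emx_det_neq0 g : g \in unitmx -> \det (emx g) != 0.
Proof. by rewrite unit2 det_emx emb_eq0. Qed.

Lemma Omega_neq0 z : Omega z -> z != 0.
Proof. by move=> Oz; apply/eqP => z0; apply: Oz; exists 0 => //; rewrite emb0. Qed.

Lemma Omega_jac g z : g \in unitmx -> Omega z -> jac (emx g) z != 0.
Proof.
move=> gU Oz; rewrite /jac !emxE -[emb (g i1 i1)]opprK -embN.
apply: Omega_form => //; have := emx_det_neq0 gU; rewrite det2 !emxE.
rewrite oppr_eq0 -!emb_eq0; apply: contraNT; rewrite negb_or !negbK.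
by move=> /andP[/eqP-> /eqP->]; rewrite !mulr0 subrr.
Qed.

Lemma mobM g h z : h \in unitmx -> Omega z -> mob (g *m h) z = mob g (mob h z).
Proof. by move=> hU Oz; rewrite !mobE emxM mobL_mul// Omega_jac. Qed.

Lemma mob1 z : mob 1%:M z = z :> C.
Proof. by rewrite mobE emx1 /mobL /jac !mxE /= !mul0r mul1r addr0 add0r divr1. Qed.

Lemma mob_emb g x : exists y, mob g (emb x) = emb y.
Proof.
exists ((g i0 i0 * x + g i0 i1) / (g i1 i0 * x + g i1 i1)).
have e i : emb (g i i0) * emb x + emb (g i i1) = emb (g i i0 * x + g i i1).
  by rewrite -[RHS]/(emb _) (embD (g i i0 * x)) (embM (g i i0)).
by rewrite /mob (e i0) (e i1) -embV -embM.
Qed.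

Lemma Omega_mob g z : g \in unitmx -> Omega z -> Omega (mob g z).
Proof.
move=> gU Oz [x _ e]; apply: (Oz); have [y ey] := mob_emb (invmx g) x.
by exists y => //; rewrite -ey e -(mobM _ gU Oz) (mulVmx gU) mob1.
Qed.

Lemma imabs_le z x : imabs z <= absC (z - emb x).
Proof.
apply: ge_inf; last by exists x.
by exists 0 => _ [y _ <-]; exact: absC_ge0.
Qed.

Lemma le_imabs z (m : R) : (forall x, m <= absC (z - emb x)) -> m <= imabs z.
Proof.
move=> mP; apply: lb_le_inf; first by exists (absC (z - emb 0)), 0.
by move=> _ [x _ <-]; exact: mP.
Qed.

Lemma imabs_ge0 z : 0 <= imabs z.
Proof. by apply: le_imabs => x; exact: absC_ge0. Qed.

Lemma imabs_le_abs z : imabs z <= absC z.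
Proof. by have := imabs_le z 0; rewrite emb0 subr0. Qed.

Lemma imabsD z x : imabs (z + emb x) = imabs z.
Proof.
have le z' x' : imabs (z' + emb x') <= imabs z'.
  apply: le_imabs => y; have := imabs_le (z' + emb x') (y + x').
  by rewrite embD opprD addrACA [_ - emb x']subrr addr0.
apply/eqP; rewrite eq_le le/=; have := le (z + emb x) (- x).
by rewrite embN addrK.
Qed.

Lemma imabsZ z c : c != 0 -> imabs (emb c * z) = v c * imabs z.
Proof.
move=> c0; have ge z' c' : c' != 0 -> v c' * imabs z' <= imabs (emb c' * z').
  move=> c'0; apply: le_imabs => y.
  have -> : emb c' * z' - emb y = emb c' * (z' - emb (y / c')).
    by rewrite mulrBr embM embV mulrCA divff ?emb_eq0// mulr1.
  by rewrite absCM absC_emb ler_wpM2l ?av_ge0// imabs_le.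
apply/eqP; rewrite eq_le ge// andbT.
have c0' : c^-1 != 0 by rewrite invr_eq0.
have := ge (emb c * z) c^-1 c0'; rewrite embV mulKf ?emb_eq0// avV.
by rewrite ler_pdivrMl ?av_gt0.
Qed.

(** Only [y] with [|y| = |1/z|] can come closer than [|1/z|], and then
    [1/z - y = (y/z) (1/y - z)]. *)
Lemma imabsV z : z != 0 -> imabs z^-1 = imabs z / absC z ^+ 2.
Proof.
have ge z' : z' != 0 -> imabs z' / absC z' ^+ 2 <= imabs z'^-1.
  move=> z0; have az : 0 < absC z' by rewrite absC_gt0.
  apply: le_imabs => y; have [big|small] := leP (absC z'^-1) (absC (z'^-1 - emb y)).
    apply: le_trans big; rewrite absCV ler_pdivrMr ?exprn_gt0// expr2 mulKf ?gt_eqF//.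
    exact: imabs_le_abs.
  have ay : absC (emb y) = absC z'^-1.
    have -> : emb y = z'^-1 + - (z'^-1 - emb y) by rewrite opprB addrC subrK.
    by apply: absCD_dominant; rewrite absCN.
  have y0 : emb y != 0 by rewrite -(absC_gt0 (emb y)) ay absCV invr_gt0.
  have -> : z'^-1 - emb y = emb y / z' * (emb y^-1 - z').
    by rewrite embV; field; rewrite ?y0 ?z0.
  rewrite absCM absCM absCV ay absCB absCV -invfM -expr2 mulrC.
  apply: ler_wpM2l; last exact: imabs_le.
  by rewrite invr_ge0 exprn_ge0// ltW.
move=> z0; apply/eqP; rewrite eq_le ge// andbT.
have := ge z^-1; rewrite invrK invr_eq0 absCV => /(_ z0).
rewrite expr2 -invfM -expr2 invrK mulrC => h.
by rewrite ler_pdivlMr ?exprn_gt0 ?absC_gt0// mulrC.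
Qed.

End UpperHalfPlane.

(** * Moving a point of the half-plane over the base edge *)

Section Normalization.
Variables (R : realType) (K : finFieldType) (C : Cinfty R K).
Local Notation F := (laurent K).
Local Notation v := (laurent_abs C).
Local Notation q := (avq v).
Local Notation i0 := (ord0 : 'I_2).
Local Notation i1 := (ord_max : 'I_2).
Local Notation emb := (emb C).
Local Notation absC := (@absC R K C).
Local Notation imabs := (@imabs R K C).
Implicit Types (z : C) (x y a c : F) (g h : 'M[F]_2).

(** With lower left entry 0 the map is affine; otherwise it is [A/c - (det/c) / (c z + D)], an
    inversion between two affine maps. *)
Lemma imabs_mob g z : g \in unitmx -> Omega z ->
  imabs (mob g z) = v (\det g) * imabs z / absC (jac (emx C g) z) ^+ 2.
Proof.
move=> gU Oz; have j0 := Omega_jac gU Oz.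
have dg : v (\det g) = absC (\det (emx C g)) by rewrite det_emx.
rewrite dg mobE; move: j0; rewrite /mobL /jac det2 !emxE.
have [c0|c0] := eqVneq (g i1 i0) 0.
  rewrite c0 emb0 !mul0r !add0r mulr0 subr0 => d0.
  have ad : g i0 i0 / g i1 i1 != 0.
    rewrite mulf_neq0 ?invr_eq0 -?(emb_eq0 C)//.
    have := emx_det_neq0 C gU; rewrite det2 !emxE c0 emb0 mulr0 subr0 mulf_eq0 negb_or.
    by move=> /andP[].
  have -> : (emb (g i0 i0) * z + emb (g i0 i1)) / emb (g i1 i1) =
      emb (g i0 i0 / g i1 i1) * z + emb (g i0 i1 / g i1 i1).
    by rewrite (embM _ (g i0 i0)) (embM _ (g i0 i1)) !embV; field.
  rewrite imabsD imabsZ// -absC_emb (embM _ (g i0 i0)) embV !absCM absCV.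
  by field; rewrite absC_eq0.
set A := g i0 i0; set B := g i0 i1; set c := g i1 i0 in c0 *; set D := g i1 i1.
move=> j0; have ec0 : emb c != 0 by rewrite emb_eq0.
set det := emb A * emb D - emb B * emb c.
have dE : det = emb (A * D - B * c) by rewrite embD embN (embM _ A) (embM _ B).
have d0 : (A * D - B * c) / c != 0.
  rewrite mulf_neq0 ?invr_eq0// -(emb_eq0 C) -dE.
  by have := emx_det_neq0 C gU; rewrite det2 !emxE.
have -> : (emb A * z + emb B) / (emb c * z + emb D) =
   emb ((A * D - B * c) / c) * - (emb c * z + emb D)^-1 + emb (A / c).
  rewrite (embM _ _ c^-1) -dE (embM _ A) embV /det.
  by field; rewrite ec0 j0.
rewrite imabsD imabsZ// -invrN imabsV ?oppr_eq0// absCN.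
have -> : - (emb c * z + emb D) = emb (- c) * z + emb (- D) by rewrite !embN; ring.
rewrite imabsD imabsZ ?oppr_eq0// avN -!absC_emb (embM _ _ c^-1) -dE embV absCM absCV.
by field; rewrite !absC_eq0 j0 ec0.
Qed.

Lemma q_pow_small (e : R) : 0 < e -> exists n, q ^- n < e.
Proof.
move=> e0; exists (Num.bound e^-1); set n := Num.bound _.
have q0 := avq_gt0 v.
rewrite -[e]invrK ltf_pV2 ?posrE ?invr_gt0// ?exprn_gt0//.
apply: lt_trans (archi_boundP _) _; first by rewrite invr_ge0 ltW.
have -> : q = #|K|%:R by [].
by rewrite -natrX ltr_nat ltn_expl// finalg.card_finNzRing_gt1.
Qed.

(** Series that are close share their initial coefficients, so the diagonal series built from the
    approximations [f n] is the limit. *)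
Lemma laurent_closed z : (forall eps : R, 0 < eps -> exists x, absC (z - emb x) < eps) ->
  exists x, z = emb x.
Proof.
have q0 := avq_gt0 v; have p0 := pi_neq0 v.
(* A power of [pi] brings [z] into the unit ball, where good approximations are power series. *)
wlog z1 : z / absC z <= 1 => [hw|] zP.
  have [x zx] := zP 1 ltr01.
  have [N xN] : exists N : nat, v (avpi v ^+ N * x) <= 1.
    have [->|/(av_disc v)[m xm]] := eqVneq x 0; first by exists 0%N; rewrite mulr0 av0.
    exists (absz m); rewrite avM avX av_pi xm exprVn exprnN -expfzDr ?avq_neq0//.
    by rewrite -(expr0z q) avq_exprz_le; lia.
  set P := avpi v ^+ N in xN *; have P0 : P != 0 by rewrite expf_neq0.
  have vP0 : 0 < v P by rewrite av_gt0.
  have vP1 : v P <= 1.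
    by rewrite /P avX av_pi exprn_ile1// ?ltW// ?avqV_gt0 ?avqV_lt1.
  have eP0 : emb P != 0 by rewrite emb_eq0.
  have [||y ey] := hw (emb P * z).
  - have -> : emb P * z = emb P * (z - emb x) + emb (P * x) by rewrite embM; ring.
    apply: absCD_le => //; rewrite absCM absC_emb mulr_ile1 ?av_ge0 ?absC_ge0//.
    exact: ltW.
  - move=> eps e0; have [y zy] := zP (eps / v P) (divr_gt0 e0 vP0).
    exists (P * y); rewrite embM -mulrBr absCM absC_emb mulrC.
    by rewrite -ltr_pdivlMr.
  by exists (P^-1 * y); rewrite embM embV -ey mulKf.
have /choice[f fP] : forall n : nat, exists f : Defs.pseries K,
    absC (z - emb (of_ps f)) < q ^- n.+1.
  move=> n; have qn : 0 < q ^- n.+1 by rewrite invr_gt0 exprn_gt0.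
  have [x zx] := zP _ qn.
  have [f _ fx] : Oinf x.
    apply/(Oinf_absF C); have -> : absF C x = absC (z - (z - emb x)) by rewrite subKr.
    apply: absCD_le => //; rewrite absCN; apply: ltW; apply: lt_trans zx _.
    by rewrite invf_lt1 ?exprn_gt0// exprn_egt1// avq_gt1.
  by exists f; rewrite fx.
have close (g1 g2 : Defs.pseries K) n : v (of_ps g1 - of_ps g2) < q ^- n ->
    forall i, (i <= n)%N -> pcoef g1 i = pcoef g2 i.
  move=> vn i lein; have [e|] := eqVneq (g1 - g2) 0.
    by move/eqP: e; rewrite subr_eq0 => /eqP ->.
  move=> /ps_neq0P[m [gm glt]].
  have vm : v (of_ps g1 - of_ps g2) = q ^- m.
    rewrite -(absF_series C glt gm); congr (v _); exact/esym/(rmorphB (@FracField.tofrac _)).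
  move: vn; rewrite vm ltf_pV2 ?posrE ?exprn_gt0// ltr_eXn2l ?avq_gt1// => nm.
  have := glt i (leq_ltn_trans lein nm) => /= /eqP; rewrite subr_eq0.
  by move=> /eqP.
have conv (g1 g2 : Defs.pseries K) n :
    (forall i, (i < n)%N -> pcoef g1 i = pcoef g2 i) -> v (of_ps g1 - of_ps g2) <= q ^- n.
  move=> eqg; have -> : of_ps g1 - of_ps g2 = of_ps (g1 - g2).
    exact/esym/(rmorphB (@FracField.tofrac _)).
  have [->|/ps_neq0P[m [gm glt]]] := eqVneq (g1 - g2) 0.
    by rewrite /of_ps rmorph0 av0 invr_ge0 exprn_ge0// ltW.
  have -> : v (of_ps (g1 - g2)) = q ^- m := absF_series C glt gm.
  rewrite lef_pV2 ?posrE ?exprn_gt0// ler_weXn2l ?ltW ?avq_gt1//.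
  rewrite leqNgt; apply/negP => mn; move/eqP: gm; apply.
  by rewrite /= eqg// subrr.
exists (of_ps (PSeries (fun n => pcoef (f n) n))).
set g := PSeries _.
have fg n : absC (emb (of_ps (f n)) - emb (of_ps g)) <= q ^- n.+1.
  rewrite -(rmorphB emb); apply: conv => i; rewrite ltnS => lein /=.
  apply: (close (f n) (f i) i) => //.
  have -> : v (of_ps (f n) - of_ps (f i)) =
      absC ((z - emb (of_ps (f i))) - (z - emb (of_ps (f n)))).
    rewrite -absC_emb (rmorphB emb); congr absC; ring.
  have qi : q ^- i.+1 < q ^- i.
    by rewrite ltf_pV2 ?posrE ?exprn_gt0// ltr_eXn2l ?avq_gt1.
  apply: absCD_lt; first exact: lt_trans (fP i) qi.
  rewrite absCN; apply: lt_le_trans (fP n) _; apply: le_trans (ltW qi).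
  by rewrite lef_pV2 ?posrE ?exprn_gt0// ler_weXn2l ?ltW ?avq_gt1.
apply/eqP; rewrite -subr_eq0 -(absC_eq0 (z - emb (of_ps g))) eq_le absC_ge0 andbT.
rewrite leNgt; apply/negP => zg.
have [n qn] : exists n, q ^- n < absC (z - emb (of_ps g)).
  exact: q_pow_small.
move: qn; apply/negP; rewrite -leNgt.
have -> : z - emb (of_ps g) = (z - emb (of_ps (f n))) + (emb (of_ps (f n)) - emb (of_ps g)).
  by ring.
have qi : q ^- n.+1 <= q ^- n.
  by rewrite lef_pV2 ?posrE ?exprn_gt0// ler_weXn2l ?ltW ?avq_gt1.
apply: absCD_le; first exact: le_trans (ltW (fP n)) qi.
exact: le_trans (fg n) qi.
Qed.

Lemma imabs_gt0 z : Omega z -> 0 < imabs z.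
Proof.
move=> Oz; rewrite lt_neqAle imabs_ge0 andbT eq_sym; apply/eqP => iz.
apply: Oz; have [|x ->] := @laurent_closed z; last by exists x.
move=> eps e0; apply: contrapT => ne.
have : eps <= imabs z.
  by apply: le_imabs => x; rewrite leNgt; apply/negP => h; apply: ne; exists x.
by rewrite iz leNgt e0.
Qed.

(** Otherwise approximations improve forever, each time by a factor [q] because their distances lie
    in the value group of [F]; this contradicts [imabs_gt0]. *)
Lemma imabs_attained z : Omega z -> exists x, absC (z - emb x) = imabs z.
Proof.
move=> Oz; have m0 := imabs_gt0 Oz; have q0 := avq_gt0 v; apply: contrapT => ne.
have step x : exists y, absC (z - emb y) <= absC (z - emb x) / q.
  have [x' lt1] : exists x', absC (z - emb x') < absC (z - emb x).
    apply: contrapT => n; apply: ne; exists x; apply/eqP; rewrite eq_le imabs_le andbT.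
    by apply: le_imabs => y; rewrite leNgt; apply/negP => h; apply: n; exists y.
  have [x'' lt2] : exists x'', absC (z - emb x'') < absC (z - emb x').
    apply: contrapT => n; apply: ne; exists x'; apply/eqP; rewrite eq_le imabs_le andbT.
    by apply: le_imabs => y; rewrite leNgt; apply/negP => h; apply: n; exists y.
  (* A distance that can be improved is a value of [v]; the second improvement [x''] serves to apply
     this to [x'] as well. *)
  have val a b : absC (z - emb b) < absC (z - emb a) -> absC (z - emb a) = v (b - a).
    move=> ba; have -> : v (b - a) = absC ((z - emb a) + - (z - emb b)).
      rewrite -absC_emb (rmorphB emb); congr absC; ring.
    by apply/esym/absCD_dominant; rewrite absCN.
  exists x'; have := lt1; rewrite (val _ _ lt1) (val _ _ lt2).
  set A := v (x' - x); set B := v (x'' - x') => AB.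
  have [p Ap] : exists p : int, A = q ^ p.
    by apply: av_disc; rewrite -(av_gt0 v); apply: le_lt_trans AB; exact: av_ge0.
  have -> : A / q = q ^ (p - 1) by rewrite Ap expfzDr ?avq_neq0.
  by apply: av_lt; rewrite -Ap.
have iter n : exists y, absC (z - emb y) <= absC z * q ^- n.
  elim: n => [|n [y yP]]; first by exists 0; rewrite emb0 subr0 expr0 invr1 mulr1.
  have [y' y'P] := step y; exists y'; apply: (le_trans y'P).
  rewrite ler_pdivrMr//; apply: (le_trans yP); 
  by rewrite exprSr invfM mulrA divfK ?avq_neq0.
have z0 : 0 < absC z by rewrite absC_gt0 Omega_neq0.
have [n nP] := q_pow_small (divr_gt0 m0 z0).
have [y yP] := iter n.
have := le_lt_trans (imabs_le z y) (le_lt_trans yP _) => /(_ (imabs z)).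
by rewrite ltxx mulrC -ltr_pdivlMr// nP => /(_ isT).
Qed.

(** A strictly largest term would give the sum its own nonzero absolute value, so the maximum is
    attained twice. *)
Lemma ultrametric_sum0 n (f : 'I_n -> C) i : \sum_j f j = 0 -> f i != 0 ->
  exists j k, [/\ j != k, f j != 0 & absC (f j) = absC (f k)].
Proof.
move=> s0 fi0; case: (@arg_maxP _ R 'I_n i xpredT (fun j => absC (f j)) isT) => j _ jmax.
have fj0 : f j != 0.
  by rewrite -(absC_gt0 (f j)); apply: lt_le_trans (jmax i isT); rewrite absC_gt0.
have [[k kj jk]|nk] := pselect (exists2 k, k != j & absC (f j) <= absC (f k)).
  exists j, k; rewrite eq_sym; split=> //; apply/eqP; rewrite eq_le jk.
  exact: (jmax k isT).
exfalso; move: s0; rewrite (bigD1 j)//= => s0.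
have rest : absC (\sum_(k < n | k != j) f k) < absC (f j).
  elim/big_ind: _ => [|x y|k kj]; first by rewrite absC0 absC_gt0.
  - exact: absCD_lt.
  - by rewrite ltNge; apply/negP => h; apply: nk; exists k.
by have := absCD_dominant rest; rewrite s0 absC0 => /esym/eqP; rewrite absC_eq0 (negbTE fj0).
Qed.

(** By density an algebraic [Y] has the same absolute value. Two terms of equal size in its
    polynomial equation make [(j - k) log_q |Y|] an integer with [j != k]. *)
Lemma absC_rational z : z != 0 -> exists r : rat, absC z = q `^ ratr r.
Proof.
move=> z0; have q0 := avq_gt0 v.
have az : 0 < absC z by rewrite absC_gt0.
have [n nP] := q_pow_small az.
have [y yP] := Cinf_dense z n%:R.
set Y := Cinf_incl C y in yP.
have zY : absC z = absC Y.
  have sm : absC (z - Y) < absC z.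
    by apply: le_lt_trans nP; rewrite -[q]/(#|K|%:R : R) -powR_invn ?ler0n// absC_powR.
  have -> : Y = z + - (z - Y) by rewrite subKr.
  by apply/esym/absCD_dominant; rewrite absCN.
have Y0 : Y != 0 by rewrite -(absC_gt0 Y) -zY.
rewrite {}zY; clear yP nP.
have [p p0 py] := Cinf_algebraic y.
have sum0 : \sum_(i < size p) emb p`_i * Y ^+ i = 0.
  move/rootP: py; rewrite horner_coef size_map_poly => /(congr1 (Cinf_incl C)).
  rewrite rmorph_sum rmorph0 => e; rewrite -[RHS]e; apply: eq_bigr => i _.
  by rewrite coef_map/= rmorphM rmorphXn.
have [i fi0] : exists i : 'I_(size p), emb p`_i * Y ^+ i != 0.
  have sp : (0 < size p)%N by rewrite lt0n size_poly_eq0.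
  have lts : ((size p).-1 < size p)%N by rewrite prednK.
  exists (Ordinal lts); rewrite mulf_neq0 ?expf_neq0 ?emb_eq0//=.
  by have := p0; rewrite -lead_coef_eq0.
have [j [k [jk fj0 e]]] := ultrametric_sum0 sum0 fi0.
have fk0 : emb p`_k * Y ^+ k != 0.
  by rewrite -(absC_gt0 (_ * _)) -e absC_gt0.
have pow (i' : 'I_(size p)) : emb p`_i' * Y ^+ i' != 0 ->
    exists m : int, ln (absC (emb p`_i' * Y ^+ i')) = m%:~R * ln q + i'%:R * ln (absC Y).
  rewrite mulf_eq0 negb_or emb_eq0 => /andP[pi0 _].
  have [m vm] := av_disc v pi0; exists m.
  have aY : 0 < absC Y by rewrite absC_gt0.
  rewrite absCM absC_emb vm absCX lnM ?posrE ?exprz_gt0 ?exprn_gt0//.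
  by rewrite -powR_intmul ?ltW// ln_powR -powR_mulrn ?ltW// ln_powR.
have [m em] := pow _ fj0; have [m' em'] := pow _ fk0.
move: em'; rewrite -e em => em'.
have jk0 : (j%:R - k%:R : R) != 0.
  by rewrite subr_eq0 eqr_nat; apply: contraNneq jk => h; apply/eqP; exact: ord_inj.
exists ((m' - m)%:~R / (j%:Z - k%:Z)%:~R).
have aY : 0 < absC Y by rewrite absC_gt0.
have e' : ln (absC Y) * (j%:R - k%:R) = (m'%:~R - m%:~R) * ln q by lra.
have yE : ln (absC Y) = (m'%:~R - m%:~R) / (j%:R - k%:R) * ln q.
  by apply: (mulIf jk0); rewrite e'; field.
rewrite /powR gt_eqF// -[LHS]lnK ?posrE//; congr expR; rewrite yE fmorph_div /= !ratr_int.
by rewrite !intrB.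
Qed.

(** A best approximation [x] is translated to 0; if [|z - x| = q ^ r], scaling by [pi] to the power
    [N], the ceiling of [r], leaves [t = N - r]. *)
Lemma normalize_point z : Omega z -> exists g (t : rat), [/\ g \in unitmx, 0 <= t <= 1,
  absC (mob g z) = imabs (mob g z) & imabs (mob g z) = q `^ (- ratr t)].
Proof.
move=> Oz; have q0 := avq_gt0 v; have p0 := pi_neq0 v.
have [x xz] := imabs_attained Oz.
have zx0 : z - emb x != 0.
  by rewrite -(absC_gt0 (z - emb x)) xz imabs_gt0.
have [r zr] := absC_rational zx0.
set N := Num.ceil r; set P := avpi v ^ N.
have P0 : P != 0 by rewrite expfz_neq0.
have gU : mx2 P (- (P * x)) 0 1 \in unitmx.
  by rewrite unit2 det2 !mx2E mulr1 mulr0 subr0.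
have gz : mob (mx2 P (- (P * x)) 0 1) z = emb P * (z - emb x).
  rewrite mobE /mobL /jac !emxE !mx2E emb0 emb1 mul0r add0r divr1 embN embM; ring.
have vP : v P = q `^ (- (ratr N%:~R)).
  by rewrite /P av_piXz -powR_intmul ?ltW// ratr_int rmorphN.
exists (mx2 P (- (P * x)) 0 1), (N%:~R - r); rewrite gz; split=> //.
- have /andP[] := real_ceil_itv (num_real r).
  by rewrite subr_ge0 lerBlDr -/N => h1 h2; rewrite h2/=; move: h1; lra.
- by rewrite absCM xz imabsZ// -embN imabsD.
- rewrite imabsZ// -embN imabsD -xz zr vP -powRD ?(gt_eqF q0) ?implybT//.
  by congr powR; rewrite rmorphB/= opprB addrC.
Qed.

End Normalization.

(** * Orders of the basic differential forms *)

Section FormNorms.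
Variables (R : realType) (K : finFieldType) (C : Cinfty R K).
Local Notation F := (laurent K).
Local Notation v := (laurent_abs C).
Local Notation q := (avq v).
Local Notation i0 := (ord0 : 'I_2).
Local Notation i1 := (ord_max : 'I_2).
Local Notation emb := (emb C).
Local Notation emx := (emx C).
Local Notation absC := (@absC R K C).
Local Notation imabs := (@imabs R K C).
Local Notation vtx := (vtx v).
Local Notation dpi := (dpi v).
Implicit Types (z : C) (x y a c : F) (g h : 'M[F]_2).

Definition col_form z h j := emx h i1 j * z - emx h i0 j.

(* q to the order at z of the form s(z; h 0, h infinity), i.e. to the distance
   from the image of z in the tree to the corresponding geodesic. *)
Definition zdefect z h : R :=
  absC (col_form z h i0) * absC (col_form z h i1) / (v (\det h) * imabs z).

Lemma col_form_neq0 z h j : h \in unitmx -> Omega z -> col_form z h j != 0.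
Proof.
move=> hU Oz; rewrite /col_form !emxE; apply: (Omega_form Oz).
by move: j; apply: I2P; [exact (unit_col0 hU)|exact (unit_col1 hU)].
Qed.

Lemma col_form_mob z g h j : g \in unitmx -> Omega z ->
  col_form (mob g z) (g *m h) j = \det (emx g) * col_form z h j / jac (emx g) z.
Proof.
move=> gU Oz; rewrite /col_form emxM !mulmx2 mobE.
exact: (mobL_form _ _ (Omega_jac gU Oz)).
Qed.

Lemma zdefect_mob z g h : g \in unitmx -> h \in unitmx -> Omega z ->
  zdefect (mob g z) (g *m h) = zdefect z h.
Proof.
move=> gU hU Oz; rewrite /zdefect (col_form_mob h i0 gU Oz) (col_form_mob h i1 gU Oz) (imabs_mob gU Oz).
have -> : v (\det (g *m h)) = absC (\det (emx g)) * v (\det h).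
  by rewrite -[LHS]absC_emb -det_emx emxM det_mulmx absCM det_emx det_emx.
have -> : v (\det g) = absC (\det (emx g)) by rewrite det_emx.
have d0 : absC (\det (emx g)) != 0 by rewrite absC_eq0; exact (emx_det_neq0 C gU).
have h0 : v (\det h) != 0 by rewrite av_eq0 -unit2.
have j0 : absC (jac (emx g) z) != 0 by rewrite absC_eq0; exact (Omega_jac gU Oz).
have z0 : imabs z != 0 by rewrite gt_eqF//; exact (imabs_gt0 Oz).
by rewrite !absCM !absCV; field; rewrite d0 h0 j0 z0.
Qed.

(** No cancellation can occur in [c z - a]: when [|a| <= |c z|] and [c != 0], it is [c (z - a/c)],
    of absolute value at least [|c| |z|_i = |c| |z|]. *)
Lemma col_form_normal z h j : absC z = imabs z ->
  absC (col_form z h j) = cnorm v (imabs z) (h i0 j) (h i1 j).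
Proof.
move=> zi; rewrite /col_form !emxE; set a := h i0 j; set c := h i1 j.
rewrite /cnorm mulrC -!absC_emb -zi -absCM mulrC.
have [lt1|le1] := ltP (absC (emb c * z)) (absC (emb a)).
  by rewrite addrC absCD_dominant absCN.
apply/eqP; rewrite eq_le absCD_le ?absCN//=.
have [c0|c0] := eqVneq c 0.
  by rewrite c0 emb0 mul0r absC0 absC_ge0.
have -> : emb c * z - emb a = emb c * (z - emb (a / c)).
  by rewrite (embM _ a) embV; field; rewrite emb_eq0.
by rewrite !absCM zi ler_wpM2l ?absC_ge0// imabs_le.
Qed.

Lemma zdefect_normal z h : absC z = imabs z -> zdefect z h = defect v (imabs z) h.
Proof. by move=> zi; rewrite /zdefect !col_form_normal. Qed.

Lemma pole_proj a c z : pole (proj_pt a c) z = emb c / (emb c * z - emb a).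
Proof.
rewrite /proj_pt; case: ifPn => [/eqP ->|c0]; first by rewrite emb0 mul0r.
have ec0 : emb c != 0 by rewrite emb_eq0.
rewrite /pole (embM _ a) embV.
have -> : z - emb a / emb c = (emb c * z - emb a) / emb c by field.
by rewrite invfM invrK mulrC.
Qed.

(** Combining the two poles gives [s = det h / (l_0 l_1)], with [l_0] and [l_1] the forms of the
    columns of [h]. *)
Lemma sform_zdefect z h : h \in unitmx -> Omega z ->
  absC (sform (mobP1 h (Some 0)) (mobP1 h None) z) * imabs z = (zdefect z h)^-1.
Proof.
move=> hU Oz; have f0 := col_form_neq0 i0 hU Oz; have f1 := col_form_neq0 i1 hU Oz.
have -> : sform (mobP1 h (Some 0)) (mobP1 h None) z =
    \det (emx h) / (col_form z h i0 * col_form z h i1).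
  rewrite /sform mobP1_None mobP1_Some0 !pole_proj.
  rewrite /col_form !emxE in f0 f1 *; rewrite det2 !emxE.
  by field; rewrite f0 f1.
have z0 : imabs z != 0 by rewrite gt_eqF//; exact (imabs_gt0 Oz).
have h0 : absC (emb (\det h)) != 0 by rewrite absC_eq0 emb_eq0 -unit2.
rewrite /zdefect det_emx -absC_emb !absCM absCV !absCM.
by field; rewrite !absC_eq0 f0 f1 z0 -(absC_eq0 (emb _)) h0.
Qed.

Lemma pullback_imabs g (f : C -> C) z : g \in unitmx -> Omega z ->
  absC (pullback g f z) * imabs z = absC (f (mob g z)) * imabs (mob g z).
Proof.
move=> gU Oz; rewrite (imabs_mob gU Oz) /pullback absCM absCM absCV absCX -absC_emb.
have -> : emb (g i1 i0) * z + emb (g i1 i1) = jac (emx g) z by rewrite /jac !emxE.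
by rewrite -!mulrA; congr (_ * (_ * _)); exact: mulrC.
Qed.

End FormNorms.

Section BuildingMap.
Variables (R : realType) (K : finFieldType) (C : Cinfty R K) (lam : C -> tpoint R K).
Hypothesis lamP : building_map lam.
Local Notation F := (laurent K).
Local Notation v := (laurent_abs C).
Local Notation q := (avq v).
Local Notation vtx := (vtx v).
Local Notation dpi := (dpi v).
Local Notation absC := (@absC R K C).
Local Notation imabs := (@imabs R K C).
Implicit Types (z : C) (g h : 'M[F]_2).

Lemma lam_mob g z : g \in unitmx -> Omega z -> lam (mob g z) = act_pt g (lam z).
Proof. by case: lamP => _ + _; apply. Qed.

Lemma lam_normal z (t : rat) : 0 <= t <= 1 -> absC z = imabs z -> imabs z = q `^ (- ratr t) ->
  Omega z /\ lam z = bary (vtx 1%:M) (vtx (dpi 1)) (ratr t).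
Proof.
move=> t01 zi it; case: lamP => _ _ /(_ t t01) => e.
have : (Omega `&` lam @^-1` [set bary (std_vertex 0) (std_vertex (-1)) (ratr t)]) z.
  by rewrite e; split.
move=> [Oz e']; split; first exact Oz.
rewrite [LHS]e'; have e0 : std_vertex 0 = vtx 1%:M := etrans (std_vertexE C 0) (congr1 vtx (dpi0 v)).
have e1 : std_vertex (-1) = vtx (dpi 1) := std_vertexE C (-1).
exact (f_equal2 (fun u w => bary u w (ratr t)) e0 e1).
Qed.

Lemma act_base_edge g (t : R) : g \in unitmx ->
  act_pt g (bary (vtx 1%:M) (vtx (dpi 1)) t) = bary (vtx g) (vtx (g *m dpi 1)) t.
Proof.
move=> gU; rewrite [LHS](act_bary _ _ _ gU).
have e0 := act_vert_vtx C gU (unitmx1 F 2); rewrite mulmx1 in e0.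
exact (f_equal2 (fun u w => bary u w t) e0 (act_vert_vtx C gU (dpi_unit v 1))).
Qed.

Lemma rat01 (t : rat) : 0 <= t <= 1 -> 0 <= (ratr t : R) <= 1.
Proof. by rewrite ler0q -(ler_rat R) rmorph1. Qed.

(** One pair [g], [t] locates [lam z] and also computes the order at [z] of every form [s]; this is
    the bridge between the half-plane and the tree. *)
Lemma lam_edge z : Omega z -> exists g (t : R), [/\ g \in unitmx, 0 <= t <= 1,
  lam z = bary (vtx g) (vtx (g *m dpi 1)) t &
  forall h, h \in unitmx -> zdefect z h = defect v (q `^ (- t)) (invmx g *m h)].
Proof.
move=> Oz; have [g [t [gU t01 wi it]]] := normalize_point Oz.
have [Ow lw] := lam_normal t01 wi it; have gVU := unitmxV gU.
have ez : z = mob (invmx g) (mob g z) by rewrite -(mobM _ gU Oz) (mulVmx gU) mob1.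
exists (invmx g), (ratr t); split.
- exact gVU.
- exact: rat01.
- by rewrite {1}ez (lam_mob gVU Ow) lw; exact (act_base_edge _ gVU).
- move=> h hU; rewrite invmxK -(zdefect_mob gU hU Oz) zdefect_normal//.
  by rewrite it.
Qed.

Lemma zdefect_ge1 z h : h \in unitmx -> Omega z -> 1 <= zdefect z h.
Proof.
move=> hU /lam_edge[g [t [gU _ _ zd]]]; rewrite (zd h hU); apply: defect_ge1.
  by rewrite powR_gt0 ?avq_gt0.
exact (unitmxM (unitmxV gU) hU).
Qed.

Lemma lam_geodesicP z h : h \in unitmx -> Omega z ->
  geodesic (mobP1 h (Some 0)) (mobP1 h None) (lam z) <-> zdefect z h = 1.
Proof.
move=> hU /lam_edge[g [t [gU t01 -> zd]]]; rewrite (zd h hU).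
exact (geodesicP C gU hU t01).
Qed.

Lemma tp_lam_gt0 z : Omega z -> 0 < tp (lam z).
Proof.
move=> /lam_edge[g [t [gU /andP[t0 t1] -> _]]]; have uw := adj_vtx C gU.
have [uV wV] := adj_vertex uw.
have [->|tn0] := eqVneq t 0; first by rewrite -vpoint_bary (tp_vertex R uV).
have [->|tn1] := eqVneq t 1; first by rewrite bary1 (tp_vertex R wV).
have t01 : 0 < t < 1 by rewrite !lt_neqAle eq_sym tn0 tn1 t0.
by have /andP[] := tp_open_edge C uw t01.
Qed.

Lemma zdefect_gap z h : h \in unitmx -> Omega z -> zdefect z h != 1 ->
  q `^ tp (lam z) <= zdefect z h.
Proof.
move=> hU /lam_edge[g [t [gU /andP[t0 t1] -> zd]]]; rewrite (zd h hU) => d1.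
have uw := adj_vtx C gU; have [uV wV] := adj_vertex uw; have q0 := avq_gt0 v.
have MU := unitmxM (unitmxV gU) hU.
have [tt|tn0] := eqVneq t 0.
  rewrite tt -vpoint_bary (tp_vertex R uV)// powRr1 ?(ltW q0)//.
  by move: d1; rewrite tt oppr0 powRr0; exact (defect_gap0 MU).
have [tt|tn1] := eqVneq t 1.
  rewrite tt bary1 (tp_vertex R wV)// powRr1 ?(ltW q0)//.
  move: d1; rewrite tt (powR_inv1 (ltW q0)) defect_shift.
  exact (defect_gap0 (unitmxM (dpi_unit v (-1)) MU)).
have t01 : 0 < t < 1 by rewrite !lt_neqAle eq_sym tn0 tn1 t0.
have /andP[_ tpm] := tp_open_edge C uw t01.
apply: le_trans (defect_gap t01 MU d1).
by apply: ler_powR => //; rewrite ltW// avq_gt1.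
Qed.

(** Condition (P) concerns vertices: [u] is the initial vertex of an edge through [lam z], chosen
    for [z] alone, and replacing the point by it adds 1 to the bound. *)
Lemma lam_near_vertex z : Omega z -> exists2 u, is_vertex u &
  forall g h n, g \in unitmx -> h \in unitmx -> zdefect (mob g z) h <= q ^+ n ->
  tdist_set (vpoint R (act_vert g u)) (geodesic (mobP1 h (Some 0)) (mobP1 h None))
    <= n.+1%:R.
Proof.
move=> Oz; have [g' [t [g'U t01 _ zd]]] := lam_edge Oz.
exists (vtx g'); first by apply/(is_vertexP C); exists g'.
move=> g h n gU hU; have gVU := unitmxV gU; have g'VU := unitmxV g'U.
have ghU := unitmxM gVU hU.
rewrite -[X in zdefect _ X](mulKVmx gU h) (zdefect_mob gU ghU Oz) (zd _ ghU) => dn.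
rewrite (act_vert_vtx C gU g'U); apply: (tdist_geodesic (C := C) (unitmxM gU g'U) hU).
have MU := unitmxM g'VU ghU.
rewrite (invmxM2 gU g'U) -mulmxA exprS.
apply: le_trans (defect_shift_le v t01 MU) _.
by apply: ler_wpM2l => //; rewrite ltW// avq_gt0.
Qed.

Lemma sqrt_pi : exists z : C, z ^+ 2 = emb C (avpi v).
Proof.
have [|x e] := @solve_monicpoly (Cinf_closure C) 2
  (fun i => if i == 0%N then Cinf_alg C (avpi v) else 0) => //.
exists (Cinf_incl C x); rewrite -rmorphXn e big_ord_recl big_ord1 /=.
by rewrite mul0r addr0 expr0 mulr1.
Qed.

(** A square root of [pi] lies over the midpoint of the base edge: its absolute value is not a value
    of [F], which forces [|z|_i = |z|]. *)
Lemma open_edge_hit u w : adj u w -> exists2 z, Omega z & open_edge u w (lam z).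
Proof.
move=> /(adjP C)[g [gU -> ->]]; have q0 := avq_gt0 v.
have [z z2] := sqrt_pi.
have half : ratr (2^-1 : rat) = 2^-1 :> R by rewrite fmorphV rmorph_nat.
have az : absC z = q `^ (- ratr (2^-1 : rat)).
  have az2 : absC z ^+ 2 = (q `^ (- ratr (2^-1 : rat))) ^+ 2.
    rewrite -absCX z2 absC_emb av_pi half -(powR_inv1 (ltW q0)) -powR_mulrn ?powR_ge0//.
    by rewrite -powRrM; congr powR; field.
  by apply/eqP; rewrite -(@eqrXn2 _ 2) ?absC_ge0 ?powR_ge0// az2.
have zi : absC z = imabs z.
  apply/eqP; rewrite eq_le imabs_le_abs andbT; apply: le_imabs => x.
  have [x0|x0] := eqVneq x 0; first by rewrite x0 emb0 subr0.
  rewrite leNgt; apply/negP => lt1.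
  have : absC (emb C x) = absC z.
    have -> : emb C x = z + - (z - emb C x) by rewrite subKr.
    by apply: absCD_dominant; rewrite absCN.
  rewrite absC_emb az -[q `^ _]mul1r -(av1 v); apply: av_neq_scale.
    by rewrite half; lra.
  by rewrite oner_neq0.
have h01 : 0 <= (2^-1 : rat) <= 1 by lra.
have [Oz lz] := lam_normal h01 zi (etrans (esym zi) az).
exists (mob g z); first exact (Omega_mob gU Oz).
exists (ratr 2^-1); first by rewrite half /=; lra.
by rewrite (lam_mob gU Oz) lz; exact (esym (act_base_edge _ gU)).
Qed.

End BuildingMap.

(** * Poincare series *)

Section UltrametricSums.
Variables (R : realType) (K : finFieldType) (C : Cinfty R K).
Variable I : choiceType.
Local Notation q := (#|K|%:R : R).
Local Notation absC := (@absC R K C).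
Implicit Types (A B D : set I) (f : I -> C) (c : R).

Lemma ord_powR_ge (x : C) (M : R) : (M%:E <= ord x)%E = (absC x <= q `^ (- M)).
Proof. by rewrite absC_powR. Qed.

Lemma fsum_le B f c : finite_set B -> 0 <= c -> (forall i, B i -> absC (f i) <= c) ->
  absC (\sum_(i \in B) f i) <= c.
Proof.
move=> Bfin c0 fc; rewrite fsbig_finite// big_seq; apply: absC_sum_le => // i.
by rewrite in_fset_set// inE; exact: fc.
Qed.

Lemma fsum_lt B f c : finite_set B -> 0 < c -> (forall i, B i -> absC (f i) < c) ->
  absC (\sum_(i \in B) f i) < c.
Proof.
move=> Bfin c0 fc; rewrite fsbig_finite// big_seq; elim/big_ind: _ => [|x y|i].
- by rewrite absC0.
- exact: absCD_lt.
- by rewrite in_fset_set// inE; exact: fc.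
Qed.

Lemma fsum_diff A B f c : finite_set B -> A `<=` B -> 0 <= c ->
  (forall i, B i -> ~ A i -> absC (f i) <= c) ->
  absC (\sum_(i \in B) f i - \sum_(i \in A) f i) <= c.
Proof.
move=> Bfin AB c0 fc; rewrite (fsbigID A)//= setIidr// addrAC subrr add0r.
by apply: fsum_le => //; [exact: finite_setIl|move=> i [Bi nAi]; exact: fc].
Qed.

(** The finite sums over the terms larger than [q ^- n] form a Cauchy sequence, since any further
    terms change a sum by at most [q ^- n]. *)
Lemma null_has_sum D f : (forall e : R, 0 < e -> finite_set [set i | D i /\ e < absC (f i)]) ->
  exists s, has_sum D f s.
Proof.
move=> null; have q0 : 0 < q := q_gt0 R K.
pose A n := [set i | D i /\ q ^- n < absC (f i)].
have qn n : 0 < q ^- n by rewrite invr_gt0 exprn_gt0.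
have Afin n : finite_set (A n) by exact: null.
have AD n : A n `<=` D by move=> i [].
have Amono m n : (m <= n)%N -> A m `<=` A n.
  move=> mn i [Di fi]; split=> //; apply: le_lt_trans fi.
  by rewrite lef_pV2 ?posrE ?exprn_gt0// ler_weXn2l// ltW// q_gt1.
have tail n B : finite_set B -> A n `<=` B -> B `<=` D ->
    absC (\sum_(i \in B) f i - \sum_(i \in A n) f i) <= q ^- n.
  move=> Bfin AB BD; apply: fsum_diff => //.
  by move=> i Bi nAi; rewrite leNgt; apply/negP => h; apply: nAi; split=> //; exact: BD.
have small (M : R) : exists n, q ^- n <= q `^ (- M).
  have [n nM] := q_pow_small C (powR_gt0 (- M) q0).
  by exists n; exact: ltW.
have [s sP] : exists l, forall M : R, exists N, forall n, (N <= n)%N ->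
    (M%:E <= ord (\sum_(i \in A n) f i - l)%R)%E.
  apply: Cinf_complete => M; have [N NM] := small M; exists N => m n Nm Nn.
  have tl k : (N <= k)%N ->
      absC (\sum_(i \in A k) f i - \sum_(i \in A N) f i) <= q `^ (- M).
    by move=> Nk; apply: le_trans NM; apply: tail => //; exact: Amono.
  rewrite ord_powR_ge.
  have -> : \sum_(i \in A m) f i - \sum_(i \in A n) f i =
      (\sum_(i \in A m) f i - \sum_(i \in A N) f i)
      + - (\sum_(i \in A n) f i - \sum_(i \in A N) f i) by ring.
  by apply: absCD_le; rewrite ?absCN tl.
exists s => M; have [N1 N1P] := sP M; have [N2 N2P] := small M.
pose n := maxn N1 N2.
have n2 : q ^- n <= q `^ (- M).
  apply: le_trans N2P; rewrite lef_pV2 ?posrE ?exprn_gt0// ler_weXn2l//.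
    by rewrite ltW// q_gt1.
  exact: leq_maxr.
exists (A n); split=> // B Bfin AB BD; rewrite ord_powR_ge.
have -> : s - \sum_(i \in B) f i = - (\sum_(i \in A n) f i - s)
    + - (\sum_(i \in B) f i - \sum_(i \in A n) f i) by ring.
apply: absCD_le; rewrite absCN; last exact: le_trans (tail _ _ Bfin AB BD) n2.
by rewrite -ord_powR_ge; apply: N1P; exact: leq_maxl.
Qed.

Lemma usum_has_sum D f : (exists s, has_sum D f s) -> has_sum D f (usum D f).
Proof. by move=> [s sP]; rewrite /usum; case: xgetP => [x _|/(_ s)]. Qed.

Lemma small_powR (c : R) : 0 < c -> exists M, q `^ (- M) < c.
Proof.
move=> /(q_pow_small C)[n nc]; exists n%:R.
by rewrite powR_invn ?ler0n.
Qed.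

Lemma has_sum_le D f s c : 0 < c -> has_sum D f s -> (forall i, D i -> absC (f i) <= c) ->
  absC s <= c.
Proof.
move=> c0 sP fc; have [M Mc] := small_powR c0.
have [A [Afin AD /(_ A Afin (@subset_refl _ A) AD)]] := sP M; rewrite ord_powR_ge => sA.
rewrite -[s](subrK (\sum_(i \in A) f i)); apply: absCD_le; first exact: le_trans sA (ltW Mc).
by apply: fsum_le => //; [exact: ltW|move=> i /AD; exact: fc].
Qed.

(** The strict bounds on infinitely many terms need not be uniform; a finite partial sum containing
    [i0], with error below [|f i0|], keeps the inequality strict. *)
Lemma has_sum_dominant D f s i0 : D i0 -> f i0 != 0 -> has_sum D f s ->
  (forall i, D i -> i <> i0 -> absC (f i) < absC (f i0)) -> absC s = absC (f i0).
Proof.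
move=> Di0 f0 sP fc; have c0 : 0 < absC (f i0) by rewrite absC_gt0.
have [M Mc] := small_powR c0; have [A [Afin AD AP]] := sP M.
have Bfin : finite_set (A `|` [set i0]) by rewrite finite_setU.
have BD : A `|` [set i0] `<=` D by move=> i [/AD//|->].
have := AP _ Bfin (@subsetUl _ _ _) BD; rewrite ord_powR_ge => /le_lt_trans/(_ Mc) sB.
have Bi0 : (A `|` [set i0]) i0 by right.
rewrite (fsbigD1 i0)//= in sB.
set T := \sum_(i \in _ `\ _) f i in sB.
have T1 : absC T < absC (f i0).
  by apply: fsum_lt => //; [exact: finite_setD|move=> i [/BD Di ii0]; exact: fc].
have -> : s = f i0 + (T + (s - (f i0 + T))) by ring.
by apply: absCD_dominant; apply: absCD_lt.
Qed.

End UltrametricSums.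

Section OrderOfForms.
Variables (R : realType) (K : finFieldType) (C : Cinfty R K).
Local Notation q := (#|K|%:R : R).
Local Notation absC := (@absC R K C).
Local Notation imabs := (@imabs R K C).
Implicit Types (g : C -> C) (z : C).

Lemma powR_log_imabs z : 0 < imabs z -> q `^ (ln (imabs z) / ln q) = imabs z.
Proof.
move=> i0; have q0 := q_gt0 R K; have q1 := q_gt1 R K.
by rewrite /powR gt_eqF// divfK ?lnK ?posrE// gt_eqF// ln_gt0.
Qed.

(** The normalized absolute value [|g(z)| |z|_i ^ d] is [q] to minus the order of the form. *)
Lemma ord_form_ge d g z (x : R) : 0 < imabs z ->
  (x%:E <= ord_form d g z)%E = (absC (g z) * imabs z ^+ d <= q `^ (- x)).
Proof.
move=> i0; have q0 := q_gt0 R K; rewrite /ord_form leeBrDr// -EFinD ord_powR_ge.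
have -> : q `^ (- (x + d%:R * (ln (imabs z) / ln q))) = q `^ (- x) / imabs z ^+ d.
  rewrite opprD powRD ?(gt_eqF q0) ?implybT//; congr (_ * _).
  by rewrite powRN mulrC powRrM powR_log_imabs// powR_mulrn// ltW.
by rewrite ler_pdivlMr// exprn_gt0.
Qed.

Lemma ord_form_eq0 d g z : 0 < imabs z -> absC (g z) * imabs z ^+ d = 1 ->
  ord_form d g z = 0%E.
Proof.
move=> i0 e; have q0 := q_gt0 R K; have q1 := q_gt1 R K.
have lq : ln q != 0 by rewrite gt_eqF// ln_gt0.
have gz : g z != 0.
  by apply: contra_eq_neq e => ->; rewrite absC0 mul0r eq_sym oner_neq0.
have := congr1 (@ln R) e.
rewrite lnM ?posrE ?exprn_gt0 ?absC_gt0// ln1 {1}/Defs.absC (negbTE gz) ln_powR.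
rewrite -powR_mulrn ?ltW// ln_powR => e'.
rewrite /ord_form (fine_ord gz) -EFinB; congr EFin.
apply: (mulIf lq); rewrite mul0r mulrBl mulrA divfK//; lra.
Qed.

End OrderOfForms.

Section ClosedEdge.
Variables (R : realType) (K : finFieldType) (C : Cinfty R K).
Local Notation F := (laurent K).
Local Notation v := (laurent_abs C).
Implicit Types (u w : vert K) (g : 'M[F]_2).

Definition closed_edge u w : set (tpoint R K) :=
  open_edge u w `|` [set vpoint R u; vpoint R w].

Lemma closed_edgeC u w : closed_edge u w = closed_edge w u.
Proof.
have le u' w' : closed_edge u' w' `<=` closed_edge w' u'.
  move=> x [[t /andP[t0 t1] <-]|[->|->]]; [left|right; right|right; left] => //.
  exists (1 - t); last by rewrite baryC subKr.
  by rewrite /= subr_gt0 t1 ltrBlDr ltrDl t0.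
by apply/seteqP; split; exact: le.
Qed.

Lemma adj_type g u w : g \in unitmx -> v (\det g) = 1 -> adj u w -> act_vert g u <> w.
Proof.
move=> gU g1 /(adjP C)[h [hU -> ->]]; rewrite (act_vert_vtx C gU hU).
exact (@vtx_type _ _ v g h gU g1 hU).
Qed.

(* Elements of unit determinant preserve types, hence cannot flip an edge. *)
Lemma edge_stabilizer g u w x : g \in unitmx -> v (\det g) = 1 -> adj u w ->
  ([set vpoint R u] `|` open_edge u w) x -> closed_edge u w (act_pt g x) ->
  act_vert g u = u.
Proof.
move=> gU g1 uw; have uw' := adj_neq C uw; have nw := adj_type gU g1 uw.
have val01 (u1 w1 : vert K) (t : R) (y : vert K) : 0 < t < 1 -> bary u1 w1 t <> vpoint R y \/ u1 = w1.
  move=> /andP[t0 t1]; have [e|n] := pselect (u1 = w1); [by right|left => e].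
  have := congr1 (fun x => x u1) e; rewrite (bary_left _ n) /vpoint.
  by case: asboolP => _ /=; lra.
have vinj y y' : vpoint R y = vpoint R y' -> y = y'.
  move=> /(congr1 (fun x => x y)); rewrite /vpoint asboolT//.
  by case: asboolP => // _ /eqP; rewrite oner_eq0.
move=> [->|[t t01 <-]].
  rewrite (act_vpoint _ _ gU) => -[[s s01 e]|[/vinj //|/vinj]]; last by [].
  by case: (val01 u w s (act_vert g u) s01).
rewrite (act_bary _ _ _ gU).
have gn : act_vert g u <> act_vert g w.
  move=> e; apply: uw'.
  exact (etrans (esym (act_vertK gU u)) (etrans (congr1 (act_vert (invmx g)) e) (act_vertK gU w))).
have nv y : bary (act_vert g u) (act_vert g w) t <> vpoint R y.
  by case: (val01 (act_vert g u) (act_vert g w) t y t01).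
move=> [[s s01 e]|[/nv|/nv]] //.
(* The image of [u] carries weight in a point of the edge, so it is [u] or [w]; preservation of
   types excludes [w]. *)
have : bary u w s (act_vert g u) != 0.
  by rewrite e (bary_left _ gn) subr_eq0; case/andP: t01 => _ t1; rewrite gt_eqF.
by move=> /bary_supp[].
Qed.

End ClosedEdge.

(** * The series: convergence, dominant coset and lower bounds *)

Section PoincareSeries.
Variables (R : realType) (K : finFieldType) (C : Cinfty R K) (lam : C -> tpoint R K).
Local Notation F := (laurent K).
Variables (G H : set 'M[F]_2) (r : nat) (l : int) (k : 'I_r -> nat) (a b : 'I_r -> P1 K).
Hypotheses (lamP : building_map lam) (GP : GL2_subgroup G)
  (detG : forall g, G g -> Oinf_units (\det g)) (HP : GL2_subgroup H) (HG : H `<=` G)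
  (kP : forall i, (1 <= k i)%N) (ab : forall i, a i <> b i)
  (Hab : forall h i, H h -> mobP1 h (a i) = a i /\ mobP1 h (b i) = b i)
  (condP : conditionP R G H a b).
Local Notation v := (laurent_abs C).
Local Notation absC := (@absC R K C).
Local Notation imabs := (@imabs R K C).
Local Notation P := (poincare G H l k a b : C -> C).
Local Notation d := (\sum_(i < r) k i)%N.
Local Notation term X z := (poincare_term l k a b (xget 1%:M X) z : C).
Implicit Types (z : C) (g h : 'M[F]_2) (X : set 'M[F]_2) (i : 'I_r).

Lemma G_unit g : G g -> g \in unitmx. Proof. by case: GP => + _ _ _; apply. Qed.
Lemma G_inv g : G g -> G (invmx g). Proof. by case: GP => _ _ _; apply. Qed.
Lemma G_mul g h : G g -> G h -> G (g *m h). Proof. by case: GP => _ _ + _; apply. Qed.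
Lemma H_inv h : H h -> H (invmx h). Proof. by case: HP => _ _ _; apply. Qed.
Lemma H_mul g h : H g -> H h -> H (g *m h). Proof. by case: HP => _ _ + _; apply. Qed.
Lemma H1 : H 1%:M. Proof. by case: HP. Qed.
Lemma G_det g : G g -> v (\det g) = 1.
Proof. by move=> /detG; exact: Oinf_units_absF. Qed.

(** A coset contains its generator, so [xget] never falls back on its default, and any of its
    elements generates it. *)
Lemma rcoset_repr X : rcosets_of H G X ->
  exists g, [/\ xget 1%:M X = g, G g & X = rcoset_of H g].
Proof.
move=> [g Gg <-]; exists (xget 1%:M (rcoset_of H g)).
have [x _ [h Hh hx]|/(_ g)] := xgetP 1%:M (rcoset_of H g); last first.
  by case; exists 1%:M; [exact H1|rewrite mul1mx].
rewrite -hx; have hU := G_unit (HG Hh); split; first by [].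
  exact (G_mul (HG Hh) Gg).
apply/seteqP; split=> _ [h' Hh' <-].
  exists (h' *m invmx h); first exact (H_mul Hh' (H_inv Hh)).
  by rewrite mulmxA (mulmxKV hU).
by exists (h' *m h); [exact (H_mul Hh' Hh)|rewrite mulmxA].
Qed.

Lemma ends_matrices : exists hh : 'I_r -> 'M[F]_2, forall i,
  [/\ hh i \in unitmx, mobP1 (hh i) (Some 0) = a i & mobP1 (hh i) None = b i].
Proof.
have /choice[hh hhP] i : exists h, [/\ h \in unitmx, mobP1 h (Some 0) = a i &
    mobP1 h None = b i] by exact (mobP1_two (@ab i)).
by exists hh.
Qed.

Variable hh : 'I_r -> 'M[F]_2.
Hypothesis hhP : forall i,
  [/\ hh i \in unitmx, mobP1 (hh i) (Some 0) = a i & mobP1 (hh i) None = b i].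

Lemma hhU i : hh i \in unitmx. Proof. by case: (hhP i). Qed.

Definition weight g z : R := \prod_(i < r) (zdefect (mob g z) (hh i))^-1 ^+ k i.

Lemma term_weight g z : G g -> Omega z ->
  absC (poincare_term l k a b g z) * imabs z ^+ d = weight g z.
Proof.
move=> Gg Oz; have gU := G_unit Gg; have Ogz := Omega_mob gU Oz.
rewrite /poincare_term absCM.
have -> : absC (emb C (\det g ^ l)) = 1.
  by rewrite absC_emb avXz (G_det Gg) exp1rz.
rewrite mul1r expr_sum.
rewrite (big_morph absC (@absCM R K C) (absC1 C)) -big_split /=.
apply: eq_bigr => i _; rewrite absCX -exprMn (pullback_imabs _ gU Oz).
by case: (hhP i) => hU <- <-; rewrite (sform_zdefect hU Ogz).
Qed.

Lemma zdefectV01 g z i : G g -> Omega z -> 0 < (zdefect (mob g z) (hh i))^-1 <= 1.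
Proof.
move=> Gg Oz; have Ogz := Omega_mob (G_unit Gg) Oz.
have d1 := zdefect_ge1 lamP (hhU i) Ogz.
by rewrite invr_gt0 invf_le1 ?d1 (lt_le_trans ltr01 d1).
Qed.

Lemma factor01 g z i : G g -> Omega z ->
  0 <= (zdefect (mob g z) (hh i))^-1 ^+ k i <= 1.
Proof.
move=> Gg Oz; have /andP[i0 i1] := zdefectV01 i Gg Oz.
by rewrite exprn_ge0 ?exprn_ile1// ltW.
Qed.

Lemma weight_le g z i : G g -> Omega z -> weight g z <= (zdefect (mob g z) (hh i))^-1.
Proof.
move=> Gg Oz; have /andP[i0 i1] := zdefectV01 i Gg Oz.
rewrite /weight (bigD1 i)//=.
apply: (@le_trans _ _ ((zdefect (mob g z) (hh i))^-1 ^+ k i)).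
  apply: ler_piMr; first by rewrite exprn_ge0// ltW.
  by apply: prodr_ile1 => j _; exact: factor01.
case: (k i) (kP i) => // n _; rewrite exprS; apply: ler_piMr; first exact: ltW.
by rewrite exprn_ile1// ltW.
Qed.

(** A lower bound on a term bounds every [zdefect] factor, so the translate of a fixed vertex near
    [lam z] stays close to all the geodesics; condition (P) leaves finitely many cosets. *)
Lemma null_terms z : Omega z -> forall e : R, 0 < e ->
  finite_set [set X | rcosets_of H G X /\ e < absC (term X z)].
Proof.
move=> Oz e e0; have iz := imabs_gt0 Oz; have q0 := avq_gt0 v.
have [u uV near] := lam_near_vertex lamP Oz.
have ez0 : 0 < e * imabs z ^+ d by rewrite mulr_gt0// exprn_gt0.
have [n nP] := q_pow_small C ez0.
apply: sub_finite_set (condP uV n.+1) => X [/rcoset_repr[g [-> Gg eX]] big].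
exists g; split=> // i; have gU := G_unit Gg; have [hU <- <-] := hhP i.
apply: (near g (hh i) n gU hU); have Ogz := Omega_mob gU Oz.
have d1 := zdefect_ge1 lamP (hhU i) Ogz.
have d0 : 0 < zdefect (mob g z) (hh i) by apply: lt_le_trans d1.
rewrite -lef_pV2 ?posrE ?exprn_gt0//; apply: le_trans (weight_le i Gg Oz).
rewrite -(term_weight Gg Oz); apply: ltW; apply: lt_trans nP _.
by rewrite ltr_pM2r// exprn_gt0.
Qed.

Lemma poincare_has_sum z : Omega z -> has_sum (rcosets_of H G) (fun X => term X z) (P z).
Proof. by move=> Oz; apply: usum_has_sum; apply: null_has_sum; exact: null_terms. Qed.

Lemma weight1_geodesics g z : G g -> Omega z -> weight g z = 1 ->
  (\bigcap_(i in [set: 'I_r]) geodesic (a i) (b i)) (lam (mob g z)).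
Proof.
move=> Gg Oz w1 i _; have [hU <- <-] := hhP i.
have Ogz := Omega_mob (G_unit Gg) Oz; apply/(lam_geodesicP lamP hU Ogz).
have /andP[i0 i1] := zdefectV01 i Gg Oz.
have : 1 <= (zdefect (mob g z) (hh i))^-1 by rewrite -w1; exact: weight_le.
by move=> le1; apply: invr_inj; rewrite invr1; apply/eqP; rewrite eq_le i1.
Qed.

(** The last hypothesis says that only elements of [H] keep [lam y] on all the geodesics, which
    makes the coset of [invmx g0] the only one of weight 1. *)
Lemma ord_translate_dominant g0 y : G g0 -> Omega y ->
  (\bigcap_(i in [set: 'I_r]) geodesic (a i) (b i)) (lam y) ->
  (forall g, G g -> (\bigcap_(i in [set: 'I_r]) geodesic (a i) (b i)) (lam (mob g y)) -> H g) ->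
  ord_form d P (mob g0 y) = 0%E.
Proof.
move=> Gg0 Oy ly stab; have g0U := G_unit Gg0; set z := mob g0 y.
have Oz : Omega z := Omega_mob g0U Oy; have iz := imabs_gt0 Oz.
have iz0 : 0 < imabs z ^+ d by rewrite exprn_gt0.
pose X0 := rcoset_of H (invmx g0).
have DX0 : rcosets_of H G X0 by exists (invmx g0) => //; exact: G_inv.
have move_z g : G g -> mob g z = mob (g *m g0) y.
  by move=> Gg; rewrite /z (mobM _ g0U Oy).
have w0 : weight (xget 1%:M X0) z = 1.
  have [g [-> Gg eX]] := rcoset_repr DX0.
  have : X0 g by rewrite eX; exists 1%:M; [exact H1|rewrite mul1mx].
  move=> [h Hh hg]; rewrite /weight big1// => i _.
  have hU := G_unit (HG Hh); have hVU := unitmxV hU.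
  (* The chosen representative is [h *m invmx g0] with [h] in [H]; as [h] fixes all the ends, [h y]
     has the same defects as [y]. *)
  have -> : mob g z = mob h y by rewrite (move_z _ Gg) -hg (mulmxKV g0U).
  have [hiU ha hb] := hhP i; have hhVU := unitmxM hVU hiU.
  have -> : zdefect (mob h y) (hh i) = 1; last by rewrite invr1 expr1n.
  rewrite -[X in zdefect _ X](mulKVmx hU) (zdefect_mob hU hhVU Oy).
  apply/(lam_geodesicP lamP hhVU Oy).
  have [ea eb] := Hab i (H_inv Hh).
  by rewrite !(mobP1M _ hVU hiU) ha hb ea eb; exact: ly.
have weightX X : rcosets_of H G X ->
    absC (term X z) * imabs z ^+ d = weight (xget 1%:M X) z.
  by move=> /rcoset_repr[g [-> Gg _]]; exact: term_weight.
have e0 : absC (term X0 z) * imabs z ^+ d = 1 by rewrite weightX.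
have t0 : term X0 z != 0.
  by rewrite -(absC_gt0 (term X0 z)) -(pmulr_lgt0 _ iz0) e0 ltr01.
apply: ord_form_eq0 => //.
rewrite (has_sum_dominant DX0 t0 (poincare_has_sum Oz)) ?e0//.
move=> X DX XX0; rewrite -(ltr_pM2r iz0) e0 weightX//.
have [g [-> Gg eX]] := rcoset_repr DX.
have w1 : weight g z <= 1.
  by apply: prodr_ile1 => i _; exact: factor01.
(* Weight 1 would put the image of [y] under [g *m g0] on all the geodesics, hence [g *m g0] in [H]
   and [X] equal to [X0]. *)
rewrite lt_neqAle w1 andbT; apply/eqP => w1e; apply: XX0.
have := weight1_geodesics Gg Oz w1e; rewrite (move_z _ Gg) => /(stab _ (G_mul Gg Gg0)) Hgg.
have ggU := G_unit (HG Hgg).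
rewrite eX; apply/seteqP; split=> _ [h Hh <-].
  exists (h *m (g *m g0)); first exact (H_mul Hh Hgg).
  by rewrite -!mulmxA (mulmxV g0U) mulmx1.
exists (h *m invmx (g *m g0)); first exact (H_mul Hh (H_inv Hgg)).
by rewrite (invmxM2 (G_unit Gg) g0U) (mulmxA h) (mulmxKV (G_unit Gg)).
Qed.

Lemma ord_off_geodesics z : Omega z ->
  (forall g, G g -> ~ (\bigcap_(i in [set: 'I_r]) geodesic (a i) (b i)) (lam (mob g z))) ->
  ((tp (lam z))%:E <= ord_form d P z)%E.
Proof.
move=> Oz off; have iz := imabs_gt0 Oz; have q0 := avq_gt0 v.
have iz0 : 0 < imabs z ^+ d by rewrite exprn_gt0.
rewrite ord_form_ge// -ler_pdivlMr//; apply: (has_sum_le _ (poincare_has_sum Oz)).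
  by rewrite divr_gt0// powR_gt0.
move=> X /rcoset_repr[g [-> Gg _]]; rewrite ler_pdivlMr// (term_weight Gg Oz).
have gU := G_unit Gg; have Ogz := Omega_mob gU Oz.
have [i zi] : exists i, zdefect (mob g z) (hh i) != 1.
  apply: contrapT => n; apply: (off g Gg) => i _; have [hU <- <-] := hhP i.
  apply/(lam_geodesicP lamP hU Ogz); apply: contrapT => zi; apply: n; exists i.
  exact/eqP.
apply: le_trans (weight_le i Gg Oz) _.
(* The bound involves [tp] at [lam z] itself, so [g] is moved from the point to the geodesic before
   the gap is used. *)
have hVU := unitmxM (unitmxV gU) (hhU i).
have e : zdefect (mob g z) (hh i) = zdefect z (invmx g *m hh i).
  by rewrite -[X in zdefect _ X](mulKVmx gU) (zdefect_mob gU hVU Oz).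
rewrite e in zi *; have gap := zdefect_gap lamP hVU Oz zi.
by rewrite powRN lef_pV2 ?posrE ?powR_gt0// (lt_le_trans _ gap)// powR_gt0.
Qed.

End PoincareSeries.

Theorem theorem3p3p2 (R : realType) (K : finFieldType) (C : Cinfty R K)
    (lam : C -> tpoint R K) (G H : set 'M[laurent K]_2)
    (r : nat) (l : int) (k : 'I_r -> nat) (a b : 'I_r -> P1 K)
    (v w : vert K) :
  odd #|K| ->
  building_map lam ->
  GL2_subgroup G ->
  discrete_in_GL2 C G ->
  (forall g, G g -> Oinf_units (\det g)) ->
  GL2_subgroup H ->
  H `<=` G ->
  (forall h, H h -> \det h ^ l = 1) ->
  (2 <= r)%N ->
  (forall i, (1 <= k i)%N) ->
  (forall i, a i <> b i) ->
  (forall i j, i <> j -> [set a i; b i] <> [set a j; b j]) ->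
  (forall h i, H h -> mobP1 h (a i) = a i /\ mobP1 h (b i) = b i) ->
  conditionP R G H a b ->
  adj v w ->
  \bigcap_(i in [set: 'I_r]) geodesic (a i) (b i)
    = open_edge v w `|` [set vpoint R v; vpoint R w] ->
  [set g | G g /\ act_vert g v = v] `<=` H ->
  let P : C -> C := poincare G H l k a b in
  let d := (\sum_(i < r) k i)%N in
  let Omega_v := Omega `&` lam @^-1` [set vpoint R v] in
  let Omega_w := Omega `&` lam @^-1` [set vpoint R w] in
  let Omega_e := Omega `&` lam @^-1` open_edge v w in
  [/\ forall z, Omega z -> orbit_of G (Omega_v `|` Omega_e) z ->
        ord_form d P z = 0%E,
      forall z, Omega z -> ~ orbit_of G (Omega_v `|` Omega_e `|` Omega_w) z ->
        0 < tp (lam z) /\ ((tp (lam z))%:E <= ord_form d P z)%E,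
      exists2 z, Omega z & P z <> 0
    & [set g | G g /\ act_vert g w = w] `<=` H ->
      forall z, Omega z -> orbit_of G Omega_w z -> ord_form d P z = 0%E].
Proof.
move=> _ lamP GP _ detG HP HG _ _ kP ab _ Hab condP vw capE stabv P d Omega_v Omega_w Omega_e.
have [hh hhP] := ends_matrices ab.
(* Stated for an arbitrary orientation of the edge: it serves for [v] with the open edge, and with
   the endpoints exchanged for [w]. *)
have near (u u' : vert K) : adj u u' ->
    \bigcap_(i in [set: 'I_r]) geodesic (a i) (b i) = @closed_edge R K u u' ->
    [set g | G g /\ act_vert g u = u] `<=` H ->
    forall g y, G g -> Omega y -> ([set vpoint R u] `|` open_edge u u') (lam y) ->
    ord_form d P (mob g y) = 0%E.
  move=> uu' cap stab g y Gg Oy ly.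
  apply: (ord_translate_dominant l lamP GP detG HP HG kP Hab condP hhP Gg Oy).
    by rewrite cap; case: ly => [->|ey]; [right; left|left].
  move=> g' Gg'; rewrite cap (lam_mob lamP (G_unit GP Gg') Oy) => ce.
  apply: stab; split; first exact Gg'.
  exact (edge_stabilizer (G_unit GP Gg') (G_det C detG Gg') uu' ly ce).
have part1 z : orbit_of G (Omega_v `|` Omega_e) z -> ord_form d P z = 0%E.
  move=> [g [y [Gg ye ->]]]; apply: (near v w vw capE stabv g y Gg).
    by case: ye => -[].
  by case: ye => -[_ ly]; [left|right].
split.
- by move=> z _; exact: part1.
- move=> z Oz noz; split; first exact (tp_lam_gt0 lamP Oz).
  apply: (ord_off_geodesics l lamP GP detG HP HG kP condP hhP Oz) => g Gg.
  rewrite capE => ce; apply: noz; have gU := G_unit GP Gg.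
  exists (invmx g), (mob g z); split.
  + exact (G_inv GP Gg).
  + have Ogz := Omega_mob gU Oz.
    by case: ce => [e|[e|e]]; [left; right|left; left|right]; split.
  + by rewrite -(mobM _ gU Oz) (mulVmx gU) mob1.
(* Over the open edge the form has order 0, whereas a zero coefficient would have order [+oo]. *)
- have [z Oz ze] := open_edge_hit lamP vw; exists z => // Pz0.
  have : ord_form d P z = 0%E.
    apply: part1; exists 1%:M, z; split; last by rewrite mob1.
      by case: GP.
    by right; split.
  rewrite /ord_form Pz0 (_ : ord 0 = +oo%E); first by [].
  exact/ord_eqy.
- move=> stabw z _ [g [y [Gg [Oy ly] ->]]].
  have capE' : \bigcap_(i in [set: 'I_r]) geodesic (a i) (b i) = @closed_edge R K w v.
    by rewrite closed_edgeC.
  by apply: (near w v (adj_sym C vw) capE' stabw g y Gg Oy); left.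
Qed.
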